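(* Let $n\ge 1$ be an integer, $r\in[0,1)$, $p\in[1,+\infty)$ and $\beta>-1$. Then $$C_{n,r}(H^p,H^\infty)\asymp\left(\frac{n}{1-r}\right)^{\frac1p}$$ with constants depending only on $p$, and $$C_{n,r}\left(A^p(\beta),H^\infty\right)\asymp\left(\frac{n}{1-r}\right)^{\frac{2+\beta}{p}}$$ with constants depending only on $p$ and $\beta$.
   Context: $\mathbb{D}=\{z\in\mathbb{C}:|z|<1\}$ and $\mathcal{H}ol(\mathbb{D})$ is the space of holomorphic functions on $\mathbb{D}$. $H^p=H^p(\mathbb{D})$, $1\le p\le\infty$, are the usual Hardy spaces with their standard norms ($\|\cdot\|_\infty$ for $H^\infty$). For $1\le p<\infty$ and $\beta>-1$, the radial-weighted Bergman space $A^p(\beta)$ consists of $f\in\mathcal{H}ol(\mathbb{D})$ with $$\|f\|_{A^p(\beta)}^p=\int_{\mathbb{D}}|f(z)|^p(1-|z|^2)^\beta\,d\mathcal{A}(z)<\infty,$$ where $\mathcal{A}$ is the normalized area measure on $\mathbb{D}$. For a Banach space $X\subset\mathcal{H}ol(\mathbb{D})$ and a finite sequence $\sigma\in\mathbb{D}^n$ (points may be repeated), put $$c(\sigma,X,H^\infty)=\sup_{f\in X,\ \|f\|_X\le1}\ \inf\{\|g\|_\infty:\ g\in H^\infty,\ g|_\sigma=f|_\sigma\},$$ where $g|_\sigma=f|_\sigma$ is understood with multiplicities: if a point $\lambda$ occurs $m$ times in $\sigma$, then $g-f$ vanishes at $\lambda$ to order at least $m$. For $n\ge1$ and $r\in[0,1)$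 put $$C_{n,r}(X,H^\infty)=\sup\{c(\sigma,X,H^\infty):\ \sigma\in\mathbb{D}^n,\ \max_{\lambda\in\sigma}|\lambda|\le r\}.$$ The notation $a\asymp b$ means that there are positive constants $c_1,c_2$ (here depending only on the indicated parameters, not on $n$ and $r$) such that $c_1 b\le a\le c_2 b$. *)

(* Defs.v *)
From mathcomp Require Import all_boot all_order all_algebra.
From mathcomp Require Import complex.
From mathcomp Require Import all_classical all_reals all_analysis.
Import Order.TTheory GRing.Theory Num.Theory numFieldNormedType.Exports.

Set Implicit Arguments.
Unset Strict Implicit.
Unset Printing Implicit Defensive.

Local Open Scope classical_set_scope.
Local Open Scope complex_scope.
Local Open Scope ring_scope.

(* The norm [`|z|] of [z : R[i]] is itself an element of [R[i]]; [cmod z] is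
   the same modulus as an element of [R]. *)
Definition cmod (R : realType) (z : R[i]) : R := complex.Re `|z|.

Definition unit_disc (R : realType) : set R[i] := [set z | cmod z < 1].

(* Functions on the disc are represented by total functions on [R[i]]; nothing
   below depends on their values outside the disc. *)
Definition holomorphic (R : realType) (f : R[i] -> R[i]) : Prop :=
  forall z : R[i], unit_disc z -> derivable (f : R[i]^o -> R[i]^o) z 1.

Definition Hinf_norm (R : realType) (g : R[i] -> R[i]) : \bar R :=
  ereal_sup [set (cmod (g z))%:E | z in @unit_disc R].

Definition Hinf (R : realType) : set (R[i] -> R[i]) :=
  [set g | holomorphic g /\ (Hinf_norm g < +oo)%E].

Definition circle_point (R : realType) (rho theta : R) : R[i] :=
  (rho * cos theta) +i* (rho * sin theta).

Definition Hardy_norm (R : realType) (p : R) (f : R[i] -> R[i]) : \bar R :=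
  ereal_sup [set (((pi *+ 2)^-1)%:E *
      \int[lebesgue_measure]_(theta in `[0%R, (pi *+ 2)%R])
        (cmod (f (circle_point rho theta)) `^ p)%:E) `^ p^-1
    | rho in `[0%R, 1%R[ ]%E.

Definition Hardy (R : realType) (p : R) : set (R[i] -> R[i]) :=
  [set f | holomorphic f /\ (Hardy_norm p f < +oo)%E].

Definition Bergman_norm (R : realType) (p beta : R) (f : R[i] -> R[i]) :
    \bar R :=
  ((pi^-1)%:E *
    \int[(lebesgue_measure \x lebesgue_measure)%E]_(w in
          [set w : R * R | unit_disc (w.1 +i* w.2)])
      (cmod (f (w.1 +i* w.2)) `^ p *
       (1 - cmod (w.1 +i* w.2) ^+ 2) `^ beta)%:E)%E `^ p^-1.

Definition Bergman (R : realType) (p beta : R) : set (R[i] -> R[i]) :=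
  [set f | holomorphic f /\ (Bergman_norm p beta f < +oo)%E].

(* Order at least [m]: the cofactor [k] may itself vanish at [a]. *)
Definition vanishes_to_order (R : realType) (m : nat) (h : R[i] -> R[i])
    (a : R[i]) : Prop :=
  exists2 k : R[i] -> R[i], holomorphic k &
    forall z, unit_disc z -> h z = (z - a) ^+ m * k z.

Definition agree_on (R : realType) (n : nat) (sigma : n.-tuple R[i])
    (g f : R[i] -> R[i]) : Prop :=
  forall a, a \in sigma ->
    vanishes_to_order (count_mem a sigma) (fun z => g z - f z) a.

Definition interp_const (R : realType) (n : nat) (sigma : n.-tuple R[i])
    (X : set (R[i] -> R[i])) (normX : (R[i] -> R[i]) -> \bar R) : \bar R :=
  ereal_sup [set ereal_inf [set Hinf_norm g
                           | g in [set g | Hinf g /\ agree_on sigma g f]]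
            | f in [set f | X f /\ (normX f <= 1)%E]].

Definition C_nr (R : realType) (n : nat) (r : R)
    (X : set (R[i] -> R[i])) (normX : (R[i] -> R[i]) -> \bar R) : \bar R :=
  ereal_sup [set interp_const sigma X normX
            | sigma in [set sigma : n.-tuple R[i] |
                forall a, a \in sigma -> unit_disc a /\ cmod a <= r]].

(* Main.v *)
(** Put [A = n / (1 - r)] and [s = 1 - 1 / A].

    Upper bounds.  Let [B] be the Blaschke product of [sigma], write
    [B(t) - B(z) = (t - z) q(z, t)], and let [rho] satisfy [1 - rho <= c / A].
    With [t'] the conjugate of [t], the function [g] whose value at [z] is the
    mean over [|t| = rho] of
    [f(t) t (q(z, t) / B(t) + (B(z) / B(t)) s t' / (1 - s t' z))]
    is holomorphic in the disc, and [f - g] is a multiple of [B] by Cauchy's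
    formula.  Adding [s z' / (1 - s z' t)] to the bracket does not change [g],
    and makes the kernel smaller than a constant times the Poisson-like kernel
    [(1 - s |z|^2) / |1 - s z' t|^2], which has mean at most [1] and maximum at
    most [2 A].  Hence [|g| <= C (A m)^(1/p)], where [m] is the mean of [|f|^p] over
    [|t| = rho].  For [H^p] one has [m <= 1]; for [A^p(beta)], polar coordinates
    yield a radius [rho] with [m <= C A^(1 + beta)].

    Lower bounds.  Take [f = c / (1 - s z)^N] and [sigma = (r, ..., r)].  If [g]
    interpolates [f], composing with the disc automorphism that moves [r] to [0]
    turns [g] into a polynomial with nonnegative coefficients plus a multiple of
    [w^n]; testing against a Fejer kernel bounds [sup |g|] from below by
    [(c / 4) (A / (16 N))^N].  The norm of [f] is estimated circle by circle. *)

Require Import Defs.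
From mathcomp Require Import all_boot all_order all_algebra.
From mathcomp Require Import complex.
From mathcomp Require Import all_classical all_reals all_analysis.
From mathcomp Require Import measurable_realfun.
From mathcomp Require Import ring lra zify.
Import Order.TTheory GRing.Theory Num.Theory numFieldNormedType.Exports.

Set Implicit Arguments.
Unset Strict Implicit.
Unset Printing Implicit Defensive.

Local Open Scope classical_set_scope.
Local Open Scope complex_scope.
Local Open Scope ring_scope.

(** * Modulus and complex differentiability *)

(** Everything is reduced to means over circles centred at [0]. The only contour theorem needed is
    therefore Cauchy's theorem for [f w / w] on polar sectors, by bisecting the rectangle of radii
    and angles; holomorphy is mere complex differentiability, with no continuity of the derivative.
    The obstacle in the upper bound is a logarithm. The kernel [q / B] is of size [A] but decays
    only like [1 / |t - z|], which bounds its mean by a multiple of [log A]. With the two correction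
    terms, [(t - z) K] is a difference of two terms, with numerators [1 - s |z|^2] and [1 - s |t|^2]
    and denominators of modulus [|1 - s z' t|]; so [K] decays quadratically. A mean [O(1)] and a
    maximum [O(A)] then combine to the power [1/p]. The choice of [s] keeps the poles of the
    corrections at distance about [1/A] from the disc. In the lower bound, [N] must be large enough
    for the norm of the pole to be governed by the scale [1/A]. The same [s] works since, once [r]
    is moved to [0], the pole lies within [O(1/n)] of the circle: about [n / (4 N)] Taylor
    coefficients are at least [1/2], and positivity allows the others to be dropped. *)

Section Modulus.
Variable R : realType.
Implicit Types (z w : R[i]) (x y : R).

Lemma normc_cmod z : `|z| = (cmod z)%:C.
Proof. by rewrite /cmod normc_def. Qed.

Lemma cmodE z : cmod z = Num.sqrt (complex.Re z ^+ 2 + complex.Im z ^+ 2).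
Proof. by rewrite /cmod normc_def. Qed.

Lemma cmod_ge0 z : 0 <= cmod z.
Proof. by rewrite cmodE sqrtr_ge0. Qed.

Lemma cmodM z w : cmod (z * w) = cmod z * cmod w.
Proof.
by apply: (@complexI R); rewrite rmorphM/= -!normc_cmod normrM.
Qed.

Lemma cmod_real x : cmod x%:C = `|x|.
Proof. by rewrite cmodE/= expr0n addr0 sqrtr_sqr. Qed.

Lemma cmod0 : cmod (0 : R[i]) = 0.
Proof. by rewrite (_ : 0 = (0:R)%:C)// cmod_real normr0. Qed.

Lemma cmod1 : cmod (1 : R[i]) = 1.
Proof. by rewrite (_ : 1 = (1:R)%:C)// cmod_real normr1. Qed.

Lemma cmod_eq0 z : (cmod z == 0) = (z == 0).
Proof.
apply/eqP/eqP => [h|->]; last exact: cmod0.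
by apply/eqP; rewrite -normr_eq0 normc_cmod h.
Qed.

Lemma cmod_gt0 z : (0 < cmod z) = (z != 0).
Proof. by rewrite lt_neqAle cmod_ge0 andbT eq_sym cmod_eq0. Qed.

Lemma cmodN z : cmod (- z) = cmod z.
Proof. by rewrite /cmod normrN. Qed.

Lemma cmodB z w : cmod (z - w) = cmod (w - z).
Proof. by rewrite /cmod distrC. Qed.

Lemma cmodV z : cmod z^-1 = (cmod z)^-1.
Proof.
by apply: (@complexI R); rewrite fmorphV/= -!normc_cmod normfV.
Qed.

Lemma cmodX z n : cmod (z ^+ n) = cmod z ^+ n.
Proof.
by apply: (@complexI R); rewrite rmorphXn/= -!normc_cmod normrX.
Qed.

Lemma cmodJ z : cmod z^* = cmod z.
Proof. by rewrite /cmod normcJ. Qed.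

Lemma ler_cmodD z w : cmod (z + w) <= cmod z + cmod w.
Proof. by rewrite -lecR rmorphD/= -!normc_cmod ler_normD. Qed.

Lemma ler_cmodB z w : cmod (z - w) <= cmod z + cmod w.
Proof. by rewrite -(cmodN w) ler_cmodD. Qed.

Lemma ler_cmod_sub z w : cmod z - cmod w <= cmod (z - w).
Proof. by rewrite lerBlDr; apply: le_trans (ler_cmodD _ _); rewrite subrK. Qed.

Lemma ler_cmod_dist z w : `|cmod z - cmod w| <= cmod (z - w).
Proof.
by rewrite ler_norml ler_cmod_sub andbT lerNl opprB cmodB ler_cmod_sub.
Qed.

Lemma ler_Re_cmod z : `|complex.Re z| <= cmod z.
Proof. by rewrite -lecR -normc_cmod normc_ge_Re. Qed.

Lemma Re_le_cmod z : complex.Re z <= cmod z.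
Proof. exact: le_trans (ler_norm _) (ler_Re_cmod z). Qed.

Lemma ler_Im_cmod z : `|complex.Im z| <= cmod z.
Proof.
by rewrite cmodE -sqrtr_sqr ler_wsqrtr// lerDr sqr_ge0.
Qed.

Lemma cmod_le_ReIm z : cmod z <= `|complex.Re z| + `|complex.Im z|.
Proof.
have i1 : cmod (0 +i* 1 : R[i]) = 1 by rewrite cmodE/= expr0n expr1n add0r sqrtr1.
rewrite {1}(complexE z); apply: le_trans (ler_cmodD _ _) _.
by rewrite cmodM !cmod_real i1 mul1r.
Qed.

Lemma cmod_sqr z : cmod z ^+ 2 = complex.Re z ^+ 2 + complex.Im z ^+ 2.
Proof. by rewrite cmodE sqr_sqrtr// addr_ge0 ?sqr_ge0. Qed.

Lemma mulcJ z : z * z^* = (cmod z ^+ 2)%:C.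
Proof. by rewrite -sqr_normc normc_cmod rmorphXn. Qed.

(** Balls of [R[i]^o] have radii in [R[i]]; a positive element there has zero imaginary part, so
    real radii describe the same topology. *)
Lemma nbhs_cmodP z (A : set R[i]^o) :
  nbhs (z : R[i]^o) A <-> exists2 e : R, 0 < e &
    forall w, cmod (w - z) < e -> A w.
Proof.
split.
  move=> /nbhs_ballP[e/= e0 eA].
  have [Ime Ree] : complex.Im e = 0 /\ 0 < complex.Re e.
    by move: e0; rewrite ltcE/= => /andP[/eqP <-].
  exists (complex.Re e) => // w we; apply: eA; rewrite /ball/= normc_cmod ltcE/=.
  by rewrite Ime eqxx/= cmodB.
move=> [e e0 eA]; apply/nbhs_ballP; exists e%:C; first by rewrite /= ltcR.
by move=> w; rewrite /ball/= normc_cmod ltcR cmodB; exact: eA.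
Qed.

Lemma cvg_cmodP (T : Type) (F : set_system T) (FF : Filter F) (f : T -> R[i]^o) z :
  f @ F --> (z : R[i]^o) <-> forall e : R, 0 < e -> \forall t \near F, cmod (f t - z) < e.
Proof.
split=> [fz e e0|fz A /nbhs_cmodP[e e0 eA]].
  apply: (fz [set w | cmod (w - z) < e]).
  by apply/nbhs_cmodP; exists e.
by move: (fz e e0); apply: filterS => t; exact: eA.
Qed.

End Modulus.

(** * Continuity and complex differentiability in terms of the real modulus *)

Section ModulusTopology.
Variable R : realType.
Implicit Types (z w : R[i]) (x y : R).

Lemma cvg_realP (T : Type) (F : set_system T) (FF : Filter F) (f : T -> R) (y : R) :
  f @ F --> y <-> forall e : R, 0 < e -> \forall t \near F, `|f t - y| < e.
Proof.
split=> [/cvgrPdist_lt H e e0|H]; last apply/cvgrPdist_lt => e e0.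
  by move: (H e e0); apply: filterS => t; rewrite distrC.
by move: (H e e0); apply: filterS => t; rewrite distrC.
Qed.

Lemma continuous_cmod : continuous (fun z : R[i]^o => cmod z : R).
Proof.
move=> z; apply/(@cvg_realP _ (nbhs (z : R[i]^o))) => e e0.
apply/nbhs_cmodP; exists e => // w we.
have h := ler_cmod_dist w z; exact: le_lt_trans h we.
Qed.

Lemma continuous_Re : continuous (fun z : R[i]^o => complex.Re z : R).
Proof.
move=> z; apply/(@cvg_realP _ (nbhs (z : R[i]^o))) => e e0.
apply/nbhs_cmodP; exists e => // w we.
suff h : `|complex.Re w - complex.Re z| <= cmod (w - z) by exact: le_lt_trans h we.
by have := ler_Re_cmod (w - z); case: w z {we} => [a b] [c d].
Qed.

Lemma continuous_Im : continuous (fun z : R[i]^o => complex.Im z : R).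
Proof.
move=> z; apply/(@cvg_realP _ (nbhs (z : R[i]^o))) => e e0.
apply/nbhs_cmodP; exists e => // w we.
suff h : `|complex.Im w - complex.Im z| <= cmod (w - z) by exact: le_lt_trans h we.
by have := ler_Im_cmod (w - z); case: w z {we} => [a b] [c d].
Qed.

Lemma continuous_conjc : continuous (fun z : R[i]^o => z^* : R[i]^o).
Proof.
move=> z; apply/(@cvg_cmodP _ _ (nbhs (z : R[i]^o))) => e e0.
apply/nbhs_cmodP; exists e => // w we.
by rewrite -rmorphB cmodJ.
Qed.

Lemma cvg_complex (T : Type) (F : set_system T) (FF : Filter F) (a b : T -> R) (x y : R) :
  a @ F --> x -> b @ F --> y ->
  (fun t => a t +i* b t : R[i]^o) @ F --> (x +i* y : R[i]^o).
Proof.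
move=> ax by_; apply/cvg_cmodP => e e0.
have e20 : 0 < e / 2 by rewrite divr_gt0.
have h1 := (cvg_realP FF a x).1 ax _ e20.
have h2 := (cvg_realP FF b y).1 by_ _ e20.
apply: (@filterS _ _ FF _ _ _ (filterI h1 h2)) => t [p q].
by apply: le_lt_trans (cmod_le_ReIm _) _ => /=; rewrite (splitr e) ltrD.
Qed.

Lemma continuous_cmodP (f : R[i] -> R[i]) z :
  {for z, continuous (f : R[i]^o -> R[i]^o)} <-> forall e : R, 0 < e ->
  exists2 del : R, 0 < del & forall w, cmod (w - z) < del -> cmod (f w - f z) < e.
Proof.
split=> [fz e e0|H].
  have H : nbhs (z : R[i]^o) [set w | cmod (f w - f z) < e] by exact: ((cvg_cmodP _ _ _).1 fz e e0).
  exact: (nbhs_cmodP _ _).1 H.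
apply/(@cvg_cmodP _ _ (nbhs (z : R[i]^o))) => e e0; apply/nbhs_cmodP.
exact: H.
Qed.

Definition hol_at (f : R[i] -> R[i]) z := derivable (f : R[i]^o -> R[i]^o) z 1.

Lemma hol_at_continuous f z : hol_at f z -> {for z, continuous (f : R[i]^o -> R[i]^o)}.
Proof. by move=> /derivable1_diffP/differentiable_continuous. Qed.

(** The expansion without division is trivially true at [w = z]; it is the form that composes, and
    the one from which Goursat's local estimate starts. *)
Lemma hol_atP f z : hol_at f z <-> exists d : R[i], forall e : R, 0 < e ->
  exists2 del : R, 0 < del & forall w, cmod (w - z) < del ->
    cmod (f w - f z - d * (w - z)) <= e * cmod (w - z).
Proof.
split.
  move=> /cvg_ex[d fd]; exists d => e e0.
  have H1 : nbhs (0 : R[i]^o) [set h | h != 0 ->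
      cmod (h^-1 *: ((f (h *: (1 : R[i]^o) + z) : R[i]^o) - f z) - d) < e].
    exact: ((cvg_cmodP _ _ _).1 fd e e0).
  have [del del0 {H1}H] := (nbhs_cmodP _ _).1 H1.
  exists del => // w wz; have [->|wz0] := eqVneq w z.
    by rewrite !subrr mulr0 subr0 cmod0 mulr0.
  have wz1 : w - z != 0 by rewrite subr_eq0.
  have := H (w - z); rewrite subr0 => /(_ wz wz1).
  rewrite /= /GRing.scale/= mulr1 subrK => h.
  rewrite (_ : _ - _ = ((w - z)^-1 * (f w - f z) - d) * (w - z)).
    by rewrite cmodM ler_wpM2r ?cmod_ge0// ltW.
  by rewrite mulrBl mulrAC mulVf// mul1r.
move=> [d H]; apply/cvg_ex; exists d; apply/cvg_cmodP => e e0.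
have [|del del0 {}H] := H (e / 2); first by rewrite divr_gt0.
apply: (nbhs_cmodP _ _).2; exists del => // h; rewrite subr0 => hd h0.
have := H (z + h); rewrite addrC addKr => /(_ hd) {}H.
rewrite /= /GRing.scale/= mulr1.
rewrite (_ : _ - d = h^-1 * (f (z + h) - f z - d * h)).
  rewrite cmodM cmodV ltr_pdivrMl ?cmod_gt0//.
  apply: le_lt_trans (H) _; rewrite mulrC ltr_pM2l ?cmod_gt0//.
  by rewrite ltr_pdivrMr// mulr_natr mulr2n ltrDl.
by rewrite (addrC h) [in RHS]mulrBr [d * h]mulrC mulKf.
Qed.

Lemma hol_at_cst c z : hol_at (fun=> c) z.
Proof. exact: derivable_cst. Qed.

Lemma hol_at_id z : hol_at (fun w => w) z.
Proof. exact: derivable_id. Qed.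

Lemma hol_atD f g z : hol_at f z -> hol_at g z -> hol_at (fun w => f w + g w) z.
Proof. exact: (@derivableD _ R[i]^o R[i]^o f g z 1). Qed.

Lemma hol_atB f g z : hol_at f z -> hol_at g z -> hol_at (fun w => f w - g w) z.
Proof. exact: (@derivableB _ R[i]^o R[i]^o f g z 1). Qed.

Lemma hol_atM f g z : hol_at f z -> hol_at g z -> hol_at (fun w => f w * g w) z.
Proof. exact: (@derivableM _ R[i]^o f g z 1). Qed.

Lemma hol_atV f z : f z != 0 -> hol_at f z -> hol_at (fun w => (f w)^-1) z.
Proof. exact: (@derivableV _ R[i]^o f z 1). Qed.

Lemma hol_atX f n z : hol_at f z -> hol_at (fun w => f w ^+ n) z.
Proof.
move=> fz; elim: n => [|n ih].
  by under eq_fun do rewrite expr0; exact: hol_at_cst.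
by under eq_fun do rewrite exprS; exact: hol_atM.
Qed.

Lemma hol_at_sum (I : Type) (s : seq I) (F : I -> R[i] -> R[i]) z :
  (forall i, hol_at (F i) z) -> hol_at (fun w => \sum_(i <- s) F i w) z.
Proof.
move=> Fz; elim: s => [|i s ih].
  by under eq_fun do rewrite big_nil; exact: hol_at_cst.
under eq_fun do rewrite big_cons.
exact: (hol_atD (Fz i) ih).
Qed.

Lemma hol_at_prod (I : eqType) (s : seq I) (F : I -> R[i] -> R[i]) z :
  (forall i, i \in s -> hol_at (F i) z) -> hol_at (fun w => \prod_(i <- s) F i w) z.
Proof.
elim: s => [|i s ih] Fz.
  by under eq_fun do rewrite big_nil; exact: hol_at_cst.
under eq_fun do rewrite big_cons.
have Fi : hol_at (F i) z by apply: Fz; rewrite mem_head.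
apply: (hol_atM Fi); apply: ih => j js; apply: Fz; rewrite inE js orbT//.
Qed.

Lemma hol_at_comp f g z : hol_at f z -> hol_at g (f z) -> hol_at (fun w => g (f w)) z.
Proof.
move=> /hol_atP[d1 H1] /hol_atP[d2 H2]; apply/hol_atP; exists (d2 * d1) => e e0.
have c1 : 0 < cmod d1 + 1 by rewrite ltr_wpDl// cmod_ge0.
have c2 : 0 < cmod d2 + 1 by rewrite ltr_wpDl// cmod_ge0.
have [|del2 del20 K2] := H2 (e / 2 / (cmod d1 + 1)); first by rewrite !divr_gt0.
(* The bound [1] makes [f] Lipschitz near [z] with constant [cmod d1 + 1]; the other bound leaves
   [e / 2] after multiplication by [d2]. *)
have [|del1 del10 K1] := H1 (Num.min 1 (e / 2 / (cmod d2 + 1))).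
  by rewrite lt_min ltr01 !divr_gt0.
exists (Num.min del1 (del2 / (cmod d1 + 1))); first by rewrite lt_min del10 divr_gt0.
move=> w; rewrite lt_min => /andP[wd1 wd2].
have fw : cmod (f w - f z) <= (cmod d1 + 1) * cmod (w - z).
  rewrite -(subrK (d1 * (w - z)) (f w - f z)); apply: le_trans (ler_cmodD _ _) _.
  rewrite cmodM mulrDl mul1r addrC lerD2l; apply: le_trans (K1 _ wd1) _.
  by rewrite -[leRHS]mul1r ler_wpM2r ?cmod_ge0// ge_min lexx.
have {}K2 := K2 (f w); have {K2}K2 : cmod (g (f w) - g (f z) - d2 * (f w - f z)) <=
    e / 2 * cmod (w - z).
  apply: le_trans (K2 _) _.
    by apply: le_lt_trans fw _; rewrite mulrC -ltr_pdivlMr.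
  have fw' : cmod (f w - f z) / (cmod d1 + 1) <= cmod (w - z).
    by rewrite ler_pdivrMr// mulrC.
  rewrite -mulrA ler_pM2l ?divr_gt0//.
  by rewrite mulrC.
rewrite (_ : g (f w) - g (f z) - d2 * d1 * (w - z) =
    g (f w) - g (f z) - d2 * (f w - f z) +
    d2 * (f w - f z - d1 * (w - z))); last by ring.
apply: le_trans (ler_cmodD _ _) _; rewrite (splitr e) mulrDl lerD//.
rewrite cmodM; apply: le_trans (ler_wpM2l (cmod_ge0 _) (K1 _ wd1)) _.
rewrite mulrA ler_wpM2r ?cmod_ge0//.
apply: (@le_trans _ _ (cmod d2 * (e / 2 / (cmod d2 + 1)))).
  by rewrite ler_wpM2l ?cmod_ge0// ge_min lexx orbT.
have k : cmod d2 / (cmod d2 + 1) <= 1 by rewrite ler_pdivrMr// mul1r lerDl.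
rewrite (_ : cmod d2 * (e / 2 / (cmod d2 + 1)) = e / 2 * (cmod d2 / (cmod d2 + 1))).
  by rewrite -[leRHS]mulr1 ler_wpM2l// divr_ge0// ltW.
by rewrite mulrCA mulrA.
Qed.

(** Differentiability is local; this serves functions defined by cases, which agree with one formula
    near each point. *)
Lemma hol_at_near f g z : (exists2 e : R, 0 < e & forall w, cmod (w - z) < e -> f w = g w) ->
  hol_at g z -> hol_at f z.
Proof.
move=> [e e0 fg] /hol_atP[d H]; apply/hol_atP; exists d => e1 e10.
have [del del0 {}H] := H e1 e10.
exists (Num.min del e); first by rewrite lt_min del0.
move=> w; rewrite lt_min => /andP[wd we]; rewrite (fg w)// (fg z) ?subrr ?cmod0//.
exact: H.
Qed.

End ModulusTopology.
Arguments hol_at {R}.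

Ltac hol_step :=
  match goal with
  | H : hol_at ?f _ |- hol_at ?g _ => constr_eq f g; exact H
  | H : hol_at ?f _ |- hol_at (fun w => ?g w) _ => constr_eq f g; exact H
  | H : is_true (?x != 0) |- is_true (?y != 0) => constr_eq x y; exact H
  | |- hol_at (fun w => w) ?z => exact (@hol_at_id _ z)
  | |- hol_at (fun w => ?c) ?z => exact (@hol_at_cst _ c z)
  | |- hol_at (fun w => @?f w - @?g w) ?z => refine (@hol_atB _ f g z _ _)
  | |- hol_at (fun w => @?f w + @?g w) ?z => refine (@hol_atD _ f g z _ _)
  | |- hol_at (fun w => @?f w * @?g w) ?z => refine (@hol_atM _ f g z _ _)
  | |- hol_at (fun w => (@?f w)^-1) ?z => refine (@hol_atV _ f z _ _)
  | |- hol_at (fun w => (@?f w) ^+ ?n) ?z => refine (@hol_atX _ f n z _)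
  end.
Ltac hol := repeat (hol_step; cbv beta).

(** * Integrals of complex-valued functions of a real variable *)

Section CircleIntegral.
Variable R : realType.
Implicit Types (a b c x y t : R) (z w : R[i]).
Notation mu := (@lebesgue_measure R).

(** Two-sided continuity at every point of the segment, endpoints included: stronger than continuity
    of the restriction, but inherited by subsegments without any subspace topology. *)
Definition cont_on (T : topologicalType) a b (h : R -> T) :=
  forall x, a <= x <= b -> {for x, continuous h}.

Definition cint a b (f : R -> R[i]) : R[i] :=
  (\int[mu]_(x in `[a, b]) complex.Re (f x))%R +i*
  (\int[mu]_(x in `[a, b]) complex.Im (f x))%R.

Lemma cont_on_integrable a b (h : R -> R) : cont_on a b h ->
  mu.-integrable `[a, b] (EFin \o h).
Proof.
move=> ch; apply: continuous_compact_integrable; first exact: segment_compact.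
apply: continuous_in_subspaceT => x; rewrite inE/= in_itv/= => xab; exact: ch.
Qed.

Lemma cont_on_Re a b (f : R -> R[i]^o) : cont_on a b f -> cont_on a b (fun x => complex.Re (f x)).
Proof.
move=> cf x xab; apply: (@continuous_comp _ _ _ f (fun z : R[i]^o => complex.Re z : R)).
  exact: cf.
exact: continuous_Re.
Qed.

Lemma cont_on_Im a b (f : R -> R[i]^o) : cont_on a b f -> cont_on a b (fun x => complex.Im (f x)).
Proof.
move=> cf x xab; apply: (@continuous_comp _ _ _ f (fun z : R[i]^o => complex.Im z : R)).
  exact: cf.
exact: continuous_Im.
Qed.

Lemma cont_on_cmod a b (f : R -> R[i]^o) : cont_on a b f -> cont_on a b (fun x => cmod (f x)).
Proof.
move=> cf x xab; apply: (@continuous_comp _ _ _ f (fun z : R[i]^o => cmod z : R)).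
  exact: cf.
exact: continuous_cmod.
Qed.

Lemma cont_on_conjc a b (f : R -> R[i]^o) :
  cont_on a b f -> cont_on a b (fun x => (f x)^* : R[i]^o).
Proof.
move=> cf x xab; apply: (@continuous_comp _ _ _ f (fun z : R[i]^o => z^* : R[i]^o)).
  exact: cf.
exact: continuous_conjc.
Qed.

Lemma cont_on_cst (T : topologicalType) a b (z : T) : cont_on a b (fun=> z).
Proof. by move=> x _; exact: cst_continuous. Qed.

Lemma cont_onD (K : numFieldType) a b (f g : R -> K^o) :
  cont_on a b f -> cont_on a b g -> cont_on a b (fun x => f x + g x : K^o).
Proof. by move=> cf cg x xab; exact: (cvgD (cf x xab) (cg x xab)). Qed.

Lemma cont_onN (K : numFieldType) a b (f : R -> K^o) :
  cont_on a b f -> cont_on a b (fun x => - f x : K^o).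
Proof. by move=> cf x xab; exact: (cvgN (cf x xab)). Qed.

Lemma cont_onB (K : numFieldType) a b (f g : R -> K^o) :
  cont_on a b f -> cont_on a b g -> cont_on a b (fun x => f x - g x : K^o).
Proof. by move=> cf cg x xab; exact: (cvgB (cf x xab) (cg x xab)). Qed.

Lemma cont_onM (K : numFieldType) a b (f g : R -> K^o) :
  cont_on a b f -> cont_on a b g -> cont_on a b (fun x => f x * g x : K^o).
Proof. by move=> cf cg x xab; exact: (cvgM (cf x xab) (cg x xab)). Qed.

Lemma cont_onZ a b z (f : R -> R[i]^o) :
  cont_on a b f -> cont_on a b (fun x => z * f x : R[i]^o).
Proof. by move=> cf; apply: (@cont_onM R[i] a b (fun=> z) f _ cf); exact: cont_on_cst. Qed.

Lemma cont_onV (K : numFieldType) a b (f : R -> K^o) : (forall x, a <= x <= b -> f x != 0) ->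
  cont_on a b f -> cont_on a b (fun x => (f x)^-1 : K^o).
Proof. by move=> f0 cf x xab; exact: (cvgV (f0 x xab) (cf x xab)). Qed.

Lemma cont_onX (K : numFieldType) a b (f : R -> K^o) n :
  cont_on a b f -> cont_on a b (fun x => f x ^+ n : K^o).
Proof.
move=> cf; elim: n => [|n ih].
  by under eq_fun do rewrite expr0; exact: cont_on_cst.
by under eq_fun do rewrite exprS; exact: cont_onM.
Qed.

Lemma eq_cint a b (f g : R -> R[i]) : (forall x, a <= x <= b -> f x = g x) ->
  cint a b f = cint a b g.
Proof.
move=> fg; congr (_ +i* _); apply: eq_Rintegral => x;
  by rewrite inE/= in_itv/= => xab; rewrite fg.
Qed.

Lemma cintD a b (f g : R -> R[i]^o) : cont_on a b f -> cont_on a b g ->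
  cint a b (fun x => f x + g x) = cint a b f + cint a b g.
Proof.
move=> cf cg; rewrite /cint.
have e x : complex.Re (f x + g x) = complex.Re (f x) + complex.Re (g x).
  by case: (f x) (g x) => ? ? [].
have e' x : complex.Im (f x + g x) = complex.Im (f x) + complex.Im (g x).
  by case: (f x) (g x) => ? ? [].
under eq_Rintegral do rewrite e.
under [X in _ +i* X]eq_Rintegral do rewrite e'.
rewrite !RintegralD//; apply: cont_on_integrable;
  first [exact: (cont_on_Re cf)|exact: (cont_on_Re cg)|exact: (cont_on_Im cf)|exact: (cont_on_Im cg)].
Qed.

Lemma cintZ a b z (f : R -> R[i]^o) : cont_on a b f ->
  cint a b (fun x => z * f x) = z * cint a b f.
Proof.
move=> cf; rewrite /cint; case: z => u v.
have iRe := cont_on_integrable (cont_on_Re cf).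
have iIm := cont_on_integrable (cont_on_Im cf).
have e x : complex.Re ((u +i* v) * f x) = u * complex.Re (f x) - v * complex.Im (f x).
  by case: (f x) => ? ?.
have e' x : complex.Im ((u +i* v) * f x) = u * complex.Im (f x) + v * complex.Re (f x).
  by case: (f x) => ? ?.
under eq_Rintegral do rewrite e.
under [X in _ +i* X]eq_Rintegral do rewrite e'.
have cc (k : R) (h : R -> R) : cont_on a b h -> mu.-integrable `[a, b] (EFin \o (fun x => k * h x)).
  by move=> ch; apply: cont_on_integrable; apply: (@cont_onM R) => //; exact: cont_on_cst.
rewrite RintegralB ?RintegralD ?RintegralZl//; try exact: cc (cont_on_Re cf);
  exact: cc (cont_on_Im cf).
Qed.

Lemma cintN a b (f : R -> R[i]^o) : cont_on a b f ->
  cint a b (fun x => - f x) = - cint a b f.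
Proof.
by move=> cf; rewrite -mulN1r -cintZ//; apply: eq_cint => x _; rewrite mulN1r.
Qed.

Lemma cintB a b (f g : R -> R[i]^o) : cont_on a b f -> cont_on a b g ->
  cint a b (fun x => f x - g x) = cint a b f - cint a b g.
Proof.
by move=> cf cg; have cNg := @cont_onN R[i] _ _ _ cg; rewrite (cintD cf cNg) (cintN cg).
Qed.

Lemma cint_conjc a b (f : R -> R[i]^o) : cont_on a b f ->
  cint a b (fun x => (f x)^*) = (cint a b f)^*.
Proof.
move=> cf; rewrite /cint /=.
have e x : complex.Re (f x)^* = complex.Re (f x) by case: (f x).
have e' x : complex.Im (f x)^* = (-1) * complex.Im (f x).
  by case: (f x) => u v /=; rewrite mulN1r.
under eq_Rintegral do rewrite e.
under [X in _ +i* X]eq_Rintegral do rewrite e'.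
by rewrite RintegralZl ?mulN1r//; exact: cont_on_integrable (cont_on_Im cf).
Qed.

Lemma cint_real a b (h : R -> R) :
  cint a b (fun x => (h x)%:C) = ((\int[mu]_(x in `[a, b]) h x)%R)%:C.
Proof.
by rewrite /cint/= Rintegral_cst// mul0r.
Qed.

Lemma Rint_cst a b (k : R) : a <= b ->
  (\int[mu]_(x in `[a, b]) k)%R = k * (b - a).
Proof.
move=> ab; rewrite Rintegral_cst//.
have -> // : fine (mu `[a, b]%classic) = b - a.
rewrite lebesgue_measure_itv/= lte_fin; case: ltP => //= ba.
by apply/esym/eqP; rewrite subr_eq0 eq_le ab ba.
Qed.

Lemma cint_cst a b z : a <= b -> cint a b (fun=> z) = z * (b - a)%:C.
Proof.
move=> ab; rewrite /cint !Rint_cst//.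
by case: z => u v; rewrite /= (complexE (u +i* v)) /=; apply/eqP; rewrite eq_complex/=; apply/andP; split; apply/eqP; ring.
Qed.

(** Rotating by a unimodular constant makes the integral real and nonnegative; it is then the
    integral of a real part, which the modulus dominates. *)
Lemma cmod_cint a b (f : R -> R[i]^o) : cont_on a b f ->
  cmod (cint a b f) <= (\int[mu]_(x in `[a, b]) cmod (f x))%R.
Proof.
move=> cf; set I := cint a b f.
have [I0|I0] := eqVneq I 0.
  by rewrite I0 cmod0; apply: Rintegral_ge0 => x _; exact: cmod_ge0.
pose u := (cmod I)%:C / I.
have u1 : cmod u = 1.
  by rewrite cmodM cmodV cmod_real ger0_norm ?cmod_ge0// divff// cmod_eq0.
have : u * I = (cmod I)%:C by rewrite mulfVK.
rewrite -cintZ// /cint => /(congr1 (@complex.Re R))/= <-.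
apply: le_Rintegral => //.
- have cu := @cont_onM R[i] a b (fun=> u) f (@cont_on_cst R[i]^o a b u) cf.
  exact: cont_on_integrable (cont_on_Re cu).
- exact: cont_on_integrable (cont_on_cmod cf).
- by move=> x _; apply: le_trans (Re_le_cmod _) _; rewrite cmodM u1 mul1r.
Qed.

Lemma cmod_cint_le a b M (f : R -> R[i]^o) : a <= b -> cont_on a b f ->
  (forall x, a <= x <= b -> cmod (f x) <= M) -> cmod (cint a b f) <= M * (b - a).
Proof.
move=> ab cf fM; apply: le_trans (cmod_cint cf) _.
apply: (@le_trans _ _ (\int[mu]_(x in `[a, b]) M)%R).
  apply: le_Rintegral => //.
  - exact: cont_on_integrable (cont_on_cmod cf).
  - by apply: cont_on_integrable; exact: cont_on_cst.
by rewrite Rint_cst.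
Qed.

Lemma Rint_split a c b (h : R -> R) : a <= c -> c <= b -> cont_on a b h ->
  (\int[mu]_(x in `[a, b]) h x = \int[mu]_(x in `[a, c]) h x + \int[mu]_(x in `[c, b]) h x)%R.
Proof.
move=> ac cb ch; have ih := cont_on_integrable ch.
rewrite -(Rintegral_itv_obnd_cbnd (r := c)).
  by rewrite -(Rintegral_itvB ih) ?bnd_simp// addrC subrK.
apply: integrableS ih => //; apply: subset_itvr.
by rewrite bnd_simp.
Qed.

Lemma cint_split a c b (f : R -> R[i]^o) : a <= c -> c <= b -> cont_on a b f ->
  cint a b f = cint a c f + cint c b f.
Proof.
move=> ac cb cf; rewrite /cint (Rint_split ac cb (cont_on_Re cf)).
by rewrite (Rint_split ac cb (cont_on_Im cf)).
Qed.

Definition cis t : R[i] := cos t +i* sin t.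

Lemma circle_pointE (s t : R) : circle_point s t = s%:C * cis t.
Proof. by apply/eqP; rewrite eq_complex/=; apply/andP; split; apply/eqP; ring. Qed.

Lemma cmod_cis t : cmod (cis t) = 1.
Proof. by rewrite cmodE/= cos2Dsin2 sqrtr1. Qed.

Lemma cmod_circle_point (s t : R) : 0 <= s -> cmod (circle_point s t) = s.
Proof. by move=> s0; rewrite circle_pointE cmodM cmod_cis mulr1 cmod_real ger0_norm. Qed.

Lemma cisD2pi t : cis (t + pi *+ 2) = cis t.
Proof. by rewrite /cis cosD2pi sinD2pi. Qed.

Lemma continuous_cis : continuous (cis : R -> R[i]^o).
Proof. by move=> t; apply: cvg_complex; [exact: continuous_cos|exact: continuous_sin]. Qed.

Lemma continuous_real_complex : continuous (real_complex R : R -> R[i]^o).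
Proof. by move=> t; apply: cvg_complex; [exact: cvg_id|exact: cvg_cst]. Qed.

Lemma Rint_FTC a b (h H : R -> R) : a <= b -> cont_on a b h ->
  (forall x, a <= x <= b -> is_derive x 1 H (h x)) ->
  (\int[mu]_(x in `[a, b]) h x)%R = H b - H a.
Proof.
rewrite le_eqVlt => /predU1P[<- _ _|ab ch dH].
  by rewrite subrr set_itv1 Rintegral_set1.
have cH x : a <= x <= b -> {for x, continuous H}.
  by move=> xab; have [dx _] := dH x xab; apply: differentiable_continuous; apply/derivable1_diffP.
rewrite /Rintegral (@continuous_FTC2 _ h H a b)//.
- apply: continuous_in_subspaceT => x; rewrite inE/= in_itv/= => xab; exact: ch.
- split.
  + by move=> x; rewrite in_itv/= => /andP[ax xb]; have [] := dH x _; rewrite ?(ltW ax) ?(ltW xb).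
  + by apply: cvg_at_right_filter; apply: cH; rewrite lexx ltW.
  + by apply: cvg_at_left_filter; apply: cH; rewrite lexx ltW.
- move=> x; rewrite in_itv/= => /andP[ax xb]; rewrite derive1E.
  have H1 : is_derive x 1 H (h x) by apply: dH; rewrite !ltW.
  exact: derive_val.
Qed.

Lemma cint_cis a b : a <= b -> 'i * cint a b cis = cis b - cis a.
Proof.
move=> ab; rewrite /cint/=.
have -> : (\int[mu]_(x in `[a, b]) cos x)%R = sin b - sin a.
  by apply: Rint_FTC => // x _; exact: continuous_cos.
have -> : (\int[mu]_(x in `[a, b]) sin x)%R = (- cos b) - (- cos a).
  apply: (@Rint_FTC a b sin (- cos)) => // x _; first exact: continuous_sin.
  by rewrite -[sin x]opprK; exact: is_deriveN.
by apply/eqP; rewrite eq_complex/=; apply/andP; split; apply/eqP; ring.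
Qed.

End CircleIntegral.

(** * Goursat's argument on polar sectors *)

Section Bisection.
Variable R : realType.
Variables (J : R -> R -> R -> R -> R[i]) (a b u v : R).
Hypotheses (ab : a <= b) (uv : u <= v).
Hypothesis Jsplit1 : forall a' m b' u' v', a <= a' -> a' <= m -> m <= b' -> b' <= b ->
  u <= u' -> u' <= v' -> v' <= v -> J a' b' u' v' = J a' m u' v' + J m b' u' v'.
Hypothesis Jsplit2 : forall a' b' u' m v', a <= a' -> a' <= b' -> b' <= b ->
  u <= u' -> u' <= m -> m <= v' -> v' <= v -> J a' b' u' v' = J a' b' u' m + J a' b' m v'.
Hypothesis Jsmall : forall s t, a <= s <= b -> u <= t <= v -> forall e, 0 < e ->
  exists2 del, 0 < del & forall a' b' u' v', a <= a' -> a' <= s -> s <= b' -> b' <= b ->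
    u <= u' -> u' <= t -> t <= v' -> v' <= v -> b' - a' < del -> v' - u' < del ->
    cmod (J a' b' u' v') <= e * (b' - a' + (v' - u')) ^+ 2.

Let h (k : nat) := (b - a) / 2 ^+ k.
Let g (k : nat) := (v - u) / 2 ^+ k.
Let Jk k (p : R * R) := cmod (J p.1 (p.1 + h k) p.2 (p.2 + g k)).
Let ok k (p : R * R) := [/\ a <= p.1, p.1 + h k <= b, u <= p.2 & p.2 + g k <= v].

Let h_ge0 k : 0 <= h k.
Proof. by rewrite divr_ge0 ?subr_ge0// exprn_ge0. Qed.

Let g_ge0 k : 0 <= g k.
Proof. by rewrite divr_ge0 ?subr_ge0// exprn_ge0. Qed.

Let hS k : h k = h k.+1 + h k.+1.
Proof. by rewrite /h exprS invfM mulrCA [2^-1 * _]mulrC -splitr. Qed.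

Let gS k : g k = g k.+1 + g k.+1.
Proof. by rewrite /g exprS invfM mulrCA [2^-1 * _]mulrC -splitr. Qed.

(** By additivity [J] is the sum over the four quarters, so one of them carries at least a quarter
    of the modulus. *)
Let step k p : ok k p -> exists q, [/\ ok k.+1 q, p.1 <= q.1 /\ q.1 + h k.+1 <= p.1 + h k,
  p.2 <= q.2 /\ q.2 + g k.+1 <= p.2 + g k & Jk k p <= 4 * Jk k.+1 q].
Proof.
case: p => x y; case; rewrite /= => ax xb uy yv.
have h0 := h_ge0 k.+1; have g0 := g_ge0 k.+1.
move: xb yv; rewrite /Jk/= hS gS => xb yv.
set H := h k.+1 in h0 xb *; set G := g k.+1 in g0 yv *.
pose q1 := (x, y); pose q2 := (x + H, y); pose q3 := (x, y + G); pose q4 := (x + H, y + G).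
pose c q := cmod (J q.1 (q.1 + H) q.2 (q.2 + G)).
have tri : cmod (J x (x + (H + H)) y (y + (G + G))) <= c q1 + c q2 + c q3 + c q4.
  have -> : J x (x + (H + H)) y (y + (G + G)) =
      J x (x + (H + H)) y (y + G) + J x (x + (H + H)) (y + G) (y + (G + G)).
    by apply: Jsplit2; lra.
  have -> : J x (x + (H + H)) y (y + G) =
      J x (x + H) y (y + G) + J (x + H) (x + (H + H)) y (y + G).
    by apply: Jsplit1; lra.
  have -> : J x (x + (H + H)) (y + G) (y + (G + G)) =
      J x (x + H) (y + G) (y + (G + G)) + J (x + H) (x + (H + H)) (y + G) (y + (G + G)).
    by apply: Jsplit1; lra.
  rewrite /c/q1/q2/q3/q4/= !addrA.
  apply: le_trans (ler_cmodD _ _) _; rewrite lerD2r.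
  by apply: le_trans (ler_cmodD _ _) _; rewrite lerD2r ler_cmodD.
have big : exists2 q, q \in [:: q1; q2; q3; q4] & c q1 + c q2 + c q3 + c q4 <= 4 * c q.
  apply: contrapT => no.
  have lt q : q \in [:: q1; q2; q3; q4] -> 4 * c q < c q1 + c q2 + c q3 + c q4.
    by move=> qin; rewrite ltNge; apply/negP => ?; apply: no; exists q.
  have := lt q1; have := lt q2; have := lt q3; have := lt q4.
  rewrite !inE !eqxx !orbT => /(_ isT) l4 /(_ isT) l3 /(_ isT) l2 /(_ isT) l1.
  clear -l1 l2 l3 l4; lra.
move: big => [q qin qc]; exists q; split; last exact: le_trans tri qc.
all: by move: qin; rewrite !inE => /or4P[] /eqP -> /=; split; rewrite /= -/H -/G;
  clear -ax xb uy yv h0 g0; lra.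
Qed.

Let itv_geo (k : nat) : (k%:R : R) <= 2 ^+ k.
Proof.
elim: k => [|k ih]; first by rewrite ler01.
by rewrite -natr1 exprS mulr_natl mulr2n lerD// exprn_ege1// ler1n.
Qed.

Let small (x e : R) : 0 < e -> exists N : nat, forall k, (N <= k)%N -> x / 2 ^+ k < e.
Proof.
move=> e0; exists (Num.truncn (`|x| / e)).+1 => k Nk.
rewrite ltr_pdivrMr ?exprn_gt0//; apply: le_lt_trans (ler_norm x) _.
rewrite mulrC -ltr_pdivrMr//; apply: lt_le_trans (truncnS_gt _) _.
by apply: le_trans (itv_geo k); rewrite ler_nat.
Qed.

(* [h] and [g] halve the sides, so an additive [J] that is [o(size^2)] at every point vanishes. *)
Lemma bisection_eq0 : J a b u v = 0.
Proof.
apply/eqP; rewrite -cmod_eq0; apply/negPn/negP => J0.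
have Jpos : 0 < cmod (J a b u v) by rewrite lt_neqAle eq_sym J0 cmod_ge0.
(* Choice asks for a successor of every pair; a pair violating [ok] is sent to itself and never
   occurs below. *)
have [F HF] : {F : nat * (R * R) -> R * R & forall kp, ok kp.1 kp.2 ->
    [/\ ok kp.1.+1 (F kp), kp.2.1 <= (F kp).1 /\ (F kp).1 + h kp.1.+1 <= kp.2.1 + h kp.1,
     kp.2.2 <= (F kp).2 /\ (F kp).2 + g kp.1.+1 <= kp.2.2 + g kp.1 & Jk kp.1 kp.2 <= 4 * Jk kp.1.+1 (F kp)]}.
  apply: (@boolp.choice _ _ (fun kp q => ok kp.1 kp.2 ->
    [/\ ok kp.1.+1 q, kp.2.1 <= q.1 /\ q.1 + h kp.1.+1 <= kp.2.1 + h kp.1,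
     kp.2.2 <= q.2 /\ q.2 + g kp.1.+1 <= kp.2.2 + g kp.1 & Jk kp.1 kp.2 <= 4 * Jk kp.1.+1 q])).
  move=> [k p]; have [hok|nok] := pselect (ok k p).
    by have [q Hq] := step hok; exists q.
  by exists p.
pose p := fix p k := if k is k'.+1 then F (k', p k') else (a, u).
have okp k : ok k (p k).
  elim: k => [|k ih]; last by have [] := HF (k, p k) ih.
  by split; rewrite /= ?lexx// /h /g expr0 divr1 addrC subrK.
have pS k := HF (k, p k) (okp k).
have Jp k : cmod (J a b u v) <= 4 ^+ k * Jk k (p k).
  elim: k => [|k ih].
    by rewrite expr0 mul1r /Jk/= /h /g expr0 !divr1 [a + _]addrC [u + _]addrC !subrK.
  apply: le_trans ih _; rewrite exprSr -mulrA ler_pM2l ?exprn_gt0//.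
  by have [] := pS k.
have mono k j : ((p k).1 <= (p (j + k)%N).1 /\ (p (j + k)%N).1 + h (j + k)%N <= (p k).1 + h k) /\
    ((p k).2 <= (p (j + k)%N).2 /\ (p (j + k)%N).2 + g (j + k)%N <= (p k).2 + g k).
  elim: j => [|j [[h1 h2] [h3 h4]]]; first by rewrite add0n.
  have [_ [i1 i2] [i3 i4] _] := pS (j + k)%N; rewrite addSn.
  by split; split; [exact: le_trans h1 i1|exact: le_trans i2 h2|
     exact: le_trans h3 i3|exact: le_trans i4 h4].
have mono1 k j : (p k).1 <= (p j).1 + h j.
  have [kj|jk] := leqP k j.
    have [[h1 _] _] := mono k (j - k)%N; rewrite subnK// in h1.
    by rewrite (le_trans h1)// lerDl h_ge0.
  have [[_ h1] _] := mono j (k - j)%N; rewrite (subnK (ltnW jk)) in h1.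
  by rewrite (le_trans _ h1)// lerDl h_ge0.
have mono2 k j : (p k).2 <= (p j).2 + g j.
  have [kj|jk] := leqP k j.
    have [_ [h1 _]] := mono k (j - k)%N; rewrite subnK// in h1.
    by rewrite (le_trans h1)// lerDl g_ge0.
  have [_ [_ h1]] := mono j (k - j)%N; rewrite (subnK (ltnW jk)) in h1.
  by rewrite (le_trans _ h1)// lerDl g_ge0.
(* The lower corners increase and stay below all upper corners, so their suprema give a point common
   to all rectangles. *)
pose s := sup (range (fun k => (p k).1)); pose t := sup (range (fun k => (p k).2)).
have s1 k : (p k).1 <= s.
  by apply: ub_le_sup; [exists ((p 0).1 + h 0) => _ [j _ <-]; exact: mono1|exists k].
have s2 k : s <= (p k).1 + h k.
  by apply: ge_sup; [exists (p 0).1; exists 0|move=> _ [j _ <-]; exact: mono1].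
have t1 k : (p k).2 <= t.
  by apply: ub_le_sup; [exists ((p 0).2 + g 0) => _ [j _ <-]; exact: mono2|exists k].
have t2 k : t <= (p k).2 + g k.
  by apply: ge_sup; [exists (p 0).2; exists 0|move=> _ [j _ <-]; exact: mono2].
have sab : a <= s <= b.
  by have [q1 q2 q3 q4] := okp 0; rewrite (le_trans _ (s1 0))// (le_trans (s2 0)).
have tuv : u <= t <= v.
  by have [q1 q2 q3 q4] := okp 0; rewrite (le_trans _ (t1 0))// (le_trans (t2 0)).
pose L := b - a + (v - u).
(* The squared size shrinks by [4 ^+ k], exactly the factor lost in [Jp]; what remains is
   [e * L ^+ 2], made smaller than [|J|]. The [+ 1] avoids dividing by zero. *)
pose e := cmod (J a b u v) / 2 / (L ^+ 2 + 1).
have L1 : 0 < L ^+ 2 + 1 by rewrite ltr_wpDl// sqr_ge0.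
have e0 : 0 < e by rewrite !divr_gt0.
have [del del0 Hd] := Jsmall sab tuv e0.
have [N1 HN1] := small (b - a) del0; have [N2 HN2] := small (v - u) del0.
pose k := maxn N1 N2.
have [q1 q2 q3 q4] := okp k.
have := Hd _ _ _ _ q1 (s1 k) (s2 k) q2 q3 (t1 k) (t2 k) q4.
rewrite (addrAC _ (h k)) (addrAC _ (g k)) !subrr !add0r.
move=> /(_ (HN1 _ (leq_maxl _ _)) (HN2 _ (leq_maxr _ _))).
have hg : h k + g k = L / 2 ^+ k by rewrite /h /g -mulrDl.
rewrite hg => H; have := Jp k; apply/negP; rewrite -ltNge.
apply: (@le_lt_trans _ _ (4 ^+ k * (e * (L / 2 ^+ k) ^+ 2))).
  by rewrite ler_pM2l ?exprn_gt0.
rewrite (_ : 4 ^+ k * _ = e * L ^+ 2).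
  rewrite /e mulrAC ltr_pdivrMr//.
  set c := cmod _ in Jpos *; set M := L ^+ 2.
  have M0 : 0 <= M by rewrite sqr_ge0.
  have cM0 : 0 <= c * M by rewrite mulr_ge0// ltW.
  by lra.
rewrite expr_div_n -exprM mulnC exprM (_ : 2 ^+ 2 = 4 :> R); last by rewrite -natrX.
by rewrite mulrCA; congr (_ * _); rewrite mulrC mulfVK// expf_neq0// pnatr_eq0.
Qed.

End Bisection.

(** * Boundary integrals of polar sectors *)

Section SectorIntegral.
Variable R : realType.
Implicit Types (a b u v s t : R) (f : R[i] -> R[i]).

(* The integral of [f w / w] along the boundary of the polar sector
   [a <= |w| <= b], [u <= arg w <= v]. *)
Definition sector_int f a b u v : R[i] :=
  'i * (cint u v (fun t => f (circle_point b t)) - cint u v (fun t => f (circle_point a t)))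
  - (cint a b (fun s => f (circle_point s v) / s%:C)
     - cint a b (fun s => f (circle_point s u) / s%:C)).

Definition sector_cont f a b u v := forall s t, a <= s <= b -> u <= t <= v ->
  {for circle_point s t, continuous (f : R[i]^o -> R[i]^o)}.

Lemma cmod_i : cmod ('i : R[i]) = 1.
Proof. by rewrite /cmod normCi. Qed.

Lemma continuous_arc s : continuous (circle_point s : R -> R[i]^o).
Proof.
move=> t; apply: cvg_complex.
  by apply: cvgM; [exact: cvg_cst|exact: continuous_cos].
by apply: cvgM; [exact: cvg_cst|exact: continuous_sin].
Qed.

Lemma continuous_ray t : continuous ((fun s => circle_point s t) : R -> R[i]^o).
Proof.
move=> s; apply: cvg_complex.
  by apply: cvgM; [exact: cvg_id|exact: cvg_cst].
by apply: cvgM; [exact: cvg_id|exact: cvg_cst].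
Qed.

Lemma cont_on_arc f a b u v s : sector_cont f a b u v -> a <= s <= b ->
  cont_on u v (fun t => f (circle_point s t) : R[i]^o).
Proof.
move=> cf sab t tuv.
apply: (@continuous_comp _ _ _ (circle_point s : R -> R[i]^o) (f : R[i]^o -> R[i]^o)).
  exact: continuous_arc.
exact: cf.
Qed.

Lemma cont_on_ray f a b u v t : 0 < a -> sector_cont f a b u v -> u <= t <= v ->
  cont_on a b (fun s => f (circle_point s t) / s%:C : R[i]^o).
Proof.
move=> a0 cf tuv s sab.
have h1 : {for s, continuous (fun s => f (circle_point s t) : R[i]^o)}.
  apply: (@continuous_comp _ _ _ ((fun s => circle_point s t) : R -> R[i]^o)
    (f : R[i]^o -> R[i]^o)).
    exact: continuous_ray.
  exact: cf.
have s0 : s%:C != 0 :> R[i].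
  rewrite -cmod_eq0 cmod_real normr_eq0; case/andP: sab => as_ _.
  by rewrite gt_eqF// (lt_le_trans a0).
exact: (cvgM h1 (cvgV s0 (@continuous_real_complex R s))).
Qed.

Lemma sector_intD f g a b u v : 0 < a -> a <= b -> u <= v ->
  sector_cont f a b u v -> sector_cont g a b u v ->
  sector_int (fun z => f z + g z) a b u v = sector_int f a b u v + sector_int g a b u v.
Proof.
move=> a0 ab uv cf cg; rewrite /sector_int.
have aa : a <= a <= b by rewrite lexx.
have bb : a <= b <= b by rewrite lexx andbT.
have uu : u <= u <= v by rewrite lexx.
have vv : u <= v <= v by rewrite lexx andbT.
rewrite (cintD (cont_on_arc cf aa) (cont_on_arc cg aa)).
rewrite (cintD (cont_on_arc cf bb) (cont_on_arc cg bb)).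
have E t : u <= t <= v -> cint a b (fun s => (f (circle_point s t) + g (circle_point s t)) / s%:C) =
   cint a b (fun s => f (circle_point s t) / s%:C) + cint a b (fun s => g (circle_point s t) / s%:C).
  move=> tuv; rewrite -(cintD (cont_on_ray a0 cf tuv) (cont_on_ray a0 cg tuv)).
  by apply: eq_cint => s _; rewrite mulrDl.
by rewrite !E//; ring.
Qed.

(** The constant part cancels between opposite sides, since [dw / w] is [i dt] on arcs and [ds / s]
    on rays; the linear part adds up the differences between consecutive corners. *)
Lemma sector_int_affine c d a b u v : 0 < a -> a <= b -> u <= v ->
  sector_int (fun z => c + d * z) a b u v = 0.
Proof.
move=> a0 ab uv; rewrite /sector_int.
have arc s : cint u v (fun t => c + d * circle_point s t) =
    c * (v - u)%:C + d * s%:C * cint u v (@cis R).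
  have cc : cont_on u v (@cis R : R -> R[i]^o) by move=> t _; exact: continuous_cis.
  rewrite -(cintZ (d * s%:C) cc) -(cint_cst c uv) -cintD.
  - by apply: eq_cint => t _; rewrite circle_pointE mulrA.
  - exact: cont_on_cst.
  - exact: cont_onZ.
have ray t : cint a b (fun s => (c + d * circle_point s t) / s%:C) =
    c * cint a b (fun s => (s%:C)^-1) + d * cis t * (b - a)%:C.
  have ci : cont_on a b (fun s => (s%:C)^-1 : R[i]^o).
    move=> s /andP[as_ _]; apply: cvgV; last exact: continuous_real_complex.
    by rewrite -cmod_eq0 cmod_real normr_eq0 gt_eqF// (lt_le_trans a0).
  rewrite -(cint_cst _ ab) -(cintZ c ci) -cintD.
  - apply: eq_cint => s /andP[as_ _]; rewrite circle_pointE mulrDl; congr (_ + _).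
    have s0 : s%:C != 0 :> R[i].
      by rewrite -cmod_eq0 cmod_real normr_eq0 gt_eqF// (lt_le_trans a0).
    by field.
  - exact: cont_onZ.
  - exact: cont_on_cst.
rewrite !arc !ray.
have H := cint_cis uv.
have -> : 'i * (c * (v - u)%:C + d * b%:C * cint u v (cis (R:=R)) -
     (c * (v - u)%:C + d * a%:C * cint u v (cis (R:=R)))) =
   d * (b%:C - a%:C) * ('i * cint u v (@cis R)) by ring.
by rewrite H [(b - a)%:C]rmorphB/=; ring.
Qed.

Lemma cis_lip t t' : cmod (cis t' - cis t) <= `|t' - t|.
Proof.
have cc x y : cont_on x y (@cis R : R -> R[i]^o) by move=> ? _; exact: continuous_cis.
wlog tt : t t' / t <= t'.
  by have [tt|/ltW tt] := leP t t'; [exact|rewrite cmodB distrC; exact].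
rewrite -cint_cis// cmodM cmod_i mul1r ger0_norm ?subr_ge0//.
rewrite -[leRHS]mul1r; apply: cmod_cint_le => // x _.
by rewrite cmod_cis.
Qed.

Lemma circle_point_lip s t s' t' : 0 <= s -> s <= 1 ->
  cmod (circle_point s' t' - circle_point s t) <= `|s' - s| + `|t' - t|.
Proof.
move=> s0 s1; rewrite !circle_pointE.
rewrite (_ : _ - _ = (s' - s)%:C * cis t' + s%:C * (cis t' - cis t)).
  apply: le_trans (ler_cmodD _ _) _; rewrite !cmodM cmod_cis mulr1 !cmod_real lerD2l.
  rewrite (ger0_norm s0); apply: le_trans (ler_wpM2l s0 (cis_lip _ _)) _.
  by rewrite ler_piMl.
by rewrite rmorphB/=; ring.
Qed.

(** Two arcs contribute at most [M (v - u)] each, two rays at most [(M / a) (b - a)] each. *)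
Lemma sector_int_le f a b u v M : 0 < a -> a <= b -> u <= v -> 0 <= M ->
  sector_cont f a b u v ->
  (forall s t, a <= s <= b -> u <= t <= v -> cmod (f (circle_point s t)) <= M) ->
  cmod (sector_int f a b u v) <= 2 * (1 + a^-1) * M * (b - a + (v - u)).
Proof.
move=> a0 ab uv M0 cf fM.
have aa : a <= a <= b by rewrite lexx.
have bb : a <= b <= b by rewrite lexx andbT.
have uu : u <= u <= v by rewrite lexx.
have vv : u <= v <= v by rewrite lexx andbT.
have arc s : a <= s <= b -> cmod (cint u v (fun t => f (circle_point s t))) <= M * (v - u).
  by move=> sab; apply: cmod_cint_le (cont_on_arc cf sab) _ => // t tuv; exact: fM.
have ray t : u <= t <= v ->
    cmod (cint a b (fun s => f (circle_point s t) / s%:C)) <= M / a * (b - a).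
  move=> tuv; apply: cmod_cint_le (cont_on_ray a0 cf tuv) _ => // s sab.
  have sa : a <= s by case/andP: sab.
  have s0 : 0 < s by exact: lt_le_trans sa.
  rewrite cmodM cmodV cmod_real gtr0_norm//.
  apply: ler_pM; rewrite ?cmod_ge0 ?invr_ge0 ?(ltW s0)//; first exact: fM.
  by rewrite lef_pV2.
rewrite /sector_int; apply: le_trans (ler_cmodB _ _) _; rewrite cmodM cmod_i mul1r.
apply: le_trans (lerD (ler_cmodB _ _) (ler_cmodB _ _)) _.
apply: le_trans (lerD (lerD (arc _ bb) (arc _ aa)) (lerD (ray _ vv) (ray _ uu))) _.
have a'0 : 0 <= M * a^-1 by rewrite mulr_ge0// invr_ge0 ltW.
have ba : 0 <= b - a by rewrite subr_ge0.
have vu : 0 <= v - u by rewrite subr_ge0.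
have h1 := mulr_ge0 M0 ba; have h2 := mulr_ge0 a'0 vu.
by lra.
Qed.

(** Goursat: subtracting the affine expansion at a point changes nothing, and the remainder, at most
    [e] times the size, is integrated over a boundary of comparable size, which gives [e] times the
    size squared. *)
Lemma sector_int_eq0 f a b u v : 0 < a -> a <= b -> b <= 1 -> u <= v ->
  (forall s t, a <= s <= b -> u <= t <= v -> hol_at f (circle_point s t)) ->
  sector_int f a b u v = 0.
Proof.
move=> a0 ab b1 uv fh.
have cf a' b' u' v' : a <= a' -> b' <= b -> u <= u' -> v' <= v -> sector_cont f a' b' u' v'.
  move=> aa bb uu vv s t /andP[s1 s2] /andP[t1 t2]; apply: hol_at_continuous; apply: fh.
    by rewrite (le_trans aa s1) (le_trans s2 bb).
  by rewrite (le_trans uu t1) (le_trans t2 vv).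
apply: bisection_eq0 => //.
- move=> a' m b' u' v' h1 h2 h3 h4 h5 h6 h7.
  have c := cf a' b' u' v' h1 h4 h5 h7.
  have a'0 : 0 < a' by exact: lt_le_trans h1.
  have uu : u' <= u' <= v' by rewrite lexx.
  have vv : u' <= v' <= v' by rewrite lexx andbT.
  rewrite /sector_int (cint_split h2 h3 (cont_on_ray a'0 c vv)).
  by rewrite (cint_split h2 h3 (cont_on_ray a'0 c uu)); ring.
- move=> a' b' u' m v' h1 h2 h3 h4 h5 h6 h7.
  have c := cf a' b' u' v' h1 h3 h4 h7.
  have aa : a' <= a' <= b' by rewrite lexx.
  have bb : a' <= b' <= b' by rewrite lexx andbT.
  rewrite /sector_int (cint_split h5 h6 (cont_on_arc c aa)).
  by rewrite (cint_split h5 h6 (cont_on_arc c bb)); ring.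
move=> s t sab tuv e e0.
have /hol_atP[d Hd] := fh s t sab tuv.
have C0 : 0 < 2 * (1 + a^-1) by rewrite mulr_gt0// addr_gt0// invr_gt0.
(* The divisor cancels the constant of [sector_int_le], as [a <= a']. The radius is halved next
   because the distance to the base point is bounded by the sum of the two sides. *)
have [|del del0 {}Hd] := Hd (e / (2 * (1 + a^-1))); first by rewrite divr_gt0.
exists (del / 2); first by rewrite divr_gt0.
move=> a' b' u' v' h1 h2 h3 h4 k1 k2 k3 k4 hb hv.
have c := cf a' b' u' v' h1 h4 k1 k4.
have a'0 : 0 < a' by exact: lt_le_trans h1.
pose z0 := circle_point s t.
pose r z := f z - f z0 - d * (z - z0).
pose l z := (f z0 - d * z0) + d * z.
have fE : f = fun z => l z + r z by apply/funext => z; rewrite /l/r; ring.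
have ab' : a' <= b' by exact: le_trans h2 h3.
have uv' : u' <= v' by exact: le_trans k2 k3.
have cl : sector_cont l a' b' u' v'.
  move=> s1 t1 _ _; apply: hol_at_continuous; apply: hol_atD; first exact: hol_at_cst.
  by apply: hol_atM; [exact: hol_at_cst|exact: hol_at_id].
have cr : sector_cont r a' b' u' v'.
  move=> s1 t1 h k; apply: hol_at_continuous; apply: hol_atB.
    apply: hol_atB; last exact: hol_at_cst.
    move: h k => /andP[x1 x2] /andP[y1 y2]; apply: fh.
      by rewrite (le_trans h1 x1) (le_trans x2 h4).
    by rewrite (le_trans k1 y1) (le_trans y2 k4).
  apply: hol_atM; first exact: hol_at_cst.
  by apply: hol_atB; [exact: hol_at_id|exact: hol_at_cst].
rewrite fE sector_intD// sector_int_affine// add0r.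
set D := b' - a' + (v' - u').
have D0 : 0 <= D by rewrite addr_ge0 ?subr_ge0.
have rM s1 t1 : a' <= s1 <= b' -> u' <= t1 <= v' ->
    cmod (r (circle_point s1 t1)) <= e / (2 * (1 + a^-1)) * D.
  move=> /andP[x1 x2] /andP[y1 y2].
  have s01 : 0 <= s <= 1.
    by case/andP: sab => x y; rewrite (le_trans (ltW a0) x) (le_trans y b1).
  have zD : cmod (circle_point s1 t1 - z0) <= D.
    case/andP: s01 => s0 s1'; apply: le_trans (circle_point_lip _ _ _ s0 s1') _.
    by apply: lerD; rewrite ler_norml; clear -x1 x2 y1 y2 h2 h3 k2 k3; lra.
  apply: le_trans (Hd _ _) _.
    by apply: le_lt_trans zD _; rewrite /D; lra.
  by rewrite ler_wpM2l// divr_ge0// ltW.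
have M0 : 0 <= e / (2 * (1 + a^-1)) * D by rewrite mulr_ge0// divr_ge0// ltW.
apply: le_trans (sector_int_le a'0 ab' uv' M0 cr rM) _.
rewrite -/D expr2 !mulrA ler_wpM2r// ler_wpM2r//.
rewrite ler_pdivrMr// [leLHS]mulrC ler_pM2l// ler_pM2l// lerD2l lef_pV2//.
Qed.

End SectorIntegral.

(** * Affine changes of variable and periodicity *)

Section AffineChange.
Variable R : realType.
Notation mu := (@lebesgue_measure R).

(** The pushforward of Lebesgue measure under the affine map, scaled by [k], gives half-open
    intervals their length, and Lebesgue measure is the only such measure. *)
Lemma ge0_integral_affine (k c : R) (F : R -> \bar R) : 0 < k ->
  measurable_fun [set: R] F -> (forall x, 0 <= F x)%E ->
  (\int[mu]_x F x = k%:E * \int[mu]_x F (k * x + c)%R)%E.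
Proof.
move=> k0 mF F0.
pose phi (x : R) : measurableTypeR R := k * x + c.
have mphi : measurable_fun [set: R] phi.
  by apply: measurable_funD => //; exact: measurable_funM.
have -> : (\int[mu]_x F (k * x + c)%R = \int[pushforward mu phi]_y F y)%E.
  by rewrite ge0_integral_pushforward.
rewrite -(ge0_integral_mscale _ _ (NngNum (ltW k0)))//.
apply: eq_measure_integral => //= A mA _.
apply: lebesgue_measure_unique => //= _ [[a b]] _ <-.
rewrite /mscale/= /pushforward.
have -> : phi @^-1` `]a, b]%classic = `](a - c) / k, (b - c) / k]%classic.
  apply/seteqP; split => x /=; rewrite !in_itv/= ltr_pdivrMr// ler_pdivlMr//;
    by rewrite ltrBlDr lerBrDr [x * k]mulrC.
rewrite !lebesgue_measure_itv/= !lte_fin.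
rewrite ltr_pM2r ?invr_gt0// ltrD2r; case: ltP => ab; last by rewrite mule0.
by rewrite -!EFinD -EFinM; congr EFin; field; rewrite gt_eqF.
Qed.

Lemma ge0_integral_shift (c a b : R) (F : R -> \bar R) :
  measurable_fun [set: R] F -> (forall x, 0 <= F x)%E ->
  (\int[mu]_(x in `[(a + c)%R, (b + c)%R]) F x = \int[mu]_(x in `[a, b]) F (x + c)%R)%E.
Proof.
move=> mF F0; rewrite integral_mkcond.
rewrite (@ge0_integral_affine 1 c)//.
- rewrite mul1e [RHS]integral_mkcond; apply: eq_integral => x _.
  rewrite /patch mul1r; congr (if _ then _ else _).
  by apply/idP/idP; rewrite !inE/= !in_itv/= !lerD2r.
- apply/(measurable_restrictT _ _).1 => //.
  exact: measurable_funTS.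
- by move=> x; rewrite /patch; case: ifP.
Qed.

Lemma Rint_shift (c a b : R) (h : R -> R) : continuous h ->
  (\int[mu]_(x in `[a + c, b + c]) h x = \int[mu]_(x in `[a, b]) h (x + c))%R.
Proof.
move=> ch.
have key (g : R -> R) : continuous g -> (forall x, 0 <= g x) ->
    (\int[mu]_(x in `[a + c, b + c]) g x = \int[mu]_(x in `[a, b]) g (x + c))%R.
  move=> cg g0; rewrite /Rintegral; congr fine.
  apply: (@ge0_integral_shift c a b (EFin \o g)).
    by apply/measurable_EFinP; exact: continuous_measurable_fun.
  by move=> x; rewrite /= lee_fin.
have cn : continuous (fun x => `|h x|).
  by move=> x; apply: (@continuous_comp _ _ _ h (@Num.norm _ R)); [exact: ch|exact: norm_continuous].
(* The signed case follows from the nonnegative one, since [h = (|h| + h) - |h|] is a difference of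
   continuous nonnegative functions. *)
have c2 : continuous (fun x => `|h x| + h x) by move=> x; apply: cvgD; [exact: cn|exact: ch].
have h2 x : 0 <= `|h x| + h x by rewrite -lerBlDr sub0r -normrN ler_norm.
have cc x : continuous (fun x : R => x + c) by move=> y; apply: cvgD; [exact: cvg_id|exact: cvg_cst].
have E u v (g : R -> R) : continuous g -> mu.-integrable `[u, v] (EFin \o g).
  by move=> cg; apply: cont_on_integrable => x _; exact: cg.
have e u v (f : R -> R) : continuous f -> (\int[mu]_(x in `[u, v]) f x =
   \int[mu]_(x in `[u, v]) (`|f x| + f x) - \int[mu]_(x in `[u, v]) `|f x|)%R.
  move=> cf.
  have cnf : continuous (fun x => `|f x|).
    by move=> x; apply: (@continuous_comp _ _ _ f (@Num.norm _ R)); [exact: cf|exact: norm_continuous].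
  by rewrite RintegralD//; [rewrite addrC addKr|exact: E|exact: E].
rewrite (e _ _ _ ch) (key _ c2 h2) (key _ cn (fun x => normr_ge0 _)).
rewrite [RHS]e// => x.
apply: (@continuous_comp _ _ _ (fun x => x + c) h); [exact: cc|exact: ch].
Qed.

Lemma Rint_periodic (P c : R) (h : R -> R) : 0 <= P -> continuous h ->
  (forall x, h (x + P) = h x) ->
  (\int[mu]_(x in `[c, c + P]) h x = \int[mu]_(x in `[0, P]) h x)%R.
Proof.
move=> P0 ch hP.
have co a b : cont_on a b h by move=> x _; exact: ch.
have shift a b : (\int[mu]_(x in `[a + P, b + P]) h x = \int[mu]_(x in `[a, b]) h x)%R.
  by rewrite Rint_shift//; apply: eq_Rintegral => x _; rewrite hP.
(* Two overlapping windows differ by segments that are translates of each other by [P]; a general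
   [c] is first brought this close to [0] by whole periods. *)
have key a b : a <= b -> b <= a + P ->
   (\int[mu]_(x in `[b, b + P]) h x = \int[mu]_(x in `[a, a + P]) h x)%R.
  move=> ab ba; rewrite (@Rint_split _ b (a + P) (b + P))// ?lerD2r//.
  by rewrite shift addrC -(@Rint_split _ a b (a + P)).
have [P00|Pn0] := eqVneq P 0; first by rewrite P00 addr0 !set_itv1 !Rintegral_set1.
have {}P0 : 0 < P by rewrite lt_neqAle eq_sym Pn0.
have step a : (\int[mu]_(x in `[a + P, (a + P) + P]) h x = \int[mu]_(x in `[a, a + P]) h x)%R.
  exact: shift.
have stepn a n : (\int[mu]_(x in `[a + P *+ n, a + P *+ n + P]) h x =
   \int[mu]_(x in `[a, a + P]) h x)%R.
  by elim: n => [|n ih]; [rewrite mulr0n addr0|rewrite mulrSr addrA step].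
have [c0|/ltW c0] := leP 0 c.
  pose n := Num.truncn (c / P).
  have cP : 0 <= c / P by rewrite divr_ge0// ltW.
  have /andP[n1 n2] := truncn_itv cP.
  rewrite ler_pdivlMr// -/n in n1; rewrite ltr_pdivrMr// -/n in n2.
  rewrite (key (n%:R * P) c n1).
    by have := stepn 0 n; rewrite !add0r mulr_natl.
  by move: n2; rewrite -natr1 mulrDl mul1r => /ltW.
pose n := Num.truncn (- c / P).
have cP : 0 <= - c / P by rewrite divr_ge0 ?oppr_ge0// ltW.
have /andP[n1 n2] := truncn_itv cP.
rewrite ler_pdivlMr// -/n in n1; rewrite ltr_pdivrMr// -/n in n2.
rewrite -(stepn c n.+1) (key 0) ?add0r//.
  by rewrite -lerBlDl sub0r -(mulr_natl P) ltW.
by rewrite mulrSr addrA gerDr -(mulr_natl P); lra.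
Qed.

End AffineChange.

(** * Circle means and Cauchy's formula *)

Section MeanValue.
Variable R : realType.
Implicit Types (a b s t : R) (f g : R[i] -> R[i]) (z w : R[i]).
Notation mu := (@lebesgue_measure R).

Lemma conjCM z w : (z * w)^* = z^* * w^*.
Proof. exact: rmorphM. Qed.

Lemma conjCB z w : (z - w)^* = z^* - w^*.
Proof. exact: rmorphB. Qed.

Lemma conjCV z : (z^-1)^* = (z^*)^-1.
Proof. exact: fmorphV. Qed.

Lemma conjC_real (x : R) : (x%:C)^* = x%:C.
Proof. exact: conjc_real. Qed.

Definition ccont (f : R -> R[i]^o) := cont_on 0 (pi *+ 2) f.
Lemma ccont_cst z : ccont (fun=> z).
Proof. exact: cont_on_cst. Qed.

Lemma ccontD (f g : R -> R[i]) : ccont f -> ccont g -> ccont (fun t => f t + g t).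
Proof. exact: (@cont_onD R R[i]). Qed.

Lemma ccontB (f g : R -> R[i]) : ccont f -> ccont g -> ccont (fun t => f t - g t).
Proof. exact: (@cont_onB R R[i]). Qed.

Lemma ccontM (f g : R -> R[i]) : ccont f -> ccont g -> ccont (fun t => f t * g t).
Proof. exact: (@cont_onM R R[i]). Qed.

Lemma ccontX (f : R -> R[i]) n : ccont f -> ccont (fun t => f t ^+ n).
Proof. exact: (@cont_onX R R[i]). Qed.

Lemma ccontV (f : R -> R[i]) : (forall t, f t != 0) -> ccont f -> ccont (fun t => (f t)^-1).
Proof. by move=> f0; apply: (@cont_onV R R[i]) => t _; exact: f0. Qed.

Lemma ccont_conjc (f : R -> R[i]) : ccont f -> ccont (fun t => (f t)^*).
Proof. exact: cont_on_conjc. Qed.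

Lemma ccont_circle_point s : ccont (circle_point s).
Proof. by move=> t _; exact: continuous_arc. Qed.

Definition rcont (h : R -> R) := cont_on 0 (pi *+ 2) h.

Lemma rcont_cst (c : R) : rcont (fun=> c).
Proof. exact: cont_on_cst. Qed.

Lemma rcontD (f g : R -> R) : rcont f -> rcont g -> rcont (fun t => f t + g t).
Proof. exact: (@cont_onD R R). Qed.

Lemma rcontM (f g : R -> R) : rcont f -> rcont g -> rcont (fun t => f t * g t).
Proof. exact: (@cont_onM R R). Qed.

Lemma rcontX (f : R -> R) n : rcont f -> rcont (fun t => f t ^+ n).
Proof. exact: (@cont_onX R R). Qed.

Lemma rcontV (f : R -> R) : (forall t, f t != 0) -> rcont f -> rcont (fun t => (f t)^-1).
Proof. by move=> f0; apply: (@cont_onV R R) => t _; exact: f0. Qed.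

Lemma rcont_cmod (f : R -> R[i]) : ccont f -> rcont (fun t => cmod (f t)).
Proof. exact: cont_on_cmod. Qed.

Lemma rcont_Re (f : R -> R[i]) : ccont f -> rcont (fun t => complex.Re (f t)).
Proof. exact: cont_on_Re. Qed.

Definition ravg (h : R -> R) := (pi *+ 2)^-1 * (\int[mu]_(t in `[0%R, (pi *+ 2)%R]) h t)%R.
Definition cavg (f : R -> R[i]) := ((pi *+ 2)^-1)%:C * cint 0 (pi *+ 2) f.

Lemma twopi_gt0 : 0 < (pi *+ 2 : R).
Proof. by rewrite pmulrn_lgt0 ?pi_gt0. Qed.

Lemma twopi_neq0 : ((pi *+ 2)%:C : R[i]) != 0.
Proof. by rewrite -cmod_eq0 cmod_real normr_eq0 gt_eqF// twopi_gt0. Qed.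

Lemma cint_cavg (f : R -> R[i]) : cint 0 (pi *+ 2) f = (pi *+ 2)%:C * cavg f.
Proof.
by rewrite /cavg mulrA -rmorphM/= divff ?mul1r// gt_eqF// twopi_gt0.
Qed.

Lemma eq_cavg (f g : R -> R[i]) : (forall t, f t = g t) -> cavg f = cavg g.
Proof. by move=> fg; congr cavg; apply/funext. Qed.

Lemma cavgD (f g : R -> R[i]^o) : ccont f -> ccont g ->
  cavg (fun t => f t + g t) = cavg f + cavg g.
Proof. by move=> cf cg; rewrite /cavg (cintD cf cg) mulrDr. Qed.

Lemma cavgB (f g : R -> R[i]^o) : ccont f -> ccont g ->
  cavg (fun t => f t - g t) = cavg f - cavg g.
Proof. by move=> cf cg; rewrite /cavg (cintB cf cg) mulrBr. Qed.

Lemma cavgZ z (f : R -> R[i]^o) : ccont f -> cavg (fun t => z * f t) = z * cavg f.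
Proof. by move=> cf; rewrite /cavg (cintZ z cf) mulrCA. Qed.

Lemma cavg_cst z : cavg (fun=> z) = z.
Proof.
rewrite /cavg cint_cst ?(ltW twopi_gt0)// subr0 mulrCA -rmorphM/= mulVf ?mulr1//.
by rewrite gt_eqF// twopi_gt0.
Qed.

Lemma cavg_conjc (f : R -> R[i]^o) : ccont f -> cavg (fun t => (f t)^*) = (cavg f)^*.
Proof. by move=> cf; rewrite /cavg (cint_conjc cf) conjCM conjC_real. Qed.

Lemma cavg_real (h : R -> R) : cavg (fun t => (h t)%:C) = (ravg h)%:C.
Proof. by rewrite /cavg cint_real -rmorphM. Qed.

Lemma ler_ravg (h k : R -> R) : rcont h -> rcont k ->
  (forall t, h t <= k t) -> ravg h <= ravg k.
Proof.
move=> ch ck hk; rewrite /ravg ler_wpM2l ?invr_ge0 ?(ltW twopi_gt0)//.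
by apply: le_Rintegral => //; exact: cont_on_integrable.
Qed.

Lemma ravg_ge0 (h : R -> R) : (forall t, 0 <= h t) -> 0 <= ravg h.
Proof.
by move=> h0; rewrite /ravg mulr_ge0 ?invr_ge0 ?(ltW twopi_gt0)// Rintegral_ge0.
Qed.

Lemma ravgD (h k : R -> R) : rcont h -> rcont k ->
  ravg (fun t => h t + k t) = ravg h + ravg k.
Proof.
by move=> ch ck; rewrite /ravg RintegralD ?mulrDr//; exact: cont_on_integrable.
Qed.

Lemma ravgZ (c : R) (h : R -> R) : rcont h ->
  ravg (fun t => c * h t) = c * ravg h.
Proof.
move=> ch; rewrite /ravg (RintegralZl _ _ (cont_on_integrable ch))//.
by rewrite mulrCA.
Qed.

Lemma cmod_cavg (f : R -> R[i]^o) : ccont f -> cmod (cavg f) <= ravg (fun t => cmod (f t)).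
Proof.
move=> cf; rewrite /cavg cmodM cmod_real ger0_norm ?invr_ge0 ?(ltW twopi_gt0)//.
by rewrite /ravg ler_wpM2l ?invr_ge0 ?(ltW twopi_gt0)// (cmod_cint cf).
Qed.

Lemma cmod_cavg_le (f : R -> R[i]^o) M : ccont f -> (forall t, cmod (f t) <= M) ->
  cmod (cavg f) <= M.
Proof.
move=> cf fM; apply: le_trans (cmod_cavg cf) _.
rewrite -lecR -cavg_real -[leRHS]cavg_cst cavg_real (cavg_real (fun=> M)) lecR.
apply: ler_ravg fM; [exact: (rcont_cmod cf)|exact: rcont_cst].
Qed.

Lemma circle_pointD2pi s t : circle_point s (t + pi *+ 2) = circle_point s t.
Proof. by rewrite !circle_pointE cisD2pi. Qed.

Lemma continuous_on_circle f s : 0 <= s ->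
  (forall w, cmod w = s -> {for w, continuous (f : R[i]^o -> R[i]^o)}) ->
  continuous (fun t => f (circle_point s t) : R[i]^o).
Proof.
move=> s0 cf t.
apply: (@continuous_comp _ _ _ (circle_point s : R -> R[i]^o) (f : R[i]^o -> R[i]^o)).
  exact: continuous_arc.
by apply: cf; rewrite cmod_circle_point.
Qed.

Lemma ccont_circle f s : 0 <= s -> (forall w, cmod w = s -> hol_at f w) ->
  ccont (fun t => f (circle_point s t)).
Proof.
move=> s0 hf t _.
apply: (@continuous_on_circle f s s0).
by move=> w ws; apply: hol_at_continuous; exact: hf.
Qed.

Lemma i_neq0 : ('i : R[i]) != 0.
Proof. by rewrite -cmod_eq0 cmod_i oner_eq0. Qed.

(** For a sector of opening [2 pi] the two radial sides coincide, so that only the difference of the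
    two circles is left. *)
Lemma cavg_annulus f a b : 0 < a -> a <= b -> b <= 1 ->
  (forall w, a <= cmod w -> cmod w <= b -> hol_at f w) ->
  cavg (fun t => f (circle_point b t)) = cavg (fun t => f (circle_point a t)).
Proof.
move=> a0 ab b1 fh.
have /eqP : sector_int f a b 0 (pi *+ 2) = 0.
  apply: sector_int_eq0 => //; first exact: ltW twopi_gt0.
  move=> s t /andP[as_ sb] _; have s0 : 0 <= s by exact: le_trans (ltW a0) as_.
  by apply: fh; rewrite cmod_circle_point.
have per : (fun s => f (circle_point s (pi *+ 2)) / s%:C) =
           (fun s => f (circle_point s 0) / s%:C).
  by apply/funext => s; rewrite -[pi *+ 2]add0r circle_pointD2pi.
rewrite /sector_int per subrr subr0 mulf_eq0 (negbTE i_neq0)/= !cint_cavg.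
by rewrite -mulrBr mulf_eq0 (negbTE twopi_neq0)/= subr_eq0 => /eqP.
Qed.

(** The mean does not depend on the radius, and on a small circle it is close to [f 0] by
    continuity. The radius [0] is treated apart, as [cavg_annulus] needs a positive inner radius. *)
Lemma mean_value f b : 0 <= b -> b <= 1 -> (forall w, cmod w <= b -> hol_at f w) ->
  cavg (fun t => f (circle_point b t)) = f 0.
Proof.
move=> b0 b1 fh.
have [b00|bn0] := eqVneq b 0.
  rewrite b00 -[RHS]cavg_cst; apply: eq_cavg => t.
  by rewrite circle_pointE mul0r.
have {}b0 : 0 < b by rewrite lt_neqAle eq_sym bn0.
apply/eqP; rewrite -subr_eq0 -cmod_eq0; apply/negPn/negP => D0.
set D := cmod _ in D0; have {D0}Dp : 0 < D by rewrite lt_neqAle eq_sym D0 cmod_ge0.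
have c0 : {for 0, continuous (f : R[i]^o -> R[i]^o)}.
  by apply: hol_at_continuous; apply: fh; rewrite cmod0 ltW.
have D20 : 0 < D / 2 by rewrite divr_gt0.
have [e e0 He] := (continuous_cmodP _ _).1 c0 _ D20.
pose a := Num.min b (e / 2).
have a0 : 0 < a by rewrite lt_min b0 divr_gt0.
have ab : a <= b by rewrite ge_min lexx.
have ae : a < e by rewrite gt_min (_ : e / 2 < e) ?orbT// ltr_pdivrMr// mulr_natr mulr2n ltrDl.
have hol_a w : cmod w = a -> hol_at f w by move=> wa; apply: fh; rewrite wa.
have E : cavg (fun t => f (circle_point b t)) - f 0 =
    cavg (fun t => f (circle_point a t) - f 0).
  rewrite (cavg_annulus a0 ab b1); last by move=> w _; exact: fh.
  rewrite (cavgB (ccont_circle (ltW a0) hol_a)) ?cavg_cst//.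
  exact: cont_on_cst.
have : D <= D / 2.
  rewrite {1}/D E; apply: cmod_cavg_le.
    apply: (cont_onB (ccont_circle (ltW a0) hol_a)); exact: cont_on_cst.
  by move=> t; apply/ltW/He; rewrite subr0 cmod_circle_point ?ltW.
by apply/negP; rewrite -ltNge ltr_pdivrMr// mulr_natr mulr2n ltrDl.
Qed.

Lemma polar_form z : exists t, z = circle_point (cmod z) t.
Proof.
have [->|z0] := eqVneq z 0; first by exists 0; rewrite cmod0 circle_pointE mul0r.
have c0 : 0 < cmod z by rewrite cmod_gt0.
pose x := complex.Re z / cmod z; pose y := complex.Im z / cmod z.
have xy : x ^+ 2 + y ^+ 2 = 1.
  by rewrite !expr_div_n -mulrDl -cmod_sqr divff// expf_neq0// gt_eqF.
have x1 : -1 <= x <= 1.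
  by rewrite -ler_norml -(@ler_pXn2r _ 2)// ?nnegrE// real_normK ?num_real// expr1n -xy lerDl sqr_ge0.
have sy : y ^+ 2 = sin (acos x) ^+ 2.
  by rewrite sin2cos2 acosK// -xy addrC addKr.
have [yp|yn] : y = sin (acos x) \/ y = - sin (acos x).
  by move/eqP: sy; rewrite eqf_sqr => /orP[/eqP ->|/eqP ->]; [left|right].
- exists (acos x); rewrite /circle_point acosK// -yp /x /y.
  by case: z z0 c0 {x y xy x1 sy yp} => p q /= z0 c0; rewrite ![cmod _ * _]mulrC !mulfVK ?gt_eqF.
exists (- acos x); rewrite /circle_point cosN sinN acosK// -yn /x /y.
by case: z z0 c0 {x y xy x1 sy yn} => p q /= z0 c0; rewrite ![cmod _ * _]mulrC !mulfVK ?gt_eqF.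
Qed.

(** The addition formula gives [cos (t - t') = 1], and [cos] is injective on [[0, pi]]. *)
Lemma circle_point_inj s s' t t' : 0 < s -> 0 < s' -> `|t - t'| <= pi ->
  circle_point s t = circle_point s' t' -> t = t'.
Proof.
move=> s0 s'0 tt E.
have ss : s = s'.
  by have := congr1 (@cmod R) E; rewrite !cmod_circle_point ?ltW.
have s'n0 : s' != 0 by rewrite gt_eqF.
move: E; rewrite ss => -[/(mulfI s'n0) cE /(mulfI s'n0) sE].
have c1 : cos `|t - t'| = 1.
  have -> : cos `|t - t'| = cos (t - t').
    by have [h|h] := leP 0 (t - t'); rewrite ?(ger0_norm h) ?(ltr0_norm h) ?cosN.
  by rewrite cosB cE sE -!expr2 cos2Dsin2.
have : `|t - t'| = 0.
  apply: (@cos_inj R); rewrite ?in_itv/= ?lexx ?pi_ge0 ?normr_ge0 ?tt// cos0//.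
by move=> /eqP; rewrite normr_eq0 subr_eq0 => /eqP.
Qed.

(** Moves the cut of the angle, so that a given point of the circle can sit in the middle of the
    window. *)
Lemma cint_window f s c : 0 <= s ->
  (forall w, cmod w = s -> {for w, continuous (f : R[i]^o -> R[i]^o)}) ->
  cint c (c + pi *+ 2) (fun t => f (circle_point s t)) =
  (pi *+ 2)%:C * cavg (fun t => f (circle_point s t)).
Proof.
move=> s0 cf; rewrite -cint_cavg /cint.
have cc := continuous_on_circle s0 cf.
have P0 := ltW twopi_gt0.
have cRe : continuous (fun t => complex.Re (f (circle_point s t))).
  move=> t; apply: (@continuous_comp _ _ _ (fun t => f (circle_point s t) : R[i]^o)
    (fun z : R[i]^o => complex.Re z : R)); [exact: cc|exact: continuous_Re].
have cIm : continuous (fun t => complex.Im (f (circle_point s t))).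
  move=> t; apply: (@continuous_comp _ _ _ (fun t => f (circle_point s t) : R[i]^o)
    (fun z : R[i]^o => complex.Im z : R)); [exact: cc|exact: continuous_Im].
by congr (_ +i* _); [apply: (Rint_periodic c P0 cRe)|apply: (Rint_periodic c P0 cIm)] => t;
  rewrite circle_pointD2pi.
Qed.

Lemma le_linear_eq0 (D C d : R) : 0 <= D -> 0 < d ->
  (forall eta, 0 < eta -> eta < d -> D <= C * eta) -> D = 0.
Proof.
move=> D0 d0 H; apply/eqP; rewrite eq_le D0 andbT leNgt; apply/negP => Dp.
have k0 : 0 < `|C| + 1 by rewrite ltr_wpDl.
pose eta := Num.min (d / 2) (D / (2 * (`|C| + 1))).
have eta0 : 0 < eta by rewrite lt_min !divr_gt0// mulr_gt0.
have etad : eta < d by rewrite gt_min ltr_pdivrMr//; apply/orP; left; lra.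
have etaD : eta * (2 * (`|C| + 1)) <= D.
  by rewrite -ler_pdivlMr ?mulr_gt0// ge_min lexx orbT.
have := H eta eta0 etad; have := ler_norm C; nra.
Qed.

(* The singular point [z] is enclosed in a sector of size [eta], where [f] is bounded;
   [f w / w] integrates to [0] over the rest of the annulus [|z| - eta <= |w| <= |z| + eta]. *)
Lemma mean_value_except f b z : b <= 1 -> z != 0 -> cmod z < b ->
  {for z, continuous (f : R[i]^o -> R[i]^o)} ->
  (forall w, w != z -> cmod w <= b -> hol_at f w) ->
  cavg (fun t => f (circle_point b t)) = f 0.
Proof.
move=> b1 z0 zb cz fh.
pose sg := cmod z; have sg0 : 0 < sg by rewrite cmod_gt0.
have [phi zE] := polar_form z; rewrite -/sg in zE.
have fc w : cmod w <= b -> {for w, continuous (f : R[i]^o -> R[i]^o)}.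
  by move=> wb; have [->|wz] := eqVneq w z; [|apply: hol_at_continuous; exact: fh].
have [e e0 He] := (continuous_cmodP _ _).1 cz 1 ltr01.
pose M := cmod (f z) + 1; have M0 : 0 <= M by rewrite addr_ge0 ?cmod_ge0.
have fM w : cmod (w - z) < e -> cmod (f w) <= M.
  move=> we; rewrite -(subrK (f z) (f w)); apply: le_trans (ler_cmodD _ _) _.
  by rewrite addrC lerD2l ltW// He.
(* The condition [2 * eta <= sg] keeps the inner radius above [sg / 2], whence [2 / sg];
   [2 * eta < e] keeps the small sector where [|f| <= M]; [4 * eta] is its radial plus its angular
   width. *)
have key eta : 0 < eta -> 2 * eta <= sg -> eta <= b - sg -> eta < pi -> 2 * eta < e ->
  cmod (cavg (fun t => f (circle_point b t)) - f 0) * (pi *+ 2) <=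
    2 * (1 + 2 / sg) * M * (4 * eta).
  move=> h0 h1 h2 h3 h4.
  pose s1 := sg - eta; pose s2 := sg + eta.
  have s10 : 0 < s1 by rewrite /s1; lra.
  have s12 : s1 <= s2 by rewrite /s1 /s2; lra.
  have s2b : s2 <= b by rewrite /s2; lra.
  have s21 : s2 <= 1 by exact: le_trans b1.
  have E1 : cavg (fun t => f (circle_point s1 t)) = f 0.
    apply: (mean_value (ltW s10) (le_trans s12 s21)) => w ws.
    apply: fh; last by rewrite (le_trans ws)// (le_trans s12).
    by apply: contraTneq ws => ->; rewrite -ltNge /s1 -/sg; lra.
  have E2 : cavg (fun t => f (circle_point b t)) = cavg (fun t => f (circle_point s2 t)).
    apply: (cavg_annulus (lt_le_trans s10 s12) s2b b1).
    move=> w ws wb; apply: fh => //.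
    by apply: contraTneq ws => ->; rewrite -ltNge /s2 -/sg; lra.
  have sc u v : sector_cont f s1 s2 u v.
    move=> s t /andP[x1 x2] _; apply: fc.
    by rewrite cmod_circle_point ?(le_trans _ x1) ?(ltW s10)// (le_trans x2).
  have zero u v : u <= v -> phi - pi <= u -> v <= phi + pi ->
      (forall t, u <= t <= v -> t != phi) -> sector_int f s1 s2 u v = 0.
    move=> uv u1 v1 ne; apply: (sector_int_eq0 s10 s12 s21 uv) => s t /andP[x1 x2] tuv.
    have sp : 0 < s by exact: lt_le_trans x1.
    apply: fh; last by rewrite cmod_circle_point ?(ltW sp)// (le_trans x2).
    apply/eqP; rewrite zE => /circle_point_inj => /(_ sp sg0) H.
    have := ne t tuv; rewrite H ?eqxx//.
    by case/andP: tuv => y1 y2; rewrite ler_norml; clear -u1 v1 y1 y2; lra.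
  have c12 : s1 <= s1 <= s2 by rewrite lexx.
  have c22 : s1 <= s2 <= s2 by rewrite lexx andbT.
  have split u m v : u <= m -> m <= v ->
      sector_int f s1 s2 u v = sector_int f s1 s2 u m + sector_int f s1 s2 m v.
    move=> um mv; rewrite /sector_int (cint_split um mv (cont_on_arc (sc u v) c12)).
    by rewrite (cint_split um mv (cont_on_arc (sc u v) c22)); ring.
  have J1 : sector_int f s1 s2 (phi - pi) (phi + pi) =
      sector_int f s1 s2 (phi - eta) (phi + eta).
    have [l1 [l2 [l3 l4]]] : phi - pi <= phi - eta /\ (phi - eta <= phi + pi /\
        (phi - eta <= phi + eta /\ phi + eta <= phi + pi)).
      by clear -h0 h3; repeat split; lra.
    have l5 : phi - pi <= phi + eta by exact: le_trans l1 l3.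
    have l6 : phi - eta < phi by rewrite ltrBlDr ltrDl.
    have l7 : phi < phi + eta by rewrite ltrDl.
    rewrite (split _ _ _ l1 l2) (split _ _ _ l3 l4).
    rewrite (zero _ _ l1 (lexx _) l2); last first.
      by move=> t /andP[x1 x2]; rewrite lt_eqF// (le_lt_trans x2).
    rewrite (zero _ _ l4 l5 (lexx _)); last first.
      by move=> t /andP[x1 x2]; rewrite gt_eqF// (lt_le_trans l7).
    by rewrite add0r addr0.
  have J2 : sector_int f s1 s2 (phi - pi) (phi + pi) =
      'i * ((pi *+ 2)%:C * (cavg (fun t => f (circle_point b t)) - f 0)).
    have pp : phi + pi = (phi - pi) + pi *+ 2 by rewrite mulr2n; ring.
    rewrite /sector_int pp.
    have per : (fun s => f (circle_point s (phi - pi + pi *+ 2)) / s%:C) =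
           (fun s => f (circle_point s (phi - pi)) / s%:C).
      by apply/funext => s; rewrite circle_pointD2pi.
    rewrite per subrr subr0 !cint_window; first by rewrite E2 -E1 [in RHS]mulrBr.
    - exact: ltW.
    - by move=> w ws; apply: fc; rewrite ws (le_trans s12).
    - exact: ltW (lt_le_trans s10 s12).
    - by move=> w ws; apply: fc; rewrite ws.
  have : cmod (sector_int f s1 s2 (phi - pi) (phi + pi)) =
      cmod (cavg (fun t => f (circle_point b t)) - f 0) * (pi *+ 2).
    by rewrite J2 !cmodM cmod_i mul1r cmod_real ger0_norm ?(ltW twopi_gt0)// mulrC.
  move=> <-; rewrite J1.
  apply: le_trans (@sector_int_le R f s1 s2 _ _ M s10 s12 _ M0 (sc _ _) _) _.
  - lra.
  - move=> s t /andP[x1 x2] /andP[y1 y2]; apply: fM; rewrite zE.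
    apply: le_lt_trans (circle_point_lip _ _ _ (ltW sg0) _) _; first by rewrite -/sg (le_trans (ltW zb)).
    apply: le_lt_trans h4; rewrite mulr_natl mulr2n.
    rewrite /s1 in x1; rewrite /s2 in x2.
    apply: lerD; rewrite ler_norml -/sg; first by clear -x1 x2; lra.
    by clear -y1 y2; lra.
  have -> : s2 - s1 + (phi + eta - (phi - eta)) = 4 * eta by rewrite /s1 /s2; ring.
  have si : s1^-1 <= 2 / sg.
    rewrite -(@invf_div _ sg 2) lef_pV2 ?posrE; [|exact: s10|by rewrite divr_gt0].
    by rewrite /s1; clear -h1; lra.
  have e4 : 0 <= 4 * eta by clear -h0; lra.
  clear -si e4 M0; rewrite ler_wpM2r// ler_wpM2r//; lra.
have pi0 := pi_gt0 R.
have d0 : 0 < Num.min (Num.min (sg / 2) (b - sg)) (Num.min pi (e / 2)).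
  by clear -sg0 zb pi0 e0; rewrite !lt_min subr_gt0 zb pi0 !divr_gt0.
have D0 : 0 <= cmod (cavg (fun t => f (circle_point b t)) - f 0) * (pi *+ 2).
  exact: (mulr_ge0 (cmod_ge0 _) (ltW twopi_gt0)).
suff /eqP : cmod (cavg (fun t => f (circle_point b t)) - f 0) * (pi *+ 2) = 0.
  by rewrite mulf_eq0 (gt_eqF twopi_gt0) orbF cmod_eq0 subr_eq0 => /eqP.
apply: (le_linear_eq0 (C := 2 * (1 + 2 / sg) * M * 4) D0 d0) => eta h0.
rewrite !lt_min => /andP[/andP[h1 h2] /andP[h3 h4]]; rewrite -[_ * 4 * eta]mulrA.
by apply: key => //; clear -h1 h2 h4; lra.
Qed.

Lemma holomorphic_hol_at f : holomorphic f <-> forall z, cmod z < 1 -> hol_at f z.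
Proof. by []. Qed.

(* On the circle, the conjugate of [w / (w - z)] is [s^2 / (s^2 - conj z * w)], holomorphic in [w]. *)
Lemma cauchy_kernel_mean s z : 0 < s -> s < 1 -> cmod z < s ->
  cavg (fun t => circle_point s t / (circle_point s t - z)) = 1.
Proof.
move=> s0 s1 zs.
pose h w := (s ^+ 2)%:C / ((s ^+ 2)%:C - z^* * w) : R[i].
have s20 : ((s ^+ 2)%:C : R[i]) != 0.
  by rewrite -cmod_eq0 cmod_real normr_eq0 expf_neq0// gt_eqF.
have dn0 w : cmod w <= s -> (s ^+ 2)%:C - z^* * w != 0.
  move=> ws; rewrite subr_eq0; apply/eqP => /(congr1 (@cmod R)).
  rewrite cmod_real cmodM cmodJ ger0_norm ?sqr_ge0// => E.
  have : cmod z * cmod w < s ^+ 2.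
    by rewrite expr2; apply: le_lt_trans (ler_wpM2l (cmod_ge0 _) ws) _; rewrite ltr_pM2r.
  by rewrite -E ltxx.
have hh w : cmod w <= s -> hol_at h w.
  move=> ws; apply: hol_atM; first exact: hol_at_cst.
  apply: hol_atV; first exact: dn0.
  by apply: hol_atB; [exact: hol_at_cst|apply: hol_atM; [exact: hol_at_cst|exact: hol_at_id]].
have hc : ccont (fun t => h (circle_point s t)).
  by apply: ccont_circle => [|w ws]; [exact: ltW|apply: hh; rewrite ws].
have := mean_value (ltW s0) (ltW s1) hh.
rewrite {2}/h mulr0 subr0 divff// => E.
rewrite -[RHS](conjC1 R[i]) -E -cavg_conjc//; apply: eq_cavg => t.
set w := circle_point s t.
have wc : cmod w = s by rewrite cmod_circle_point// ltW.
have wz : w - z != 0.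
  rewrite subr_eq0; apply/eqP => E1; by move: zs; rewrite -E1 wc ltxx.
have w0 : w != 0 by rewrite -cmod_eq0 wc gt_eqF.
have := dn0 w; rewrite wc lexx => /(_ isT); rewrite -conjC_eq0 => dn.
have W : w * w^* = (s ^+ 2)%:C by rewrite mulcJ wc.
have wj0 : w^* != 0 by rewrite conjC_eq0.
move: dn; rewrite /h conjCM conjCV conjCB conjCM !conjC_real conjCK -W => dn.
have -> : w * w^* - z * w^* = (w - z) * w^* by ring.
by field; rewrite wz wj0.
Qed.

(* The mean value property of [w * (f w - f z) / (w - z)], which vanishes at [0]. *)
Lemma cauchy_formula f s z : holomorphic f -> 0 < s -> s < 1 -> cmod z < s ->
  cavg (fun t => f (circle_point s t) * (circle_point s t / (circle_point s t - z))) = f z.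
Proof.
move=> fh s0 s1 zs.
have fs w : cmod w <= s -> hol_at f w by move=> ws; apply: fh; exact: le_lt_trans s1.
have [z0|z0] := eqVneq z 0.
  rewrite z0 -(mean_value (ltW s0) (ltW s1) fs); apply: eq_cavg => t.
  by rewrite subr0 divff ?mulr1// -cmod_eq0 cmod_circle_point ?gt_eqF// ltW.
have /hol_atP[d Hd] := fs z (ltW zs).
(* The value [d] makes the difference quotient continuous at [z]; continuity at that single point is
   all that [mean_value_except] asks. *)
pose q w := if w == z then d else (f w - f z) / (w - z).
have cq : {for z, continuous (q : R[i]^o -> R[i]^o)}.
  apply/continuous_cmodP => e e0.
  have [|del del0 {}Hd] := Hd (e / 2); first by rewrite divr_gt0.
  exists del => // w wz; rewrite /q eqxx; case: eqVneq => [_|nwz].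
    by rewrite subrr cmod0.
  have nwz' : w - z != 0 by rewrite subr_eq0.
  have -> : (f w - f z) / (w - z) - d = (f w - f z - d * (w - z)) / (w - z) by field.
  rewrite cmodM cmodV ltr_pdivrMr ?cmod_gt0//; apply: le_lt_trans (Hd _ wz) _.
  by rewrite ltr_pM2r ?cmod_gt0// ltr_pdivrMr// mulr_natr mulr2n ltrDl.
pose G w := w * q w.
have cG : {for z, continuous (G : R[i]^o -> R[i]^o)}.
  have cid : {for z, continuous (id : R[i]^o -> R[i]^o)} by exact: cvg_id.
  exact: (cvgM cid cq).
have Gh w : w != z -> cmod w <= s -> hol_at G w.
  move=> wz ws; have wz' : w - z != 0 by rewrite subr_eq0.
  apply: (@hol_at_near _ _ (fun w => w * ((f w - f z) / (w - z)))).
    exists (cmod (w - z)); first by rewrite cmod_gt0.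
    move=> w'; rewrite /G /q; case: eqVneq => // ->.
    by rewrite cmodB ltxx.
  apply: hol_atM; first exact: hol_at_id.
  apply: hol_atM; first by apply: hol_atB; [exact: fs|exact: hol_at_cst].
  by hol.
have := mean_value_except (ltW s1) z0 zs cG Gh; rewrite {2}/G mul0r => E.
have tz t : circle_point s t - z != 0.
  rewrite subr_eq0; apply/eqP => E1; move: zs.
  by rewrite -E1 cmod_circle_point ?ltxx// ltW.
have nz w : cmod w = s -> w - z != 0.
  by move=> ws; rewrite subr_eq0; apply/eqP => E1; move: zs; rewrite -E1 ws ltxx.
have hk w : cmod w = s -> hol_at (fun w => w / (w - z)) w.
  move=> ws; apply: hol_atM; first exact: hol_at_id.
  by apply: hol_atV; [exact: nz|apply: hol_atB; [exact: hol_at_id|exact: hol_at_cst]].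
have c1 : ccont (fun t => f (circle_point s t) * (circle_point s t / (circle_point s t - z))).
  apply: (@ccont_circle (fun w => f w * (w / (w - z)))); first exact: ltW.
  by move=> w ws; apply: hol_atM; [apply: fs; rewrite ws|exact: hk].
have c2 : ccont (fun t => circle_point s t / (circle_point s t - z)).
  by apply: (@ccont_circle (fun w => w / (w - z))) => //; exact: ltW.
have c3 : ccont (fun t => f z * (circle_point s t / (circle_point s t - z))) by exact: cont_onZ.
apply/eqP; rewrite -subr_eq0 -[f z]mulr1 -{1}(cauchy_kernel_mean s0 s1 zs).
rewrite -(cavgZ (f z) c2) -(cavgB c1 c3) -[X in _ == X]E; apply/eqP; apply: eq_cavg => t.
rewrite /G /q; case: eqVneq => [E1|_]; first by have := tz t; rewrite E1 subrr eqxx.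
by field.
Qed.

End MeanValue.

Ltac ccont_step :=
  match goal with
  | H : ccont ?f |- ccont ?g => constr_eq f g; exact H
  | |- ccont (fun t => circle_point ?s t) => exact (@ccont_circle_point _ s)
  | |- ccont (fun t => ?c) => exact (@ccont_cst _ c)
  | H : ccont ?f |- ccont (fun t => ?g t) => constr_eq f g; exact H
  | |- ccont (fun t => @?f t - @?g t) => refine (@ccontB _ f g _ _)
  | |- ccont (fun t => @?f t + @?g t) => refine (@ccontD _ f g _ _)
  | |- ccont (fun t => @?f t * @?g t) => refine (@ccontM _ f g _ _)
  | |- ccont (fun t => (@?f t)^-1) => refine (@ccontV _ f _ _)
  | |- ccont (fun t => (@?f t) ^+ ?n) => refine (@ccontX _ f n _)
  | |- ccont (fun t => (@?f t)^* ) => refine (@ccont_conjc _ f _)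
  | H : rcont ?f |- rcont ?g => constr_eq f g; exact H
  | |- rcont (fun t => ?c) => exact (@rcont_cst _ c)
  | H : rcont ?f |- rcont (fun t => ?g t) => constr_eq f g; exact H
  | |- rcont (fun t => cmod (@?f t)) => refine (@rcont_cmod _ f _)
  | |- rcont (fun t => complex.Re (@?f t)) => refine (@rcont_Re _ f _)
  | |- rcont (fun t => @?f t + @?g t) => refine (@rcontD _ f g _ _)
  | |- rcont (fun t => @?f t * @?g t) => refine (@rcontM _ f g _ _)
  | |- rcont (fun t => (@?f t)^-1) => refine (@rcontV _ f _ _)
  | |- rcont (fun t => (@?f t) ^+ ?n) => refine (@rcontX _ f n _)
  end.
Ltac cont := repeat (ccont_step; cbv beta).

(** * Blaschke products *)

Section Blaschke.
Variable R : realType.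
Implicit Types (l z w : R[i]) (s : seq R[i]) (r : R).

Definition blaschke_factor l z : R[i] := (z - l) / (1 - l^* * z).
Definition blaschke s z : R[i] := \prod_(l <- s) blaschke_factor l z.

(* The divided difference [(B w - B z) / (w - z)] of the Blaschke product [B] of [s],
   in a form that is visibly holomorphic and bounded. *)
Fixpoint blaschke_quot s z w : R[i] :=
  if s is l :: s' then
    (1 - l * l^*) / ((1 - l^* * w) * (1 - l^* * z)) * blaschke s' w
      + blaschke_factor l z * blaschke_quot s' z w
  else 0.

Lemma ge_cmod_1B (u : R[i]) : 1 - cmod u <= cmod (1 - u).
Proof. by have := ler_cmod_sub 1 u; rewrite cmod1. Qed.

Lemma cmod_1BM_ge l z r : cmod l <= r -> cmod z <= 1 -> 1 - r <= cmod (1 - l^* * z).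
Proof.
move=> lr z1; apply: le_trans (ge_cmod_1B _); rewrite cmodM cmodJ lerD2l lerN2.
by apply: le_trans lr; rewrite ler_piMr ?cmod_ge0.
Qed.

Lemma cmod_1BM_neq0 l z : cmod l < 1 -> cmod z <= 1 -> 1 - l^* * z != 0.
Proof.
move=> l1 z1; rewrite -cmod_gt0; apply: lt_le_trans (cmod_1BM_ge (lexx _) z1).
by rewrite subr_gt0.
Qed.

Lemma cmod_Re2 z w : cmod (z - w) ^+ 2 = cmod z ^+ 2 + cmod w ^+ 2 - 2 * complex.Re (z^* * w).
Proof.
rewrite !cmod_sqr (_ : z^* * w = conjc z * w)//.
by case: z w => a b [c d] /=; ring.
Qed.

(** The Schwarz-Pick identity of one factor. It gives both the bound by [1] and, quantitatively,
    that the factor is nearly unimodular close to the circle. *)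
Lemma blaschke_factor_defect l z : cmod l < 1 -> cmod z <= 1 ->
  (1 - cmod (blaschke_factor l z) ^+ 2) * cmod (1 - l^* * z) ^+ 2 =
  (1 - cmod l ^+ 2) * (1 - cmod z ^+ 2).
Proof.
move=> l1 z1; have n0 := cmod_1BM_neq0 l1 z1.
have c0 : cmod (1 - l^* * z) != 0 by rewrite cmod_eq0.
rewrite /blaschke_factor cmodM cmodV exprMn exprVn mulrBl mul1r mulfVK ?expf_neq0//.
rewrite (cmodB z l) !cmod_Re2 cmod1 cmodM cmodJ.
by rewrite (_ : (1 : R[i])^* = 1) ?mul1r ?(conjC1)//; ring.
Qed.

Lemma cmod_blaschke_factor_le1 l z : cmod l < 1 -> cmod z <= 1 ->
  cmod (blaschke_factor l z) <= 1.
Proof.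
move=> l1 z1; have n0 := cmod_1BM_neq0 l1 z1.
have c0 : 0 < cmod (1 - l^* * z) ^+ 2 by rewrite exprn_gt0// cmod_gt0.
rewrite -(@ler_pXn2r _ 2)// ?nnegrE ?cmod_ge0// expr1n -subr_ge0 -(pmulr_lge0 _ c0).
rewrite blaschke_factor_defect// mulr_ge0// subr_ge0 exprn_ile1 ?cmod_ge0//.
exact: ltW.
Qed.

Lemma ratio_le (x r : R) : 0 <= x -> x <= r -> r < 1 -> (1 - x ^+ 2) / (1 - x) ^+ 2 <= 2 / (1 - r).
Proof.
move=> x0 xr r1; have x1 : 0 < 1 - x by lra.
have r10 : 0 < 1 - r by lra.
have -> : (1 - x ^+ 2) / (1 - x) ^+ 2 = (1 + x) / (1 - x) by field; lra.
rewrite ler_pdivrMr// mulrAC ler_pdivlMr//; nra.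
Qed.

(** Both denominators are at least [1 - |l|], and [(1 - |l|^2) / (1 - |l|)^2 = (1 + |l|) / (1 -
    |l|)]. Summed over [n] nodes this becomes [2 A]. *)
Lemma blaschke_weight_le l z w r : cmod l <= r -> r < 1 -> cmod z <= 1 -> cmod w <= 1 ->
  (1 - cmod l ^+ 2) / (cmod (1 - l^* * w) * cmod (1 - l^* * z)) <= 2 / (1 - r).
Proof.
move=> lr r1 z1 w1; apply: le_trans (ratio_le (cmod_ge0 l) lr r1).
have l1 : 0 < 1 - cmod l by rewrite subr_gt0 (le_lt_trans lr).
rewrite ler_wpM2l//.
  by rewrite subr_ge0 exprn_ile1 ?cmod_ge0// -subr_ge0 ltW.
have zl := cmod_1BM_ge (lexx (cmod l)) z1; have wl := cmod_1BM_ge (lexx (cmod l)) w1.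
rewrite lef_pV2 ?posrE ?mulr_gt0 ?exprn_gt0//; last 2 first.
- exact: lt_le_trans wl.
- exact: lt_le_trans zl.
by rewrite expr2 ler_pM// ltW.
Qed.

Variables (s : seq R[i]) (r : R).
Hypotheses (r1 : r < 1) (sr : forall l, l \in s -> cmod l <= r).

Lemma cmod_blaschke_le1 z : cmod z <= 1 -> cmod (blaschke s z) <= 1.
Proof.
move=> z1; rewrite /blaschke; elim: s sr => [|l s' ih] sr'; first by rewrite big_nil cmod1.
rewrite big_cons cmodM -[leRHS]mulr1 ler_pM ?cmod_ge0//; last first.
  by apply: ih => k ks; apply: sr'; rewrite inE ks orbT.
by rewrite cmod_blaschke_factor_le1// (le_lt_trans _ r1)// sr'// mem_head.
Qed.

(** The product rule for divided differences, one factor at a time: [b(w) P(w) - b(z) P(z) = (b(w) -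
    b(z)) P(w) + b(z) (P(w) - P(z))], where [P] is the product over the tail. *)
Lemma blaschke_quotP z w : cmod z <= 1 -> cmod w <= 1 ->
  (w - z) * blaschke_quot s z w = blaschke s w - blaschke s z.
Proof.
move=> z1 w1; rewrite /blaschke; elim: s sr => [|l s' ih] sr' /=.
  by rewrite !big_nil mulr0 subrr.
rewrite !big_cons mulrDr [X in _ + X]mulrCA ih; last by move=> k ks; apply: sr'; rewrite inE ks orbT.
have l1 : cmod l < 1 by rewrite (le_lt_trans _ r1)// sr'// mem_head.
have nz := cmod_1BM_neq0 l1 z1; have nw := cmod_1BM_neq0 l1 w1.
rewrite /blaschke /blaschke_factor; set X := \prod_(j <- s') _; set Y := \prod_(j <- s') _.
by field; rewrite nz nw.
Qed.

Lemma cmod_blaschke_quot z w : cmod z <= 1 -> cmod w <= 1 ->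
  cmod (blaschke_quot s z w) <= (size s)%:R * (2 / (1 - r)).
Proof.
have r10 : 0 < 1 - r by rewrite subr_gt0.
move=> z1 w1; have := cmod_blaschke_le1 w1; rewrite /blaschke.
(* Stated for all sublists because the induction on [s] below needs the bound for its tails. *)
have : forall s', {subset s' <= s} -> cmod (\prod_(l <- s') blaschke_factor l w) <= 1.
  move=> s' ss; elim: s' ss => [|l s' ih] ss; first by rewrite big_nil cmod1.
  rewrite big_cons cmodM -[leRHS]mulr1 ler_pM ?cmod_ge0//; last first.
    by apply: ih => k ks; apply: ss; rewrite inE ks orbT.
  by rewrite cmod_blaschke_factor_le1// (le_lt_trans _ r1)// sr// ss// mem_head.
move=> H _; elim: s sr H => [|l s' ih] sr' H /=; first by rewrite cmod0 mul0r.
have lr : cmod l <= r by rewrite sr'// mem_head.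
have l1 : cmod l < 1 by rewrite (le_lt_trans lr).
rewrite -natr1 [leRHS]mulrDl mul1r [leRHS]addrC; apply: le_trans (ler_cmodD _ _) _; apply: lerD.
  rewrite !cmodM cmodV cmodM -[leRHS]mulr1 ler_pM ?cmod_ge0//.
  - by rewrite divr_ge0 ?cmod_ge0// mulr_ge0 ?cmod_ge0.
  - rewrite mulcJ (_ : 1 - (cmod l ^+ 2)%:C = (1 - cmod l ^+ 2)%:C); last by rewrite rmorphB.
    rewrite cmod_real ger0_norm; last by rewrite subr_ge0 exprn_ile1 ?cmod_ge0// ltW.
    exact: blaschke_weight_le.
  - by apply: H => k ks; rewrite inE ks orbT.
rewrite cmodM -[leRHS]mul1r ler_pM ?cmod_ge0 ?cmod_blaschke_factor_le1//.
by apply: ih => [k ks|s'' ss]; [apply: sr'|apply: H => k ks]; rewrite inE ?ss ?ks ?orbT.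
Qed.

(** Each factor has defect [1 - |b|^2] at most [x], and for factors of modulus at most [1] the
    defect of a product is at most the sum of the defects. *)
Lemma cmod_blaschke_ge w (x : R) : cmod w <= 1 -> (1 - cmod w ^+ 2) * (2 / (1 - r)) <= x ->
  1 - (size s)%:R * x <= cmod (blaschke s w) ^+ 2.
Proof.
have r10 : 0 < 1 - r by rewrite subr_gt0.
move=> w1 wx; rewrite /blaschke.
have : forall s', {subset s' <= s} -> cmod (\prod_(l <- s') blaschke_factor l w) <= 1 /\
    1 - (size s')%:R * x <= cmod (\prod_(l <- s') blaschke_factor l w) ^+ 2.
  move=> s' ss; elim: s' ss => [|l s' ih] ss.
    by rewrite big_nil cmod1 mul0r subr0 expr1n.
  rewrite big_cons cmodM.
  have [] := ih; first by move=> k ks; apply: ss; rewrite inE ks orbT.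
  set P := cmod (\prod_(j <- s') _) => P1 PP.
  have lr : cmod l <= r by rewrite sr// ss// mem_head.
  have l1 : cmod l < 1 by rewrite (le_lt_trans lr).
  have b1 := cmod_blaschke_factor_le1 l1 w1.
  have P0 : 0 <= P by exact: cmod_ge0.
  split; first by rewrite -[leRHS]mulr1 ler_pM ?cmod_ge0.
  have n0 := cmod_1BM_neq0 l1 w1.
  have bx : 1 - x <= cmod (blaschke_factor l w) ^+ 2.
    rewrite lerBlDl -lerBlDr; apply: le_trans wx.
    have c0 : 0 < cmod (1 - l^* * w) ^+ 2 by rewrite exprn_gt0// cmod_gt0.
    rewrite -(ler_pM2r c0) blaschke_factor_defect// -mulrA [leLHS]mulrC ler_wpM2l//.
      by rewrite subr_ge0 exprn_ile1 ?cmod_ge0.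
    by rewrite -ler_pdivrMr// expr2 blaschke_weight_le.
  have x0 : 0 <= x.
    by apply: le_trans wx; rewrite mulr_ge0 ?divr_ge0 ?(ltW r10)// subr_ge0 exprn_ile1 ?cmod_ge0.
  rewrite exprMn /= -natr1 mulrDl mul1r.
  have P21 : P ^+ 2 <= 1 by rewrite exprn_ile1.
  have P20 : 0 <= P ^+ 2 by rewrite sqr_ge0.
  by set c := _ ^+ 2 in bx *; set d := P ^+ 2 in PP P21 P20 *; nra.
by move=> /(_ s (fun _ h => h))[].
Qed.

Lemma hol_at_blaschke z : cmod z <= 1 -> hol_at (blaschke s) z.
Proof.
move=> z1; apply: (@hol_at_prod R _ s (fun l w => blaschke_factor l w)) => l ls.
rewrite /blaschke_factor; hol.
by rewrite cmod_1BM_neq0// (le_lt_trans _ r1)// sr.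
Qed.

End Blaschke.

(** * Interpolation with control of the supremum norm *)

Section Upper.
Variable R : realType.
Implicit Types (z w : R[i]).
Notation mu := (@lebesgue_measure R).

Lemma continuous_powR_norm (p : R) : 0 < p -> continuous (fun x : R => `|x| `^ p).
Proof.
move=> p0 x; have [->|x0] := eqVneq x 0.
  apply/(@cvg_realP _ _ (nbhs (0 : R))) => e e0.
  have e1 : 0 < e `^ p^-1 by rewrite powR_gt0.
  apply/nbhs_ballP; exists (e `^ p^-1) => //= t; rewrite /ball/= sub0r normrN => te.
  rewrite normr0 powR0 ?gt_eqF// subr0 ger0_norm ?powR_ge0//.
  have := gt0_ltr_powR p0; move=> /(_ `|t| (e `^ p^-1)).
  rewrite !nnegrE normr_ge0 powR_ge0 => /(_ isT isT te).
  by rewrite -powRrM mulVf ?gt_eqF// powRr1// ltW.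
have xp : 0 < `|x| by rewrite normr_gt0.
apply: (@continuous_comp _ _ _ (@Num.norm _ R) (fun y => y `^ p)).
  exact: norm_continuous.
have : derivable (fun y : R => y `^ p) `|x| 1 by apply: derivable_powR; rewrite in_itv/= xp.
by move=> /derivable1_diffP/differentiable_continuous.
Qed.

Lemma rcont_powR (F : R -> R[i]) (p : R) : 0 < p -> ccont F -> rcont (fun t => cmod (F t) `^ p).
Proof.
move=> p0 cF t t0.
have E : (fun t => cmod (F t) `^ p) = (fun x : R => `|x| `^ p) \o (fun t => cmod (F t)).
  by apply/funext => x /=; rewrite ger0_norm ?cmod_ge0.
rewrite E; apply: continuous_comp; first exact: (rcont_cmod cF).
exact: continuous_powR_norm.
Qed.

(** Differentiation under the mean, with an explicit remainder [(w - z)^2 phi b^2 / ((a - b w) (a -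
    b z)^2)], at most [|w - z|^2 |phi| / c^3]. Both [a] and [b] vary so that poles inside and
    outside the circle are covered at once. *)
Lemma hol_at_cauchy_transform (phi a b : R -> R[i]^o) z (c e : R) :
  ccont phi -> ccont a -> ccont b -> 0 < c -> 0 < e ->
  (forall t, cmod (b t) <= 1) ->
  (forall t w, cmod (w - z) < e -> c <= cmod (a t - b t * w)) ->
  hol_at (fun w => cavg (fun t => phi t / (a t - b t * w))) z.
Proof.
move=> cphi ca cb c0 e0 b1 ab.
have n0 t w : cmod (w - z) < e -> a t - b t * w != 0.
  by move=> we; rewrite -cmod_gt0; apply: lt_le_trans (ab t w we).
have zz : cmod (z - z) < e by rewrite subrr cmod0.
have ck w : cmod (w - z) < e -> ccont (fun t => (a t - b t * w)^-1).
  by move=> we; cont => t; exact: n0.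
have cphik w : cmod (w - z) < e -> ccont (fun t => phi t / (a t - b t * w)).
  by move=> we; cont => t; exact: n0.
have cD : ccont (fun t => phi t * b t / (a t - b t * z) ^+ 2).
  by cont => t; rewrite expf_neq0// n0.
apply/hol_atP; exists (cavg (fun t => phi t * b t / (a t - b t * z) ^+ 2)) => eps eps0.
pose K := ravg (fun t => cmod (phi t)).
have K0 : 0 <= K by apply: ravg_ge0 => t; exact: cmod_ge0.
exists (Num.min e (eps * c ^+ 3 / (K + 1))).
  by rewrite lt_min e0 !(divr_gt0, mulr_gt0) ?exprn_gt0// ltr_wpDl.
move=> w; rewrite lt_min => /andP[we wd].
have cd : ccont (fun t => (w - z) * (phi t * b t / (a t - b t * z) ^+ 2)) by cont => t; rewrite expf_neq0// n0.
rewrite [X in _ - X]mulrC -(cavgZ _ cD) -(cavgB (cphik w we) (cphik z zz)).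
rewrite -(cavgB (ccontB (cphik w we) (cphik z zz)) cd).
have E t : phi t / (a t - b t * w) - phi t / (a t - b t * z) -
    (w - z) * (phi t * b t / (a t - b t * z) ^+ 2) =
    (w - z) ^+ 2 * (phi t * b t ^+ 2 / ((a t - b t * w) * (a t - b t * z) ^+ 2)).
  by have h1 := n0 t w we; have h2 := n0 t z zz; field; rewrite h1 h2.
have cR : ccont (fun t => (w - z) ^+ 2 * (phi t * b t ^+ 2 /
    ((a t - b t * w) * (a t - b t * z) ^+ 2))).
  by cont => t; rewrite mulf_neq0 ?expf_neq0 ?n0.
under eq_cavg do rewrite E.
apply: le_trans (cmod_cavg cR) _.
apply: (@le_trans _ _ (ravg (fun t => (cmod (w - z) ^+ 2 / c ^+ 3) * cmod (phi t)))).
  apply: ler_ravg; [by cont|by cont|].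
  move=> t; rewrite cmodM cmodX -[leRHS]mulrA ler_wpM2l ?sqr_ge0// [leRHS]mulrC.
  have X1 := ab t w we; have Y1 := ab t z zz.
  rewrite cmodM cmodV !cmodM; apply: ler_pM.
  - by rewrite !mulr_ge0 ?cmod_ge0.
  - by rewrite invr_ge0 !mulr_ge0 ?cmod_ge0.
  - by rewrite -[leRHS]mulr1 ler_wpM2l ?cmod_ge0// mulr_ile1 ?cmod_ge0.
  have X0 := lt_le_trans c0 X1; have Y0 := lt_le_trans c0 Y1.
  rewrite lef_pV2 ?posrE ?mulr_gt0 ?exprn_gt0//.
  by rewrite exprS expr2 !ler_pM ?mulr_ge0 ?(ltW c0).
rewrite (ravgZ _ (rcont_cmod cphi)) -/K.
move: wd; rewrite ltr_pdivlMr ?ltr_wpDl// => wd.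
set x := cmod (w - z) in wd *; have x0 : 0 <= x by exact: cmod_ge0.
have xK : x * K <= eps * c ^+ 3.
  by apply: le_trans (ltW wd); rewrite ler_wpM2l// lerDl.
rewrite (_ : x ^+ 2 / c ^+ 3 * K = x * (x * K / c ^+ 3)); last by ring.
by rewrite [leRHS]mulrC ler_wpM2l// ler_pdivrMr ?exprn_gt0.
Qed.

(* [(w - z) * K] is explicit and small where [1 - |w|^2] is; when [w] is within [O(1/A)]
   of [z], the crude bound [|K| <= 7 A] suffices. *)
Lemma kernel_bound z w q Bz Bw (A : R) (s := 1 - A^-1)
  (K := q / Bw + Bz / Bw * (s%:C * w^* / (1 - s%:C * w^* * z)) + s%:C * z^* / (1 - s%:C * z^* * w)) :
  1 <= A -> cmod z <= 1 -> cmod w <= 1 -> 1 - cmod w ^+ 2 <= (4 * A)^-1 ->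
  (w - z) * q = Bw - Bz -> cmod q <= 2 * A -> cmod Bz <= 1 -> 2^-1 <= cmod Bw ->
  cmod K <= 44 * ((1 - s * cmod z ^+ 2) / cmod (1 - s%:C * z^* * w) ^+ 2).
Proof.
move=> A1 z1 w1 wA qE q2 Bz1 Bw2.
have A0 : 0 < A by lra.
have Ai0 : 0 < A^-1 by rewrite invr_gt0.
have Ai1 : A^-1 <= 1 by rewrite invf_le1.
have s0 : 0 <= s by rewrite /s; lra.
have s1 : s < 1 by rewrite /s; lra.
have scz u v : cmod u <= 1 -> cmod v <= 1 -> A^-1 <= cmod (1 - s%:C * u^* * v).
  move=> u1 v1; apply: le_trans (ge_cmod_1B _).
  rewrite !cmodM cmodJ cmod_real ger0_norm// lerBrDr -lerBrDl -/s -mulrA ler_piMr//.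
  by rewrite mulr_ile1 ?cmod_ge0.
have Dz := scz z w z1 w1; have Dw := scz w z w1 z1.
set D := cmod (1 - s%:C * z^* * w) in Dz *.
have DD : cmod (1 - s%:C * w^* * z) = D.
  rewrite /D -[RHS]cmodJ; congr cmod.
  rewrite conjCB conjCM conjCM conjCK (_ : (1 : R[i])^* = 1) ?(conjC1)// conjC_real.
  by ring.
rewrite DD in Dw.
have D0 : 0 < D by exact: lt_le_trans Dz.
have nD1 : 1 - s%:C * z^* * w != 0 by rewrite -cmod_gt0.
have nD2 : 1 - s%:C * w^* * z != 0 by rewrite -cmod_gt0 DD.
have Bw0 : 0 < cmod Bw by lra.
have nB : Bw != 0 by rewrite -cmod_gt0.
pose W := 1 - s * cmod z ^+ 2.
have z21 : cmod z ^+ 2 <= 1 by rewrite exprn_ile1 ?cmod_ge0.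
have z20 := sqr_ge0 (cmod z).
have WA : A^-1 <= W by rewrite /W /s; clear -Ai0 Ai1 z20 z21; nra.
have W0 : 0 < W by lra.
pose V := 1 - s * cmod w ^+ 2.
have w21 : cmod w ^+ 2 <= 1 by rewrite exprn_ile1 ?cmod_ge0.
have w20 := sqr_ge0 (cmod w).
have wA' : 1 - cmod w ^+ 2 <= A^-1 / 4 by rewrite (le_trans wA)// invfM mulrC.
have VA : V <= 5 / 4 * A^-1 by rewrite /V /s; clear -Ai0 Ai1 w20 w21 wA'; nra.
have V0 : 0 <= V by rewrite /V /s; clear -Ai0 Ai1 w20 w21; nra.
have Bwi : (cmod Bw)^-1 <= 2 by rewrite invf_ple ?posrE.
have Bwi0 : 0 <= (cmod Bw)^-1 by rewrite invr_ge0 cmod_ge0.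
have Di : D^-1 <= A by rewrite invf_ple ?posrE.
have Di0 : 0 < D^-1 by rewrite invr_gt0.
(* The three summands of [K] are at most [4 A], [2 A] and [A]. *)
have K7 : cmod K <= 7 * A.
  rewrite /K; apply: le_trans (ler_cmodD _ _) _.
  apply: le_trans (lerD (ler_cmodD _ _) (lexx _)) _.
  rewrite !cmodM !cmodV !cmodJ cmod_real (ger0_norm s0) DD -/D.
  have h1 : cmod q * (cmod Bw)^-1 <= 2 * A * 2 by rewrite ler_pM ?cmod_ge0.
  have h2 : cmod Bz / cmod Bw * (s * cmod w / D) <= 1 * 2 * (1 * A).
    rewrite ler_pM ?mulr_ge0 ?cmod_ge0 ?(ltW Di0)//; first by rewrite ler_pM ?cmod_ge0.
    by rewrite ler_pM ?mulr_ge0 ?cmod_ge0 ?(ltW Di0)// mulr_ile1 ?cmod_ge0// ltW.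
  have h3 : s * cmod z / D <= 1 * A.
    by rewrite ler_pM ?mulr_ge0 ?cmod_ge0 ?(ltW Di0)// mulr_ile1 ?cmod_ge0// ltW.
  by clear -h1 h2 h3; lra.
(* The reason for the correction terms: [(w - z) q / Bw = 1 - Bz / Bw], and each correction times
   [w - z] completes one of these two terms to a fraction with small numerator, since
   [(w - z) s z' + (1 - s z' w) = W] and [(1 - s w' z) - (w - z) s w' = V]. *)
have KwE : (w - z) * K = W%:C / (1 - s%:C * z^* * w) - Bz / Bw * (V%:C / (1 - s%:C * w^* * z)).
  have zz : (W%:C : R[i]) = 1 - s%:C * (z * z^*) by rewrite mulcJ /W rmorphB rmorphM.
  have ww : (V%:C : R[i]) = 1 - s%:C * (w * w^*) by rewrite mulcJ /V rmorphB rmorphM.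
  have qE' : (w - z) * (q / Bw) = (Bw - Bz) / Bw by rewrite mulrA qE.
  rewrite zz ww /K [LHS]mulrDr [X in X + _]mulrDr qE'.
  by field; rewrite nB nD1 nD2.
have Kw : cmod (w - z) * cmod K <= 7 / 2 * W / D.
  rewrite -cmodM KwE; apply: le_trans (ler_cmodB _ _) _.
  rewrite !cmodM !cmodV DD -/D !cmod_real (gtr0_norm W0) (ger0_norm V0).
  have h2 : cmod Bz / cmod Bw * (V / D) <= 1 * 2 * (V / D).
    by rewrite ler_wpM2r ?mulr_ge0 ?(ltW Di0)// ler_pM ?cmod_ge0.
  have h3 : V / D <= 5 / 4 * W / D by rewrite ler_wpM2r ?(ltW Di0)//; clear -VA WA; lra.
  by clear -h2 h3; lra.
(* From [1 - s z' w = V + s (w - z)' w]: as [V] is [O(1/A)], a denominator well above [1/A] forces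
   [w] away from [z]. *)
have DV : D <= V + cmod (w - z).
  have -> : D = cmod (V%:C + s%:C * ((w - z)^* * w)).
    rewrite /D; congr cmod.
    have -> : (V%:C : R[i]) = 1 - s%:C * (w * w^*) by rewrite mulcJ /V rmorphB rmorphM.
    by rewrite conjCB; ring.
  apply: le_trans (ler_cmodD _ _) _; rewrite cmod_real (ger0_norm V0) lerD2l.
  rewrite !cmodM cmodJ cmod_real ger0_norm// mulrCA ler_piMr ?cmod_ge0//.
  by rewrite mulr_ile1 ?cmod_ge0// ltW.
rewrite -/W mulrA ler_pdivlMr ?exprn_gt0//.
have K0 := cmod_ge0 K.
(* The threshold is twice the bound on [V]. Above it [|w - z| >= D / 2], so [|K| D^2 <= 7 W]; below
   it [7 A (5 / (2 A))^2 = 175 / (4 A) <= 44 W], the origin of [44]. *)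
have [big|small] := leP (5 / 2 * A^-1) D.
  have h : D / 2 <= cmod (w - z) by clear -big DV VA; lra.
  have h2 : D / 2 * cmod K <= 7 / 2 * W / D by apply: le_trans Kw; rewrite ler_wpM2r.
  rewrite ler_pdivlMr// in h2.
  move: (cmod K) K0 h2 => X K0 h2; clear -K0 h2 D0 W0; nra.
have h1 : D ^+ 2 <= (5 / 2 * A^-1) ^+ 2 by clear -small D0 Ai0; rewrite lerXn2r ?nnegrE ?(ltW D0) ?(ltW small)//; lra.
have h2 : cmod K * D ^+ 2 <= 7 * A * (5 / 2 * A^-1) ^+ 2.
  by rewrite ler_pM ?sqr_ge0.
apply: le_trans h2 _.
have -> : 7 * A * (5 / 2 * A^-1) ^+ 2 = 175 / 4 * A^-1 by clear -A0; field; lra.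
by clear -WA Ai0; lra.
Qed.

(** The numerator is at most [2 (1 - s |z|)], the denominator at least [(1 - s |z|)^2], and
    [1 - s |z| >= 1/A]. *)
Lemma poisson_kernel_le z w (A : R) (s := 1 - A^-1) : 1 <= A -> cmod z <= 1 -> cmod w <= 1 ->
  (1 - s * cmod z ^+ 2) / cmod (1 - s%:C * z^* * w) ^+ 2 <= 2 * A.
Proof.
move=> A1 z1 w1.
have Ai0 : 0 < A^-1 by rewrite invr_gt0; lra.
have Ai1 : A^-1 <= 1 by rewrite invf_le1; lra.
have s0 : 0 <= s by rewrite /s; lra.
have D1 : 1 - s * cmod z <= cmod (1 - s%:C * z^* * w).
  apply: le_trans (ge_cmod_1B _); rewrite lerD2l lerN2 !cmodM cmodJ cmod_real ger0_norm//.
  by rewrite ler_piMr// mulr_ge0 ?cmod_ge0.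
move: (cmod z) (cmod (1 - _)) (cmod_ge0 z) z1 D1 => x D x0 x1 D1.
have dA : A^-1 <= 1 - s * x by rewrite /s; nra.
have d0 : 0 < 1 - s * x by lra.
rewrite ler_pdivrMr ?exprn_gt0 ?(lt_le_trans d0)//.
apply: (@le_trans _ _ (2 * A * (1 - s * x) ^+ 2)); last first.
  by rewrite ler_wpM2l ?lerXn2r ?nnegrE ?(ltW d0) ?mulr_ge0//; lra.
have h : 1 - s * x ^+ 2 <= 2 * (1 - s * x).
  have : (s * x) ^+ 2 <= s * x ^+ 2.
    by rewrite exprMn ler_wpM2r ?sqr_ge0// expr2 ler_piMr// /s; lra.
  have := sqr_ge0 (1 - s * x); nra.
apply: le_trans h _; rewrite -mulrA ler_pM2l// expr2 mulrA ler_peMl ?(ltW d0)//.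
by rewrite mulrC -ler_pdivrMr ?div1r//; lra.
Qed.

(* With [u = s * conj z], the real part of [(1 + u w) / (1 - u w)], whose mean is [1],
   is [(1 - |u w|^2) / |1 - u w|^2]. *)
Lemma poisson_mean_le1 (rho s : R) z : 0 <= rho -> rho < 1 -> 0 <= s -> s < 1 -> cmod z <= 1 ->
  ravg (fun t => (1 - s * cmod z ^+ 2) / cmod (1 - s%:C * z^* * circle_point rho t) ^+ 2) <= 1.
Proof.
move=> r0 r1 s0 s1 z1.
pose u := s%:C * z^*.
have u1 : cmod u < 1.
  rewrite cmodM cmodJ cmod_real ger0_norm//; apply: le_lt_trans s1.
  by rewrite ler_piMr.
have n0 w : cmod w <= 1 -> 1 - u * w != 0.
  by move=> w1; rewrite -[u]conjCK cmod_1BM_neq0// cmodJ.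
pose h w := (1 + u * w) / (1 - u * w).
have hh w : cmod w <= 1 -> hol_at h w by move=> w1; rewrite /h; hol; exact: n0.
have hm : cavg (fun t => h (circle_point rho t)) = 1.
  rewrite mean_value ?(ltW r1)//; first by rewrite /h mulr0 addr0 subr0 divr1.
  by move=> w wr; apply: hh; rewrite (le_trans wr)// ltW.
have hc : ccont (fun t => h (circle_point rho t)).
  by apply: ccont_circle => // w wr; apply: hh; rewrite wr ltW.
have cpos t : 0 < cmod (1 - u * circle_point rho t) ^+ 2.
  by rewrite exprn_gt0// cmod_gt0 n0// cmod_circle_point// ltW.
have ReE t : complex.Re (h (circle_point rho t)) =
    (1 - cmod u ^+ 2 * rho ^+ 2) / cmod (1 - u * circle_point rho t) ^+ 2.
  have wr : cmod (circle_point rho t) = rho by rewrite cmod_circle_point.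
  have -> : cmod u ^+ 2 * rho ^+ 2 = cmod (u * circle_point rho t) ^+ 2.
    by rewrite cmodM wr exprMn.
  set v := u * _.
  have nv : 1 - v != 0 by apply: n0; rewrite wr ltW.
  have E : h (circle_point rho t) * (cmod (1 - v) ^+ 2)%:C = (1 + v) * (1 - v)^*.
    by rewrite -mulcJ /h -/v mulrA mulfVK.
  move: E => /(congr1 (@complex.Re R)).
  have c0 : cmod (1 - v) ^+ 2 != 0 by rewrite expf_neq0// cmod_eq0.
  have -> : complex.Re (h (circle_point rho t) * (cmod (1 - v) ^+ 2)%:C) =
     complex.Re (h (circle_point rho t)) * cmod (1 - v) ^+ 2.
    by case: (h _) => x y /=; rewrite mulr0 subr0.
  move=> E; apply: (mulIf c0); rewrite mulfVK// E.
  rewrite cmod_sqr (_ : (1 - v)^* = conjc (1 - v))//.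
  by case: (v) => x y /=; ring.
have cRe : rcont (fun t => complex.Re (h (circle_point rho t))) by cont.
have key : ravg (fun t => complex.Re (h (circle_point rho t))) = 1.
  have := congr1 (@complex.Re R) hm; rewrite /cavg /cint /ravg /=.
  by rewrite mul0r subr0.
rewrite -[leRHS]key; apply: ler_ravg cRe _.
  by cont => t; rewrite gt_eqF// cpos.
move=> t; rewrite ReE; apply: ler_wpM2r.
  by rewrite invr_ge0; exact: ltW (cpos t).
(* What is left is [s^2 rho^2 |z|^2 <= s |z|^2], true because [s] and [rho] are at most [1]. *)
rewrite lerD2l lerN2.
rewrite cmodM cmodJ cmod_real (ger0_norm s0) exprMn.
have z20 := sqr_ge0 (cmod z); have r2 : rho ^+ 2 <= 1 by rewrite exprn_ile1// ltW.
have ss : s ^+ 2 <= s by rewrite expr2 ler_piMr// ltW.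
rewrite mulrAC; apply: ler_wpM2r => //.
by apply: le_trans ss; rewrite ler_piMr ?sqr_ge0.
Qed.

End Upper.

(** * The Hermite interpolant *)

Section Interpolation.
Variable R : realType.
Implicit Types (z w a : R[i]) (s : seq R[i]).

Lemma eq_ccont (f g : R -> R[i]) : (forall t, f t = g t) -> ccont g -> ccont f.
Proof. by move=> fg; rewrite (funext fg). Qed.

Lemma eq_hol_at (f g : R[i] -> R[i]) z : (forall w, f w = g w) -> hol_at g z -> hol_at f z.
Proof. by move=> fg; rewrite (funext fg). Qed.

Lemma prod_sub_count s a z : \prod_(l <- s) (z - l) =
  (z - a) ^+ (count_mem a s) * \prod_(l <- s | l != a) (z - l).
Proof.
elim: s => [|l s ih]; first by rewrite !big_nil mulr1.
rewrite !big_cons /= ih; have [->|_] /= := eqVneq l a.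
  by rewrite add1n exprS mulrA.
by rewrite add0n mulrCA.
Qed.

(** What remains of the Blaschke product once the zeros at [a] are removed; all denominators stay,
    so it is holomorphic up to the circle and exhibits the order of vanishing at [a]. *)
Definition blaschke_cofactor s a z : R[i] :=
  \prod_(l <- s | l != a) (z - l) * \prod_(l <- s) (1 - l^* * z)^-1.

Lemma blaschke_cofactorP s a z :
  blaschke s z = (z - a) ^+ (count_mem a s) * blaschke_cofactor s a z.
Proof.
by rewrite /blaschke /blaschke_factor big_split/= (prod_sub_count s a) -mulrA.
Qed.

Lemma hol_at_blaschke_cofactor s r a z : r < 1 -> (forall l, l \in s -> cmod l <= r) ->
  cmod z <= 1 -> hol_at (blaschke_cofactor s a) z.
Proof.
move=> r1 sr z1; rewrite /blaschke_cofactor.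
have h1 : hol_at (fun z => \prod_(l <- s | l != a) (z - l)) z.
  apply: (@eq_hol_at _ (fun z => \prod_(l <- [seq l <- s | l != a]) (z - l))).
    by move=> w; rewrite big_filter.
  apply: (@hol_at_prod R _ [seq l <- s | l != a] (fun l w => w - l)) => l _; hol.
have h2 : hol_at (fun z => \prod_(l <- s) (1 - l^* * z)^-1) z.
  apply: (@hol_at_prod R _ s (fun l w => (1 - l^* * w)^-1)) => l ls; hol.
  by rewrite cmod_1BM_neq0// (le_lt_trans _ r1)// sr.
exact: (hol_atM h1 h2).
Qed.

Lemma ccont_blaschke s (r rho : R) : r < 1 -> (forall l, l \in s -> cmod l <= r) ->
  0 <= rho -> rho <= 1 -> ccont (fun t => blaschke s (circle_point rho t)).
Proof.
move=> r1 sr r0 rho1; apply: ccont_circle => // w wr.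
by apply: (hol_at_blaschke r1 sr); rewrite wr.
Qed.

Lemma den_circle_neq0 l (r rho t : R) : cmod l <= r -> r < 1 -> 0 <= rho -> rho <= 1 ->
  1 - l^* * circle_point rho t != 0.
Proof.
by move=> lr r1 r0 rho1; rewrite cmod_1BM_neq0 ?cmod_circle_point// (le_lt_trans lr).
Qed.

Lemma ccont_blaschke_quot s (r rho : R) z : r < 1 -> (forall l, l \in s -> cmod l <= r) ->
  0 <= rho -> rho <= 1 -> ccont (fun t => blaschke_quot s z (circle_point rho t)).
Proof.
move=> r1 sr r0 rho1; elim: s sr => [|l s ih] sr /=; first exact: ccont_cst.
have sr' k : k \in s -> cmod k <= r by move=> ks; apply: sr; rewrite inE ks orbT.
have cb := ccont_blaschke r1 sr' r0 rho1; have cq := ih sr'.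
have lr : cmod l <= r by apply/sr/mem_head.
apply: (@eq_ccont _ (fun t => (1 - l * l^*) * ((1 - l^* * circle_point rho t)^-1 * (1 - l^* * z)^-1) *
   blaschke s (circle_point rho t) + blaschke_factor l z * blaschke_quot s z (circle_point rho t))).
  by move=> t; rewrite invfM.
cont => t; exact: (den_circle_neq0 t lr r1 r0 rho1).
Qed.

(** Unfolding the recursion moves every occurrence of [z] out of the mean as a rational factor, so
    no differentiation under the integral is needed. *)
Lemma hol_at_cavg_blaschke_quot s (r rho : R) (phi : R -> R[i]) z :
  r < 1 -> (forall l, l \in s -> cmod l <= r) ->
  0 <= rho -> rho <= 1 -> ccont phi -> cmod z < 1 ->
  hol_at (fun z => cavg (fun t => phi t * blaschke_quot s z (circle_point rho t))) z.
Proof.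
move=> r1 sr r0 rho1 cphi z1; elim: s sr => [|l s ih] sr.
  apply: (@eq_hol_at _ (fun=> cavg (fun=> 0))) => [w|]; last exact: hol_at_cst.
  by apply: eq_cavg => t; rewrite mulr0.
have sr' k : k \in s -> cmod k <= r by move=> ks; apply: sr; rewrite inE ks orbT.
have lr : cmod l <= r by apply/sr/mem_head.
have cb := ccont_blaschke r1 sr' r0 rho1.
have n0 t : 1 - l^* * circle_point rho t != 0 by exact: (den_circle_neq0 t lr r1 r0 rho1).
pose c := cavg (fun t => phi t * (blaschke s (circle_point rho t) / (1 - l^* * circle_point rho t))).
have E w : cavg (fun t => phi t * blaschke_quot (l :: s) w (circle_point rho t)) =
    (1 - l * l^*) / (1 - l^* * w) * c +
    blaschke_factor l w * cavg (fun t => phi t * blaschke_quot s w (circle_point rho t)).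
  have cq := ccont_blaschke_quot (z := w) r1 sr' r0 rho1.
  have c1 : ccont (fun t => phi t * (blaschke s (circle_point rho t) / (1 - l^* * circle_point rho t))).
    by cont.
  have c2 : ccont (fun t => phi t * blaschke_quot s w (circle_point rho t)) by cont.
  rewrite /c -(cavgZ _ c1) -(cavgZ _ c2) -cavgD; [|by cont|by cont].
  by apply: eq_cavg => t /=; rewrite invfM; ring.
apply: (eq_hol_at E); have ihz := ih sr'; rewrite /blaschke_factor.
have nz : 1 - l^* * z != 0 by rewrite cmod_1BM_neq0 ?ltW// (le_lt_trans lr).
by hol.
Qed.

(** Either [x <= T], or [(x / T)^(p - 1) >= 1]. This elementary splitting replaces interpolation
    between exponents. *)
Lemma le_addr_powR (T x p : R) : 0 < T -> 0 <= x -> 1 <= p -> x <= T + T `^ (1 - p) * x `^ p.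
Proof.
move=> T0 x0 p1; have [xT|/ltW Tx] := leP x T.
  by rewrite (le_trans xT)// lerDl mulr_ge0 ?powR_ge0.
have x0' : 0 < x by exact: lt_le_trans Tx.
apply: (@le_trans _ _ (T `^ (1 - p) * x `^ p)); last by rewrite lerDr ltW.
rewrite -{1}[x]powRr1// -{1}(subrK p 1) powRD ?(gt_eqF x0') ?implybT//.
have xp : 0 < x `^ (- (1 - p)) by exact: powR_gt0.
have Tp : 0 < T `^ (- (1 - p)) by exact: powR_gt0.
apply: ler_wpM2r; first exact: powR_ge0.
rewrite -[1 - p]opprK (powRN x) (powRN T) lef_pV2 ?posrE//.
by apply: ge0_ler_powR; rewrite ?nnegrE ?(ltW T0)//; lra.
Qed.

(** Otherwise [rho^2 <= r], and [1 <= A (1 - r) <= A (1 - rho^2) <= 1/4]. The circle of integration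
    therefore encloses all nodes. *)
Lemma radius_gt (A r rho : R) : 1 <= A -> 0 <= r -> 1 <= A * (1 - r) -> 0 < rho ->
  1 - rho ^+ 2 <= (4 * A)^-1 -> r < rho.
Proof.
move=> A1 r0 Ar rho0; rewrite -[(4 * A)^-1]mul1r ler_pdivlMr; last by lra.
move=> h; rewrite ltNge; apply/negP => rr.
have r1 : r <= 1.
  by rewrite -subr_ge0 -(pmulr_rge0 _ (_ : 0 < A)); lra.
have r2 : rho ^+ 2 <= r by nra.
have : A * (1 - r) <= A * (1 - rho ^+ 2) by rewrite ler_wpM2l//; lra.
lra.
Qed.

(* Split [|f| <= T + T^(1-p) |f|^p] with [T = (A m)^(1/p)], and bound the kernel by its
   mean on the first part and by its maximum on the second. *)
Lemma kernel_mean_le (F : R -> R[i]) (P : R -> R) (A m p : R) :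
  1 <= p -> 0 < A -> 0 < m -> ccont F -> rcont P -> (forall t, 0 <= P t) ->
  (forall t, P t <= 2 * A) -> ravg P <= 1 -> ravg (fun t => cmod (F t) `^ p) <= m ->
  ravg (fun t => cmod (F t) * (44 * P t)) <= 132 * (A * m) `^ p^-1.
Proof.
move=> p1 A0 m0 cF cP P0 P2A Pm Fm; have p0 : 0 < p by lra.
have Am : 0 < A * m by rewrite mulr_gt0.
pose T := (A * m) `^ p^-1; have T0 : 0 < T by rewrite powR_gt0.
have cFp := rcont_powR p0 cF.
(* On the first part [P] is kept, on the second it is replaced by [2 A], whence [88 = 44 * 2]. Since
   [A m T^(1 - p) = T], the total is [44 + 88 = 132] times [T]. *)
apply: (@le_trans _ _ (ravg (fun t => 44 * T * P t + 88 * A * T `^ (1 - p) * cmod (F t) `^ p))).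
  apply: ler_ravg; [by cont|by cont|move=> t].
  have h := le_addr_powR T0 (cmod_ge0 (F t)) p1.
  apply: le_trans (ler_wpM2r _ h) _; first by rewrite mulr_ge0.
  have X0 : 0 <= T `^ (1 - p) * cmod (F t) `^ p by rewrite mulr_ge0 ?powR_ge0.
  rewrite -[88 * A * _ * _]mulrA; move: (_ * _ `^ p) X0 (P2A t) => X X0 PA.
  by clear -X0 PA; nra.
have cP' : rcont (fun t => 44 * T * P t) by cont.
have cF' : rcont (fun t => 88 * A * T `^ (1 - p) * cmod (F t) `^ p) by cont.
rewrite (ravgD cP' cF') (ravgZ _ cP) (ravgZ _ cFp).
have e1 : 44 * T * ravg P <= 44 * T by rewrite ler_piMr// mulr_ge0// ltW.
have e2 : 88 * A * T `^ (1 - p) * ravg (fun t => cmod (F t) `^ p) <= 88 * T.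
  apply: (@le_trans _ _ (88 * A * T `^ (1 - p) * m)).
    by rewrite ler_wpM2l// !mulr_ge0 ?powR_ge0// ltW.
  have -> : 88 * A * T `^ (1 - p) * m = 88 * ((A * m) * T `^ (1 - p)) by ring.
  rewrite ler_pM2l// /T -{1}[A * m]powRr1 ?(ltW Am)// -powRrM -powRD; last first.
    by rewrite (gt_eqF Am) implybT.
  by have -> // : 1 + p^-1 * (1 - p) = p^-1 by field; lra.
by rewrite -/T; lra.
Qed.

(** The bound [m] is left free so that both scales of spaces share the construction: only the mean
    over one circle close to the boundary enters. *)
Lemma hermite_interpolation (f : R[i] -> R[i]) (n : nat) (sigma : n.-tuple R[i])
    (r rho p m : R) (A := n%:R / (1 - r)) :
  (0 < n)%N -> 0 <= r -> r < 1 -> (forall l, l \in sigma -> cmod l <= r) ->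
  holomorphic f -> 0 < rho -> rho < 1 -> 1 - rho ^+ 2 <= (4 * A)^-1 ->
  1 <= p -> 0 < m -> ravg (fun t => cmod (f (circle_point rho t)) `^ p) <= m ->
  exists g : R[i] -> R[i], [/\ holomorphic g, agree_on sigma g f &
    forall z, cmod z < 1 -> cmod (g z) <= 132 * (A * m) `^ p^-1].
Proof.
move=> n0 r0 r1 sr fh rho0 rho1 rhoA p1 m0 fm.
have r10 : 0 < 1 - r by rewrite subr_gt0.
have n1 : 1 <= n%:R :> R by rewrite ler1n.
have A1 : 1 <= A by rewrite /A ler_pdivlMr// mul1r; lra.
have A0 : 0 < A by lra.
have Ai0 : 0 < A^-1 by rewrite invr_gt0.
have Ai1 : A^-1 <= 1 by rewrite invf_le1.
have rrho : r < rho.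
  apply: (radius_gt A1 r0 _ rho0 rhoA); rewrite /A divfK ?gt_eqF//.
have rho0' := ltW rho0; have rho1' := ltW rho1.
pose w t := circle_point rho t.
have wc t : cmod (w t) = rho by rewrite cmod_circle_point.
have w1 t : cmod (w t) <= 1 by rewrite wc.
pose s := 1 - A^-1.
have s0 : 0 <= s by rewrite /s; lra.
have s1 : s < 1 by rewrite /s; lra.
pose B := blaschke sigma.
have B1 z : cmod z <= 1 -> cmod (B z) <= 1 by exact: (cmod_blaschke_le1 r1 sr).
(* The radius is chosen for this: [n (1 - rho^2) 2 / (1 - r) <= 1/2]. The weaker [3/4] suffices, as
   it leaves [|B|^2 >= 1/4]. *)
have B2 t : 2^-1 <= cmod (B (w t)).
  have h : (1 - cmod (w t) ^+ 2) * (2 / (1 - r)) <= 3 / 4 / n%:R.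
    rewrite wc; apply: (@le_trans _ _ ((4 * A)^-1 * (2 / (1 - r)))).
      by rewrite ler_wpM2r ?divr_ge0 ?(ltW r10).
    have -> : (4 * A)^-1 * (2 / (1 - r)) = 2^-1 / n%:R.
      by rewrite /A; field; apply/andP; split; lra.
    by rewrite ler_wpM2r ?invr_ge0//; lra.
  have := cmod_blaschke_ge r1 sr (w1 t) h; rewrite size_tuple.
  have -> : n%:R * (3 / 4 / n%:R) = 3 / 4 :> R by field; lra.
  rewrite -/B => H.
  by rewrite -(@ler_pXn2r _ 2)// ?nnegrE ?cmod_ge0//; lra.
have Bn0 t : B (w t) != 0 by rewrite -cmod_gt0 (lt_le_trans _ (B2 t))// invr_gt0.
have fhol z : cmod z < 1 -> hol_at f z by exact: fh.
have cf : ccont (fun t => f (w t)).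
  by apply: (ccont_circle rho0') => z zr; apply: fhol; rewrite zr.
have cB : ccont (fun t => B (w t)) by exact: (ccont_blaschke r1 sr).
have cw : ccont w by exact: ccont_circle_point.
pose phi t := f (w t) * w t / B (w t).
have cphi : ccont phi by rewrite /phi; cont.
pose g1 z := cavg (fun t => phi t * blaschke_quot sigma z (w t)).
pose g2 z := cavg (fun t => phi t * (s%:C * (w t)^*) / (1 - s%:C * (w t)^* * z)).
pose g z := g1 z + B z * g2 z.
have sw1 t : cmod (s%:C * (w t)^*) <= 1.
  by rewrite cmodM cmodJ cmod_real ger0_norm// mulr_ile1 ?cmod_ge0// ltW.
have csw : ccont (fun t => s%:C * (w t)^*) by cont.
have cphisw : ccont (fun t => phi t * (s%:C * (w t)^*)) by cont.
have nsw t z : cmod z < 1 -> 1 - s%:C * (w t)^* * z != 0.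
  move=> z1; rewrite -cmod_gt0; apply: lt_le_trans (ge_cmod_1B _).
  rewrite subr_gt0 cmodM; apply: le_lt_trans z1.
  by rewrite ler_piMl ?cmod_ge0.
have g2h z : cmod z < 1 -> hol_at g2 z.
  move=> z1; have e0 : 0 < (1 - cmod z) / 2 by rewrite divr_gt0// subr_gt0.
  refine (@hol_at_cauchy_transform R (fun t => phi t * (s%:C * (w t)^*)) (fun=> 1)
    (fun t => s%:C * (w t)^*) z _ _ cphisw (@ccont_cst R 1) csw e0 e0 sw1 _) => t u uz.
  apply: le_trans (ge_cmod_1B _); rewrite cmodM.
  have uu : cmod u <= cmod z + (1 - cmod z) / 2.
    by have := ler_cmod_sub u z; clear -uz; lra.
  have : cmod (s%:C * (w t)^*) * cmod u <= cmod u by rewrite ler_piMl ?cmod_ge0.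
  by clear -uu z1; lra.
have gh z : cmod z < 1 -> hol_at g z.
  move=> z1; apply: hol_atD.
    exact: (hol_at_cavg_blaschke_quot r1 sr rho0' rho1' cphi z1).
  apply: hol_atM; last exact: g2h.
  by apply: (hol_at_blaschke r1 sr); exact: ltW.
exists g; split; first exact: gh.
  move=> a asig; have ar := sr a asig.
  (* The factor [1 * z] gives the denominator the shape [a t - b t * z] of
     [hol_at_cauchy_transform]. *)
  pose h1 z := cavg (fun t => phi t / (w t - 1 * z)).
  pose h z := h1 z - g2 z.
  have h1h z : cmod z < rho -> hol_at h1 z.
    move=> zr; have e0 : 0 < (rho - cmod z) / 2 by rewrite divr_gt0// subr_gt0.
    have b1 (t : R) : cmod (1 : R[i]) <= 1 by rewrite cmod1.
    refine (@hol_at_cauchy_transform R phi w (fun=> 1) z _ _ cphi cw (@ccont_cst R 1) e0 e0 b1 _).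
    move=> t u uz; clear b1; rewrite mul1r; have := ler_cmod_sub (w t) u; rewrite wc.
    have := ler_cmod_sub u z; clear -uz; lra.
  (* In Cauchy's formula for [f], split [1 / (w - z) = q / B(w) + B(z) / (B(w) (w - z))]; the first
     part gives [g1], so [f = g1 + B h1]. *)
  have fg z : cmod z < rho -> g z - f z = - (B z * h z).
    move=> zr; have z1 := lt_trans zr rho1.
    have nwz t : w t - z != 0.
      by rewrite subr_eq0; apply/eqP => E; move: zr; rewrite -E wc ltxx.
    have cq : ccont (fun t => blaschke_quot sigma z (w t)) by exact: (ccont_blaschke_quot r1 sr).
    have c1 : ccont (fun t => phi t / (w t - z)) by cont.
    have c2 : ccont (fun t => phi t * blaschke_quot sigma z (w t)) by cont.
    have h1E : h1 z = cavg (fun t => phi t / (w t - z)).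
      by apply: eq_cavg => t; rewrite mul1r.
    rewrite /g /h -(cauchy_formula fh rho0 rho1 zr) h1E.
    have -> : cavg (fun t => f (circle_point rho t) * (circle_point rho t / (circle_point rho t - z))) =
        g1 z + B z * cavg (fun t => phi t / (w t - z)).
      rewrite /g1 -(cavgZ _ c1) -cavgD; [|by cont|by cont].
      apply: eq_cavg => t; rewrite -/(w t) /phi.
      have zz : cmod z <= 1 by exact: ltW.
      have qE := blaschke_quotP r1 sr zz (w1 t); rewrite -/B in qE.
      have -> : blaschke_quot sigma z (w t) = (B (w t) - B z) / (w t - z).
        by rewrite -qE mulrAC divff ?mul1r.
      by field; rewrite Bn0 nwz.
    ring.
  (* Cauchy's formula covers only [|z| < rho]. The nodes satisfy [|a| <= r < rho], so outside that
     disc the plain quotient has no singularity. *)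
  pose k z := if cmod z < rho then - (blaschke_cofactor sigma a z * h z)
              else (g z - f z) / (z - a) ^+ (count_mem a sigma).
  have kE z : cmod z < 1 -> g z - f z = (z - a) ^+ (count_mem a sigma) * k z.
    move=> z1; rewrite /k; case: ltP => zr.
      by rewrite fg// /B (blaschke_cofactorP _ a); ring.
    rewrite mulrC divfK// expf_neq0// subr_eq0; apply/eqP => E.
    by move: zr; rewrite E => /(lt_le_trans rrho); rewrite ltNge ar.
  exists k; last by move=> z; exact: kE.
  suff kh z : cmod z < 1 -> hol_at k z by exact: kh.
  move=> z1.
  have [zr|zr] := ltP (cmod z) rho.
    apply: (@hol_at_near _ _ (fun z => - 1 * (blaschke_cofactor sigma a z * h z))).
      exists (rho - cmod z); first by rewrite subr_gt0.
      move=> u uz; rewrite /k; case: ltP => [_|ur]; first by rewrite mulN1r.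
      by exfalso; have := ler_cmod_sub u z; clear -uz ur; lra.
    have hc := hol_at_blaschke_cofactor (a := a) r1 sr (ltW z1).
    have hh1 := h1h z zr; have hh2 := g2h z z1.
    by rewrite /h; hol; exact: hc.
  have za : z - a != 0.
    rewrite subr_eq0; apply/eqP => E.
    by move: zr; rewrite E => /(lt_le_trans rrho); rewrite ltNge ar.
  apply: (@hol_at_near _ _ (fun z => (g z - f z) / (z - a) ^+ (count_mem a sigma))).
    exists (Num.min (cmod (z - a)) (1 - cmod z)).
      by rewrite lt_min cmod_gt0 za subr_gt0.
    move=> u; rewrite lt_min => /andP[ua u1].
    have u1' : cmod u < 1 by have := ler_cmod_sub u z; clear -u1; lra.
    have nua : u - a != 0.
      apply/eqP => /eqP; rewrite subr_eq0 => /eqP E.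
      by move: ua; rewrite E cmodB ltxx.
    by rewrite (kE u u1') mulrAC divff ?mul1r// expf_neq0.
  have hg := gh z z1; have hf := fhol z z1.
  by hol; rewrite expf_neq0.
move=> z z1.
pose P t := (1 - s * cmod z ^+ 2) / cmod (1 - s%:C * z^* * w t) ^+ 2.
pose K t := blaschke_quot sigma z (w t) / B (w t) +
  B z / B (w t) * (s%:C * (w t)^* / (1 - s%:C * (w t)^* * z)) +
  s%:C * z^* / (1 - s%:C * z^* * w t).
have z1' := ltW z1.
have sz1 : cmod (s%:C * z^*) < 1.
  rewrite cmodM cmodJ cmod_real ger0_norm//; apply: le_lt_trans s1.
  by rewrite ler_piMr.
have nsz u : cmod u <= 1 -> 1 - s%:C * z^* * u != 0.
  by move=> u1; rewrite -[s%:C * z^*]conjCK cmod_1BM_neq0// cmodJ.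
have cq : ccont (fun t => blaschke_quot sigma z (w t)) by exact: (ccont_blaschke_quot r1 sr).
have gK : g z = cavg (fun t => f (w t) * w t * K t).
  have c1 : ccont (fun t => phi t * blaschke_quot sigma z (w t)) by cont.
  have c2 : ccont (fun t => phi t * (s%:C * (w t)^*) / (1 - s%:C * (w t)^* * z)).
    by cont => t; exact: nsw.
  have c3 : ccont (fun t => f (w t) * w t * (s%:C * z^* / (1 - s%:C * z^* * w t))).
    by cont => t; apply: nsz.
  (* The correction is holomorphic in the integration variable, and the extra factor [u] makes the
     value at [0] vanish. *)
  have e3 : cavg (fun t => f (w t) * w t * (s%:C * z^* / (1 - s%:C * z^* * w t))) = 0.
    rewrite (@mean_value R (fun u => f u * u * (s%:C * z^* / (1 - s%:C * z^* * u))) rho)//.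
      by rewrite mulr0 mul0r.
    move=> u ur; have u1 : cmod u < 1 by exact: le_lt_trans rho1.
    have hf := fhol u u1; hol; exact/nsz/ltW.
  have c23 : ccont (fun t => B z * (phi t * (s%:C * (w t)^*) / (1 - s%:C * (w t)^* * z))).
    by apply: ccontM c2; exact: ccont_cst.
  rewrite /g -[LHS]addr0 -e3 /g1 /g2 -(cavgZ _ c2) -(cavgD c1 c23) -(cavgD (ccontD c1 c23) c3).
  by apply: eq_cavg => t; rewrite /K /phi; ring.
have cK : ccont (fun t => f (w t) * w t * K t).
  by rewrite /K; cont => t; [exact: Bn0|exact: Bn0|exact: nsw|exact/nsz/w1].
have nP t : cmod (1 - s%:C * z^* * w t) ^+ 2 != 0.
  by rewrite expf_neq0// cmod_eq0; exact: nsz.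
have cP : rcont P by rewrite /P; cont.
have z21 : cmod z ^+ 2 <= 1 by rewrite exprn_ile1 ?cmod_ge0.
have z20 := sqr_ge0 (cmod z).
have W0 : 0 <= 1 - s * cmod z ^+ 2 by rewrite subr_ge0 mulr_ile1// ltW.
have P0 t : 0 <= P t by rewrite /P divr_ge0// sqr_ge0.
have KP t : cmod (K t) <= 44 * P t.
  apply: kernel_bound => //; first by rewrite wc.
  - exact: (blaschke_quotP r1 sr).
  - have := cmod_blaschke_quot r1 sr z1' (w1 t); rewrite size_tuple => /le_trans; apply.
    by rewrite /A mulrCA.
  - exact: B1.
have P2A t : P t <= 2 * A by exact: poisson_kernel_le.
have Pm : ravg P <= 1 by apply: poisson_mean_le1.
rewrite gK; apply: le_trans (cmod_cavg cK) (le_trans _ (kernel_mean_le p1 A0 m0 cf cP P0 P2A Pm fm)).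
apply: ler_ravg; [by cont|by cont|move=> t].
rewrite !cmodM wc -mulrA ler_wpM2l ?cmod_ge0//; apply: le_trans (KP t).
by rewrite ler_piMl ?cmod_ge0.
Qed.

End Interpolation.

(** * Lower bounds *)

Section LowerBound.
Variable R : realType.
Implicit Types (z w : R[i]).

Lemma ccont_sum (I : Type) (s : seq I) (F : I -> R -> R[i]) : (forall i, ccont (F i)) ->
  ccont (fun t => \sum_(i <- s) F i t).
Proof.
move=> cF; elim: s => [|i s ih].
  by apply: (@eq_ccont _ _ (fun=> 0)) => [t|]; [rewrite big_nil|exact: ccont_cst].
apply: (@eq_ccont _ _ (fun t => F i t + \sum_(j <- s) F j t)) => [t|].
  by rewrite big_cons.
exact: (ccontD (cF i) ih).
Qed.

Lemma cavg_sum (I : Type) (s : seq I) (F : I -> R -> R[i]) : (forall i, ccont (F i)) ->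
  cavg (fun t => \sum_(i <- s) F i t) = \sum_(i <- s) cavg (F i).
Proof.
move=> cF; elim: s => [|i s ih].
  rewrite big_nil -[RHS](@cavg_cst R 0).
  by apply: eq_cavg => t; rewrite big_nil.
rewrite big_cons -ih -(cavgD (cF i) (ccont_sum (s := s) cF)).
by apply: eq_cavg => t; rewrite big_cons.
Qed.

Variables (n : nat) (x : R).
Hypotheses (x0 : 0 < x) (x1 : x < 1).
Notation w := (circle_point x).

Let wc t : cmod (w t) = x. Proof. by rewrite cmod_circle_point// ltW. Qed.

Let conjwX t j : (w t)^* ^+ j * (w t) ^+ j = (x ^+ (2 * j))%:C.
Proof. by rewrite -exprMn [_^* * _]mulrC mulcJ wc -rmorphXn/= -exprM. Qed.

Lemma mean_holX k j : (forall z, cmod z < 1 -> hol_at k z) -> (0 < j)%N ->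
  cavg (fun t => w t ^+ j * k (w t)) = 0.
Proof.
move=> kh j0; rewrite (@mean_value R (fun u => u ^+ j * k u) x (ltW x0) (ltW x1)).
  by rewrite expr0n gtn_eqF// mul0r.
move=> u ux; have ku : hol_at k u by apply: kh; exact: le_lt_trans x1.
by hol.
Qed.

(** For [b < a] the modulus is constant and factors out, leaving a positive power of mean zero; the
    case [a < b] is its conjugate. *)
Lemma mean_monomial a b : cavg (fun t => w t ^+ a * (w t)^* ^+ b) =
  ((a == b)%:R * x ^+ (2 * b))%:C.
Proof.
have key c d : (d < c)%N -> cavg (fun t => w t ^+ c * (w t)^* ^+ d) = 0.
  move=> dc; have c1 : ccont (fun t => w t ^+ (c - d) * 1) by cont.
  rewrite -[RHS](mulr0 (x ^+ (2 * d))%:C).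
  rewrite -(@mean_holX (fun=> 1) (c - d)) ?subn_gt0//; last by move=> z _; hol.
  rewrite -(cavgZ _ c1); apply: eq_cavg => t; rewrite mulr1 -(conjwX t) -mulrA -exprD.
  by rewrite subnKC ?(ltnW dc)// mulrC.
have [ab|ba|->] := ltngtP a b.
- rewrite mul0r -[RHS](conjC0 R[i]) -(key b a ab).
  have c1 : ccont (fun t => w t ^+ b * (w t)^* ^+ a) by cont.
  rewrite -(cavg_conjc c1); apply: eq_cavg => t.
  by rewrite conjCM !rmorphXn/= conjCK mulrC.
- by rewrite mul0r key.
- rewrite mul1r -[RHS]cavg_cst; apply: eq_cavg => t; by rewrite -(conjwX t) mulrC.
Qed.

Let Q z : R[i] := \sum_(j < n) z ^+ j.
(** In closed form, the sum of [x^(2 j)] over [i <= j < n]: the Fejer coefficients, damped by the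
    radius. The double sum is what expanding [|Q|^2] yields. *)
Let lam i : R := \sum_(j < n) \sum_(l < n) (i + l == j)%N%:R * x ^+ (2 * j).

Let QJ t : (Q (w t))^* = \sum_(j < n) (w t)^* ^+ j.
Proof. by rewrite /Q rmorph_sum; apply: eq_bigr => j _; rewrite rmorphXn. Qed.

Let cQ : ccont (fun t => Q (w t)).
Proof. by apply: (ccont_circle (ltW x0)) => z _; apply: hol_at_sum => j; hol. Qed.

Lemma fejer_monomial i : cavg (fun t => w t ^+ i * (Q (w t) * (Q (w t))^*)) = (lam i)%:C.
Proof.
rewrite /lam rmorph_sum/=; under eq_bigr do rewrite rmorph_sum/=.
have E t : w t ^+ i * (Q (w t) * (Q (w t))^*) =
    \sum_(j < n) \sum_(l < n) w t ^+ (i + l) * (w t)^* ^+ j.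
  rewrite QJ mulrA mulr_sumr; apply: eq_bigr => j _.
  by rewrite /Q mulr_sumr mulr_suml; apply: eq_bigr => l _; rewrite exprD.
rewrite (eq_cavg E) cavg_sum.
  apply: eq_bigr => j _; rewrite cavg_sum; last by move=> l; cont.
  by apply: eq_bigr => l _; rewrite mean_monomial.
move=> j; apply: (@eq_ccont _ _ (fun t => (w t ^+ i * Q (w t)) * (w t)^* ^+ j)).
  by move=> t; rewrite /Q mulr_sumr mulr_suml; apply: eq_bigr => l _; rewrite exprD.
by cont.
Qed.

(** The conjugate of [Q] has degree below [n], and [w^n w'^j = x^(2 j) w^(n - j)] keeps a positive
    power of [w], so each term has mean zero. *)
Lemma fejer_high k : (forall z, cmod z < 1 -> hol_at k z) ->
  cavg (fun t => w t ^+ n * k (w t) * (Q (w t) * (Q (w t))^*)) = 0.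
Proof.
move=> kh.
have Qh z : hol_at Q z by apply: hol_at_sum => j; hol.
have kw : ccont (fun t => k (w t)).
  by apply: (ccont_circle (ltW x0)) => z zx; apply: kh; rewrite zx.
have E t : w t ^+ n * k (w t) * (Q (w t) * (Q (w t))^*) =
    \sum_(j < n) (x ^+ (2 * j))%:C * (w t ^+ (n - j) * (k (w t) * Q (w t))).
  rewrite QJ mulr_sumr [LHS]mulr_sumr; apply: eq_bigr => j _.
  have e : w t ^+ n = w t ^+ (n - j) * w t ^+ j by rewrite -exprD subnK// ltnW.
  rewrite -(conjwX t) e; move: (w t ^+ (n - j)) (w t ^+ j) ((w t)^* ^+ j) => a b c; ring.
have c1 (j : 'I_n) : ccont (fun t => w t ^+ (n - j) * (k (w t) * Q (w t))) by cont.
rewrite (eq_cavg E) cavg_sum; last by move=> j; have := c1 j => c2; cont.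
apply: big1 => j _; rewrite (cavgZ _ (c1 j)).
have kQ z : cmod z < 1 -> hol_at (fun u => k u * Q u) z.
  by move=> z1; have h1 := kh z z1; have h2 := Qh z; hol.
have nj : (0 < n - j)%N by rewrite subn_gt0.
by rewrite (mean_holX kQ nj) mulr0.
Qed.

Lemma lam_ge0 i : 0 <= lam i.
Proof. by rewrite !sumr_ge0// => j _; rewrite sumr_ge0// => l _; rewrite mulr_ge0// exprn_ge0// ltW. Qed.

Lemma lam0_le : lam 0 <= n%:R.
Proof.
rewrite /lam -[n in leRHS]card_ord -sum1_card natr_sum; apply: ler_sum => j _.
rewrite (bigD1 j)//= add0n eqxx mul1r big1 ?addr0.
  by rewrite exprn_ile1// ltW.
by move=> l lj; rewrite add0n (_ : (l : nat) == j = false) ?mul0r//; apply/negbTE.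
Qed.

Lemma lam_ge i : (i <= n)%N -> (n - i)%:R * x ^+ (2 * n) <= lam i.
Proof.
move=> ni; rewrite /lam.
apply: (@le_trans _ _ (\sum_(j < n | (i <= j)%N) x ^+ (2 * n))).
  rewrite -(big_mkord (fun j => (i <= j)%N) (fun=> x ^+ (2 * n))).
  have -> : (n - i)%:R * x ^+ (2 * n) = \sum_(i <= j < n) x ^+ (2 * n).
    by rewrite sumr_const_nat mulr_natl.
  by rewrite (big_nat_widenl _ 0)//=.
rewrite big_mkcond/=; apply: ler_sum => j _; case: ifP => ij; last first.
  by rewrite sumr_ge0// => l _; rewrite mulr_ge0// exprn_ge0// ltW.
have lji : (j - i < n)%N by rewrite (leq_ltn_trans (leq_subr _ _)).
rewrite (bigD1 (Ordinal lji))//= subnKC// eqxx mul1r ler_wpDr//.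
  by rewrite sumr_ge0// => l _; rewrite mulr_ge0// exprn_ge0// ltW.
by rewrite ler_wiXn2l ?(ltW x0) ?(ltW x1)// leq_mul2l/= ltnW.
Qed.

Lemma lam_eq0 i : (n <= i)%N -> lam i = 0.
Proof.
move=> ni; rewrite /lam big1// => j _; rewrite big1// => l _.
rewrite (_ : (i + l == j)%N = false) ?mul0r//.
by apply/negbTE; rewrite gtn_eqF// (leq_trans (ltn_ord j))// (leq_trans ni)// leq_addr.
Qed.

(* The mean of [p(w) |Q(w)|^2] over [|w| = x], where [Q(w) = 1 + w + ... + w^(n-1)]; this
   functional does not see multiples of [w^n]. *)
Definition fejer_fun (p : {poly R}) : R := \sum_(i < n) p`_i * lam i.

Lemma fejer_poly (p : {poly R}) :
  cavg (fun t => (map_poly (real_complex R) p).[w t] * (Q (w t) * (Q (w t))^*)) =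
  (fejer_fun p)%:C.
Proof.
have E t : (map_poly (real_complex R) p).[w t] * (Q (w t) * (Q (w t))^*) =
    \sum_(i < maxn (size p) n) (p`_i)%:C * (w t ^+ i * (Q (w t) * (Q (w t))^*)).
  rewrite (@horner_coef_wide _ (maxn (size p) n)).
    by rewrite mulr_suml; apply: eq_bigr => i _; rewrite coef_map/= mulrA.
  by rewrite size_map_poly leq_maxl.
have c1 (i : nat) : ccont (fun t => w t ^+ i * (Q (w t) * (Q (w t))^*)) by cont.
rewrite (eq_cavg E) cavg_sum; last by move=> i; have c2 := c1 i; cont.
under eq_bigr => i _ do rewrite (cavgZ _ (c1 i)) fejer_monomial.
rewrite /fejer_fun rmorph_sum/=.
rewrite -(big_mkord xpredT (fun i => (p`_i)%:C * (lam i)%:C)).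
rewrite (big_cat_nat (n := n)) ?leq_maxr//= [X in _ + X]big1_seq ?addr0.
  by rewrite big_mkord; apply: eq_bigr => i _; rewrite rmorphM.
by move=> i; rewrite mem_index_iota => /andP[_ /andP[ni _]]; rewrite lam_eq0// mulr0.
Qed.

Lemma fejer_fun_ge0 (p : {poly R}) : (forall i, 0 <= p`_i) -> 0 <= fejer_fun p.
Proof. by move=> p0; apply: sumr_ge0 => i _; rewrite mulr_ge0// lam_ge0. Qed.

Lemma fejer_funD (p q : {poly R}) : fejer_fun (p + q) = fejer_fun p + fejer_fun q.
Proof.
by rewrite /fejer_fun -big_split; apply: eq_bigr => i _ /=; rewrite coefD mulrDl.
Qed.

(** The degree [(size p).-1] is at most [n / 2], so every coefficient that occurs has weight at
    least [(n / 2) x^(2 n)]. *)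
Lemma fejer_fun_low (p : {poly R}) : (forall i, 0 <= p`_i) -> (2 * (size p).-1 <= n)%N ->
  (0 < n)%N -> n%:R / 2 * x ^+ (2 * n) * p.[1] <= fejer_fun p.
Proof.
move=> p0 sp n0.
have spn : (size p <= n)%N by lia.
rewrite (horner_coef_wide _ spn) /fejer_fun mulr_sumr; apply: ler_sum => i _.
rewrite expr1n mulr1 mulrC; have [ip|pi] := ltnP i (size p); last first.
  by rewrite nth_default// !mul0r.
rewrite ler_wpM2l//; apply: le_trans (lam_ge (ltnW (ltn_ord i))).
rewrite ler_wpM2r ?exprn_ge0 ?(ltW x0)//.
rewrite ler_pdivrMr// -natrM ler_nat; have := ltn_ord i; lia.
Qed.

(** The weight [|Q|^2] is nonnegative with mean [lam 0 <= n], so the weighted mean of [G] is at most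
    [M n]; the [w^n] part contributes nothing to it. *)
Lemma fejer_lower (G k : R[i] -> R[i]) (p : {poly R}) (C M : R) :
  (0 < n)%N -> (forall z, cmod z < 1 -> hol_at k z) ->
  (forall z, cmod z < 1 -> G z = C%:C * (map_poly (real_complex R) p).[z] + z ^+ n * k z) ->
  (forall z, cmod z < 1 -> cmod (G z) <= M) ->
  C * fejer_fun p <= M * n%:R.
Proof.
move=> n0 kh GE GM.
have w1 t : cmod (w t) < 1 by rewrite wc.
have cp : ccont (fun t => (map_poly (real_complex R) p).[w t]).
  apply: (ccont_circle (ltW x0)) => z _.
  apply: (@eq_hol_at _ _ (fun z => \sum_(i < size p) (p`_i)%:C * z ^+ i)).
    move=> u; rewrite horner_coef size_map_poly.
    by apply: eq_bigr => i _; rewrite coef_map.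
  by apply: hol_at_sum => i; hol.
have ck : ccont (fun t => k (w t)).
  by apply: (ccont_circle (ltW x0)) => z zx; apply: kh; rewrite zx.
have c1 : ccont (fun t => (map_poly (real_complex R) p).[w t] * (Q (w t) * (Q (w t))^*)) by cont.
have c1' : ccont (fun t => C%:C * ((map_poly (real_complex R) p).[w t] * (Q (w t) * (Q (w t))^*))) by cont.
have c2 : ccont (fun t => w t ^+ n * k (w t) * (Q (w t) * (Q (w t))^*)) by cont.
have E : cavg (fun t => G (w t) * (Q (w t) * (Q (w t))^*)) = (C * fejer_fun p)%:C.
  rewrite [RHS]rmorphM/= -fejer_poly -[RHS]addr0 -(fejer_high kh) -(cavgZ _ c1).
  rewrite -(cavgD c1' c2); apply: eq_cavg => t; rewrite GE//; ring.
have cG : ccont (fun t => G (w t) * (Q (w t) * (Q (w t))^*)).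
  apply: (@eq_ccont _ _ (fun t => C%:C * ((map_poly (real_complex R) p).[w t] * (Q (w t) * (Q (w t))^*)) +
     w t ^+ n * k (w t) * (Q (w t) * (Q (w t))^*))); last exact: ccontD.
  by move=> t; rewrite GE//; ring.
have M0 : 0 <= M by apply: le_trans (GM 0 _); rewrite ?cmod_ge0 ?cmod0.
have QE t : cmod (Q (w t) * (Q (w t))^*) = complex.Re (w t ^+ 0 * (Q (w t) * (Q (w t))^*)).
  by rewrite expr0 mul1r mulcJ cmod_real ger0_norm ?sqr_ge0.
have h1 := cmod_cavg cG; rewrite E in h1.
apply: le_trans (le_trans (Re_le_cmod ((C * fejer_fun p)%:C)) h1) _.
have cR : rcont (fun t => cmod (Q (w t) * (Q (w t))^*)) by cont.
apply: (@le_trans _ _ (ravg (fun t => M * cmod (Q (w t) * (Q (w t))^*)))).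
  apply: ler_ravg; [by cont|by cont|move=> t].
  by rewrite cmodM ler_wpM2r ?cmod_ge0// GM.
rewrite (ravgZ _ cR) ler_wpM2l//; apply: le_trans lam0_le.
have := fejer_monomial 0; move/(congr1 (@complex.Re R)) => /= <-.
rewrite /cavg /cint /ravg /= mul0r subr0.
by under eq_Rintegral do rewrite QE.
Qed.

End LowerBound.

(** * The test function, transported by a disc automorphism *)

Section LowerTest.
Variable R : realType.
Implicit Types (z w : R[i]).
Notation toC := (map_poly (real_complex R)).

Lemma realCB (a b : R) : (a - b)%:C = a%:C - b%:C :> R[i].
Proof. exact: (rmorphB (real_complex R)). Qed.

Lemma realCM (a b : R) : (a * b)%:C = a%:C * b%:C :> R[i].
Proof. exact: (rmorphM (real_complex R)). Qed.

Lemma realCV (a : R) : (a^-1)%:C = (a%:C)^-1 :> R[i].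
Proof. exact: (fmorphV (real_complex R)). Qed.

Lemma realCX (a : R) k : (a ^+ k)%:C = a%:C ^+ k :> R[i].
Proof. exact: (rmorphXn (real_complex R)). Qed.

Lemma realC1 : (1 : R)%:C = 1 :> R[i].
Proof. exact: (rmorph1 (real_complex R)). Qed.

Lemma nonneg_coefD (p q : {poly R}) : (forall i, 0 <= p`_i) -> (forall i, 0 <= q`_i) ->
  forall i, 0 <= (p + q)`_i.
Proof. by move=> p0 q0 i; rewrite coefD addr_ge0. Qed.

Lemma nonneg_coefM (p q : {poly R}) : (forall i, 0 <= p`_i) -> (forall i, 0 <= q`_i) ->
  forall i, 0 <= (p * q)`_i.
Proof. by move=> p0 q0 i; rewrite coefM sumr_ge0// => j _; rewrite mulr_ge0. Qed.

Lemma nonneg_coefX (p : {poly R}) N : (forall i, 0 <= p`_i) -> forall i, 0 <= (p ^+ N)`_i.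
Proof.
move=> p0; elim: N => [|N ih]; first by move=> i; rewrite expr0 coef1 ler0n.
by rewrite exprS; exact: nonneg_coefM.
Qed.

(** Since [fejer_fun] is monotone on nonnegative coefficients, a power of a sum may be replaced by
    the power of one summand. *)
Lemma nonneg_coef_powD (p q : {poly R}) N : (forall i, 0 <= p`_i) -> (forall i, 0 <= q`_i) ->
  exists2 u : {poly R}, (forall i, 0 <= u`_i) & (p + q) ^+ N = p ^+ N + u.
Proof.
move=> p0 q0; elim: N => [|N [u u0 ih]].
  by exists 0; [move=> i; rewrite coef0|rewrite !expr0 addr0].
exists (q * p ^+ N + (p + q) * u); last by rewrite !exprS ih; ring.
apply: nonneg_coefD; first by apply: nonneg_coefM => //; exact: nonneg_coefX.
by apply: nonneg_coefM => //; exact: nonneg_coefD.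
Qed.

Lemma bernoulli_le (x : R) k : 0 <= x -> x <= 1 -> 1 - k%:R * x <= (1 - x) ^+ k.
Proof.
move=> x0 x1; elim: k => [|k ih]; first by rewrite mul0r subr0 expr0.
have h : (1 - x) * (1 - k%:R * x) <= (1 - x) ^+ k.+1.
  by rewrite exprS ler_wpM2l// subr_ge0.
apply: le_trans h; rewrite -natr1.
have : 0 <= k%:R * x * x by rewrite !mulr_ge0.
lra.
Qed.

Lemma geom_trunc (tau : R) n z : 1 - tau%:C * z != 0 ->
  (1 - tau%:C * z)^-1 = (toC (\poly_(i < n) tau ^+ i)).[z] +
     z ^+ n * ((tau ^+ n)%:C / (1 - tau%:C * z)).
Proof.
move=> nz; have -> : (toC (\poly_(i < n) tau ^+ i)).[z] = \sum_(i < n) (tau%:C * z) ^+ i.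
  rewrite (@horner_coef_wide _ n); last by rewrite size_map_poly size_poly.
  by apply: eq_bigr => i _; rewrite coef_map/= coef_poly ltn_ord exprMn -rmorphXn.
apply: (mulfI nz); rewrite mulfV// mulrDr.
have -> : (1 - tau%:C * z) * (\sum_(i < n) (tau%:C * z) ^+ i) = 1 - (tau%:C * z) ^+ n.
  by rewrite -[RHS]opprB subrX1 -[RHS]mulNr opprB.
rewrite [X in _ = _ + X]mulrCA [(1 - _) * (_ / _)]mulrC divfK// exprMn rmorphXn/=.
by rewrite [z ^+ n * _]mulrC subrK.
Qed.

(** Congruence modulo [w^n] is compatible with powers. The polynomial [p ^+ N] need not be truncated
    again, as [fejer_fun] ignores degrees from [n] on. *)
Lemma trunc_pow (h : R[i] -> R[i]) (p : {poly R}) n N (k : R[i] -> R[i]) :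
  (forall z, cmod z < 1 -> hol_at k z) ->
  (forall z, cmod z < 1 -> h z = (toC p).[z] + z ^+ n * k z) ->
  exists2 k' : R[i] -> R[i], (forall z, cmod z < 1 -> hol_at k' z) &
    forall z, cmod z < 1 -> h z ^+ N = (toC (p ^+ N)).[z] + z ^+ n * k' z.
Proof.
move=> kh hE.
have ph (q : {poly R}) z : hol_at (fun z => (toC q).[z]) z.
  apply: (@eq_hol_at _ _ (fun z => \sum_(i < size q) (q`_i)%:C * z ^+ i)).
    move=> u; rewrite horner_coef size_map_poly.
    by apply: eq_bigr => i _; rewrite coef_map.
  by apply: hol_at_sum => i; hol.
elim: N => [|N [k' k'h ih]].
  exists (fun=> 0); first by move=> z _; hol.
  by move=> z _; rewrite !expr0 rmorph1 hornerC mulr0 addr0.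
exists (fun z => (toC p).[z] * k' z + k z * ((toC (p ^+ N)).[z] + z ^+ n * k' z)).
  move=> z z1; have h1 := kh z z1; have h2 := k'h z z1; have h3 := ph p z.
  by have h4 := ph (p ^+ N) z; hol.
by move=> z z1; rewrite !exprS ih// hE// rmorphM hornerM; ring.
Qed.

Lemma cmod_blaschke_factor_lt1 (l z : R[i]) : cmod l < 1 -> cmod z < 1 ->
  cmod (blaschke_factor l z) < 1.
Proof.
move=> l1 z1; have z1' := ltW z1; have n0 := cmod_1BM_neq0 l1 z1'.
have c0 : 0 < cmod (1 - l^* * z) ^+ 2 by rewrite exprn_gt0// cmod_gt0.
rewrite -(@ltr_pXn2r _ 2)// ?nnegrE ?cmod_ge0// expr1n -subr_gt0 -(pmulr_lgt0 _ c0).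
by rewrite blaschke_factor_defect// mulr_gt0// subr_gt0 exprn_ilt1 ?cmod_ge0.
Qed.

(** The circle must lie inside the disc, where the functions are holomorphic; Bernoulli gives
    [x^(2 n) >= 1 - 2 n / (4 n)]. *)
Lemma fejer_radius n (x := 1 - (4 * n%:R)^-1 : R) : (0 < n)%N ->
  0 < x /\ (x < 1 /\ 1 / 2 <= x ^+ (2 * n)).
Proof.
move=> n0; have n1 : 1 <= n%:R :> R by rewrite ler1n.
have x41 : (4 * n%:R)^-1 <= 4^-1 :> R by rewrite lef_pV2 ?posrE; nra.
have x40 : 0 < (4 * n%:R)^-1 :> R by rewrite invr_gt0; lra.
split; first by rewrite /x; lra.
split; first by rewrite /x; lra.
apply: le_trans (bernoulli_le _ _ _); [|lra|lra].
have -> : (2 * n)%:R * (4 * n%:R)^-1 = 2^-1 :> R by rewrite natrM; field; lra.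
by lra.
Qed.

(** There are more than [n / (4 N)] terms, and each is at least [1/2] by Bernoulli, since [i (1 -
    tau) <= (n / (4 N)) (2 / n) <= 1/2]. *)
Lemma geom_sum_ge n N (tau : R) : (0 < N)%N -> (0 < n)%N -> 0 <= tau -> tau <= 1 ->
  1 - tau <= 2 / n%:R -> n%:R / (8 * N%:R) <= \sum_(i < (n %/ (4 * N)).+1) tau ^+ i.
Proof.
move=> N0 n0 tau0 tau1 taun.
have N1 : 1 <= N%:R :> R by rewrite ler1n.
have n1 : 1 <= n%:R :> R by rewrite ler1n.
apply: (@le_trans _ _ (\sum_(i < (n %/ (4 * N)).+1) 2^-1)).
  rewrite sumr_const card_ord -[leRHS]mulr_natl.
  have : (n%:R : R) <= (n %/ (4 * N)).+1%:R * (4 * N%:R).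
    by rewrite -[4 * _]natrM -natrM ler_nat ltnW// ltn_ceil// muln_gt0 N0.
  move: ((n %/ (4 * N)).+1%:R : R) => X h; rewrite ler_pdivrMr; last by lra.
  lra.
apply: ler_sum => i _; have -> : tau = 1 - (1 - tau) by ring.
have t0 : 0 <= 1 - tau by rewrite subr_ge0.
have t1 : 1 - tau <= 1 by lra.
apply: (le_trans _ (bernoulli_le i t0 t1)).
have iN : (i%:R : R) * (4 * N%:R) <= n%:R.
  rewrite -[4 * _]natrM -natrM ler_nat.
  have im : (i <= n %/ (4 * N))%N by rewrite -ltnS.
  by rewrite (leq_trans _ (leq_trunc_div n (4 * N)))// leq_mul2r im orbT.
have i0 : 0 <= i%:R :> R by [].
have : i%:R * (1 - tau) <= i%:R * (2 / n%:R) by rewrite ler_wpM2l.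
have : i%:R * (2 / n%:R) <= 2^-1 :> R by rewrite mulrA ler_pdivrMr; nra.
lra.
Qed.

(* The automorphism [phi] moves [r] to [0]; up to a multiple of [w^n], [g (phi w)] is a
   positive multiple of [(1 + r w)^N (sum_(i < n) tau^i w^i)^N], whose coefficients are nonnegative. *)
Lemma lower_test (N n : nat) (r c M : R) (A := n%:R / (1 - r)) (s := 1 - A^-1)
    (g : R[i] -> R[i]) :
  (0 < N)%N -> (0 < n)%N -> 0 <= r -> r < 1 -> 0 <= c -> holomorphic g ->
  agree_on (nseq_tuple n (r%:C)) g (fun z => c%:C / (1 - s%:C * z) ^+ N) ->
  (forall z, cmod z < 1 -> cmod (g z) <= M) ->
  c / 4 * (A / (16 * N%:R)) ^+ N <= M.
Proof.
move=> N0 n0 r0 r1 c0 gh gf gM.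
have r10 : 0 < 1 - r by rewrite subr_gt0.
have n1 : 1 <= n%:R :> R by rewrite ler1n.
have A1 : 1 <= A by rewrite /A ler_pdivlMr// mul1r; lra.
have AiE : A^-1 = (1 - r) / n%:R by rewrite invf_div.
have Ai0 : 0 < A^-1 by rewrite invr_gt0; lra.
have Air : A^-1 <= 1 - r by rewrite AiE ler_pdivrMr; nra.
have s1 : s < 1 by rewrite /s; lra.
have sr : r <= s by rewrite /s; lra.
have d0 : 0 < 1 - s * r by nra.
(* With [phi] as below, [1 - s phi(w) = (1 - s r) (1 - tau w) / (1 + r w)]: the pole [1 / s] is
   carried to [1 / tau]. *)
pose tau := (s - r) / (1 - s * r).
have tau0 : 0 <= tau by rewrite /tau divr_ge0 ?(ltW d0)// subr_ge0.
have s1r : 0 < (1 - s) * (1 + r) by rewrite mulr_gt0//; lra.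
have tau1 : tau < 1 by rewrite /tau ltr_pdivrMr//; lra.
(* Here [s] pays off: [1 - s = (1 - r) / n] and [1 - s r >= 1 - r], so the transported pole is seen
   at scale [1/n], independently of [r]. *)
have taun : 1 - tau <= 2 / n%:R.
  have d1 : 1 - s * r != 0 by rewrite gt_eqF.
  have -> : 1 - tau = (1 - s) * (1 + r) / (1 - s * r).
    by rewrite /tau; move: (s) d1 => s' d1; field.
  have -> : 1 - s = A^-1 by rewrite /s; ring.
  rewrite ler_pdivrMr// AiE.
  have h : (1 - r) * (1 + r) <= 2 * (1 - s * r) by nra.
  by rewrite mulrAC [leRHS]mulrAC ler_pM2r ?invr_gt0//; lra.
have ra : r%:C \in nseq_tuple n (r%:C : R[i]) by rewrite mem_nseq n0 eqxx.
have [k kh] := gf _ ra; rewrite count_nseq /= eqxx mul1n => gE.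
pose phi w := blaschke_factor (- r%:C) w.
have rc : cmod (- r%:C) < 1 by rewrite cmodN cmod_real ger0_norm.
have phi1 w : cmod w < 1 -> cmod (phi w) < 1 by exact: cmod_blaschke_factor_lt1.
have rJ : (- r%:C : R[i])^* = - r%:C.
  have -> : - r%:C = (- r)%:C :> R[i] by rewrite rmorphN.
  exact: conjC_real.
have phiE w : phi w = (w + r%:C) / (1 + r%:C * w).
  rewrite /phi /blaschke_factor opprK; congr (_ / _).
  by rewrite rJ mulNr opprK.
have nr w : cmod w < 1 -> 1 + r%:C * w != 0.
  move=> w1; have := cmod_1BM_neq0 rc (ltW w1).
  by rewrite rJ mulNr opprK.
have nt w : cmod w < 1 -> 1 - tau%:C * w != 0.
  move=> w1; have tc : cmod (tau%:C) < 1 by rewrite cmod_real ger0_norm.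
  by have := cmod_1BM_neq0 tc (ltW w1); rewrite conjC_real.
pose S m : {poly R} := \poly_(i < m) tau ^+ i.
have S0 m i : 0 <= (S m)`_i by rewrite coef_poly; case: ifP => // _; rewrite exprn_ge0.
pose rX : {poly R} := r *: 'X.
have rX0 i : 0 <= rX`_i by rewrite coefZ coefX mulr_ge0// ler0n.
pose P := (1 + rX) ^+ N * S n ^+ N.
have kth w : cmod w < 1 -> hol_at (fun w => (tau ^+ n)%:C / (1 - tau%:C * w)) w.
  by move=> w1; have nw := nt w w1; hol.
have kE w : cmod w < 1 -> (1 - tau%:C * w)^-1 =
    (toC (S n)).[w] + w ^+ n * ((tau ^+ n)%:C / (1 - tau%:C * w)).
  by move=> w1; exact: (geom_trunc n (nt w w1)).
have [k1 k1h k1E] := trunc_pow (h := fun w => (1 - tau%:C * w)^-1) N kth kE.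
pose C := c / (1 - s * r) ^+ N.
have C0 : 0 <= C by rewrite divr_ge0// exprn_ge0// ltW.
have hP w : (toC ((1 + rX) ^+ N)).[w] = (1 + r%:C * w) ^+ N.
  by rewrite rmorphXn rmorphD rmorph1 /rX /= map_polyZ map_polyX horner_exp !hornerE.
(* The first summand is the truncation remainder, the second the interpolation error:
   [phi w - r = w (1 - r^2) / (1 + r w)]. *)
pose k2 w := C%:C * ((1 + r%:C * w) ^+ N * k1 w) +
   ((1 - r%:C ^+ 2) / (1 + r%:C * w)) ^+ n * k (phi w).
have k2h w : cmod w < 1 -> hol_at k2 w.
  move=> w1; have h1 := k1h w w1; have h2 := nr w w1.
  have h3 : hol_at (fun w => k (phi w)) w.
    apply: hol_at_comp; last exact/kh/phi1.
    apply: (eq_hol_at phiE); hol.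
  by rewrite /k2; hol; exact: h3.
have GE w : cmod w < 1 -> g (phi w) = C%:C * (toC P).[w] + w ^+ n * k2 w.
  move=> w1; have := gE _ (phi1 w w1) => /(congr1 (fun u => u + c%:C / (1 - s%:C * phi w) ^+ N)).
  rewrite subrK => ->; have h2 := nr w w1; have h3 := nt w w1.
  have nd : 1 - s%:C * r%:C != 0 :> R[i].
    by rewrite -rmorphM -(rmorph1 (real_complex R)) -rmorphB -cmod_eq0 cmod_real normr_eq0 gt_eqF.
  have e1 : phi w - r%:C = w * ((1 - r%:C ^+ 2) / (1 + r%:C * w)) by rewrite phiE; field.
  have e2 : (1 - s%:C * phi w)^-1 = (1 + r%:C * w) / (1 - s%:C * r%:C) * (1 - tau%:C * w)^-1.
    have et : tau%:C = (s%:C - r%:C) / (1 - s%:C * r%:C) :> R[i].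
      by rewrite /tau; move: (s) => s0; rewrite realCM realCV !realCB realCM realC1.
    have h4 : (1 - s%:C * r%:C) - (s%:C - r%:C) * w != 0.
      have -> : (1 - s%:C * r%:C) - (s%:C - r%:C) * w = (1 - s%:C * r%:C) * (1 - tau%:C * w).
        by rewrite et; field.
      by rewrite mulf_neq0.
    rewrite phiE et; move: (s%:C) (r%:C) nd h2 h4 => s' r' nd h2 h4; field.
    by rewrite nd h2 h4.
  have -> : c%:C / (1 - s%:C * phi w) ^+ N = c%:C * ((1 - s%:C * phi w)^-1) ^+ N.
    by rewrite exprVn.
  have -> : (toC P).[w] = (toC ((1 + rX) ^+ N)).[w] * (toC (S n ^+ N)).[w].
    by rewrite /P -hornerM; congr (_.[_]); exact: (rmorphM (map_poly (real_complex R))).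
  rewrite e1 e2 hP /k2.
  have -> : C%:C = c%:C * ((1 - s%:C * r%:C)^-1) ^+ N.
    by rewrite /C; move: (s) => s0; rewrite realCM realCV realCX realCB realCM realC1 exprVn.
  rewrite !exprMn k1E//.
  by ring.
pose x := 1 - (4 * n%:R)^-1 : R.
have [x0 [x1 x2]] : 0 < x /\ (x < 1 /\ 1 / 2 <= x ^+ (2 * n)) by exact: fejer_radius.
have main : C * fejer_fun n x P <= M * n%:R.
  by apply: (fejer_lower x0 x1 n0 k2h GE) => w w1; apply: gM; exact: phi1.
(* The degree of [S m ^+ N] is then at most [n / 4], within reach of [fejer_fun_low], and all its
   [tau ^+ i] are at least [1/2]. *)
pose m := (n %/ (4 * N)).+1.
have mn : (m <= n)%N by rewrite /m ltn_divLR ?muln_gt0// ltn_Pmulr// (leq_trans _ (leq_pmulr 4 N0)).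
have [q qn qE] : exists2 q : {poly R}, (forall i, 0 <= q`_i) & S n = S m + q.
  exists (\poly_(i < n) (if (i < m)%N then 0 else tau ^+ i)).
    by move=> i; rewrite coef_poly; do 2 case: ifP => // _; rewrite exprn_ge0.
  apply/polyP => i; rewrite coefD !coef_poly.
  case: (ltnP i m) => im; first by rewrite (leq_trans im mn) addr0.
  by rewrite add0r.
have [u un uE] := nonneg_coef_powD N (S0 m) qn.
have [v vn vE] : exists2 v : {poly R}, (forall i, 0 <= v`_i) & (1 + rX) ^+ N = 1 + v.
  have [i|v vn vE] := @nonneg_coef_powD 1 rX N _ rX0; first by rewrite coef1 ler0n.
  by exists v => //; rewrite vE expr1n.
have PE : P = S m ^+ N + (u + v * S n ^+ N).
  by rewrite /P vE mulrDl mul1r {1}qE uE addrA.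
have Plow : fejer_fun n x (S m ^+ N) <= fejer_fun n x P.
  rewrite PE fejer_funD lerDl; apply: (fejer_fun_ge0 _ x0).
  by apply: nonneg_coefD => //; apply: nonneg_coefM => //; exact: nonneg_coefX.
have szS : (2 * (size (S m ^+ N)).-1 <= n)%N.
  have h1 := size_poly_exp_leq (S m) N; have h2 : (size (S m) <= m)%N by exact: size_poly.
  have h3 : ((size (S m)).-1 * N <= (n %/ (4 * N)) * N)%N by 
    rewrite leq_mul2r -subn1 leq_subLR add1n; apply/orP; right; exact: h2.
  have h4 : (n %/ (4 * N) * (4 * N) <= n)%N by exact: leq_trunc_div.
  move: h1 h3 h4; move: (size (S m ^+ N)) ((size (S m)).-1 * N)%N (n %/ (4 * N))%N.
  by clear; move=> a b e; lia.
have low := fejer_fun_low x0 x1 (nonneg_coefX N (S0 m)) szS n0.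
have Sm1 : n%:R / (8 * N%:R) <= (S m).[1].
  have -> : (S m).[1] = \sum_(i < m) tau ^+ i.
    rewrite (@horner_coef_wide _ m) ?size_poly//; apply: eq_bigr => i _.
    by rewrite coef_poly ltn_ord expr1n mulr1.
  by apply: geom_sum_ge => //; exact: ltW.
have Sm1N : (n%:R / (8 * N%:R)) ^+ N <= (S m ^+ N).[1].
  by rewrite horner_exp lerXn2r ?nnegrE// ?divr_ge0// (le_trans _ Sm1)// divr_ge0.
(* Uses [1 - s r = (1 - r) + r (1 - s) <= 2 (1 - r)]. *)
have CA : c / (2 * (1 - r)) ^+ N <= C.
  rewrite /C; apply: ler_wpM2l => //; clear -d0 r10 Ai0 Air r0 r1 sr.
  have srA : 1 - s * r <= 2 * (1 - r) by rewrite /s; nra.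
  by rewrite lef_pV2 ?posrE ?exprn_gt0 ?mulr_gt0// lerXn2r ?nnegrE ?mulr_ge0 ?(ltW d0) ?(ltW r10).
(* [16] is [2] from [CA] times [8] from [geom_sum_ge]; [4] collects the halves from [fejer_fun_low]
   and from [x ^+ (2 * n)]. *)
have E : c / 4 * (A / (16 * N%:R)) ^+ N =
    c / (2 * (1 - r)) ^+ N * ((n%:R / (8 * N%:R)) ^+ N / 4).
  have -> : A / (16 * N%:R) = (2 * (1 - r))^-1 * (n%:R / (8 * N%:R)).
    by rewrite /A; clear -r10 N0; field; rewrite pnatr_eq0 -lt0n N0 gt_eqF.
  by rewrite exprMn exprVn; ring.
rewrite E -(@ler_pM2r _ n%:R) ?ltr0n//.
apply: le_trans main.
have X0 : 0 <= (n%:R / (8 * N%:R)) ^+ N :> R by rewrite exprn_ge0// divr_ge0.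
apply: (@le_trans _ _ (C * ((n%:R / (8 * N%:R)) ^+ N / 4 * n%:R))).
  by rewrite [leRHS]mulrA ler_wpM2r// ler_wpM2r// divr_ge0.
rewrite ler_wpM2l//; apply: le_trans (le_trans low Plow).
set X := _ ^+ N in Sm1N X0 *; set Y := (S m ^+ N).[1] in Sm1N *; set Z := x ^+ _ in x2 *.
have -> : X / 4 * n%:R = n%:R / 2 * (1 / 2) * X by field.
by apply: ler_pM => //; rewrite ler_wpM2l.
Qed.

End LowerTest.

(** * Hardy spaces *)

Section HardyAssembly.
Variable R : realType.
Implicit Types (z w : R[i]) (f g : R[i] -> R[i]).
Notation mu := (@lebesgue_measure R).

Lemma C_nr_le (X : set (R[i] -> R[i])) normX n (r M : R) :
  (forall (sigma : n.-tuple R[i]) f, (forall l, l \in sigma -> cmod l <= r) ->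
     X f -> (normX f <= 1)%E ->
     exists g, [/\ holomorphic g, agree_on sigma g f &
       forall z, cmod z < 1 -> cmod (g z) <= M]) ->
  (C_nr n r X normX <= M%:E)%E.
Proof.
move=> H; apply: ge_ereal_sup => _ [sigma sr <-].
apply: ge_ereal_sup => _ [f [Xf f1] <-].
have [g [gh gf gM]] := H sigma f (fun l ls => (sr l ls).2) Xf f1.
have gle : (Hinf_norm g <= M%:E)%E.
  by apply: ge_ereal_sup => _ [z z1 <-]; rewrite lee_fin; exact: gM.
apply: (le_trans _ gle); apply: ereal_inf_lbound; exists g => //; split => //; split => //.
exact: (le_lt_trans gle (ltry M)).
Qed.

Lemma le_C_nr (X : set (R[i] -> R[i])) normX n (r M : R) (sigma : n.-tuple R[i]) f :
  (forall a, a \in sigma -> cmod a < 1 /\ cmod a <= r) -> X f -> (normX f <= 1)%E ->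
  (forall g K, holomorphic g -> agree_on sigma g f ->
     (forall z, cmod z < 1 -> cmod (g z) <= K) -> M <= K) ->
  (M%:E <= C_nr n r X normX)%E.
Proof.
move=> sr Xf f1 H.
apply: (@le_trans _ _ (interp_const sigma X normX)); last first.
  by apply: ereal_sup_ubound; exists sigma.
apply: le_trans (ereal_sup_ubound _); last by exists f.
apply: le_ereal_inf_tmp => _ [g [[gh gfin] gf] <-].
have g0 : (0 <= Hinf_norm g)%E.
  apply: (@le_trans _ _ (cmod (g 0))%:E); first by rewrite lee_fin cmod_ge0.
  by apply: ereal_sup_ubound; exists 0 => //; rewrite /unit_disc/= cmod0.
have gnum : Hinf_norm g \is a fin_num by rewrite ge0_fin_numE.
rewrite -(fineK gnum) lee_fin; apply: (H g _ gh gf) => z z1.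
by rewrite -lee_fin fineK//; apply: ereal_sup_ubound; exists z.
Qed.

Lemma ravg_integral (h : R -> R) : rcont h -> (((pi *+ 2)^-1)%:E *
   \int[mu]_(t in `[0%R, (pi *+ 2)%R]) (h t)%:E)%E = (ravg h)%:E.
Proof.
move=> ch; rewrite /ravg EFinM; congr (_ * _)%E.
rewrite /Rintegral fineK//; apply: integrable_fin_num => //.
exact: (cont_on_integrable ch).
Qed.

Lemma ccont_holomorphic f rho : holomorphic f -> 0 <= rho -> rho < 1 ->
  ccont (fun t => f (circle_point rho t)).
Proof.
move=> /holomorphic_hol_at fh r0 r1; apply: ccont_circle => // w wr.
by apply: fh; rewrite wr.
Qed.

Lemma Hardy_norm_le1 f (p : R) : 1 <= p -> holomorphic f ->
  (Hardy_norm p f <= 1)%E <->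
  (forall rho, 0 <= rho -> rho < 1 ->
     ravg (fun t => cmod (f (circle_point rho t)) `^ p) <= 1).
Proof.
move=> p1 fh; have p0 : 0 < p by lra.
have E rho : 0 <= rho -> rho < 1 -> ((((pi *+ 2)^-1)%:E *
      \int[mu]_(theta in `[0%R, (pi *+ 2)%R])
        (cmod (f (circle_point rho theta)) `^ p)%:E) `^ p^-1)%E =
    ((ravg (fun t => cmod (f (circle_point rho t)) `^ p)) `^ p^-1)%:E.
  move=> r0 r1; rewrite ravg_integral ?poweR_EFin//.
  by apply: rcont_powR => //; exact: ccont_holomorphic.
have m0 rho : 0 <= ravg (fun t => cmod (f (circle_point rho t)) `^ p).
  by apply: ravg_ge0 => t; exact: powR_ge0.
split=> [fn rho r0 r1|H].
  have : (((ravg (fun t => cmod (f (circle_point rho t)) `^ p)) `^ p^-1)%:E <= 1)%E.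
    rewrite -E//; apply: le_trans fn; apply: ereal_sup_ubound; exists rho => //=.
    by rewrite in_itv/= r0.
  rewrite lee_fin => h; rewrite leNgt; apply/negP => h1.
  have := gt0_ltr_powR (_ : 0 < p^-1); rewrite invr_gt0 => /(_ p0 1 (ravg (fun t => cmod (f (circle_point rho t)) `^ p))).
  by rewrite !nnegrE ler01 m0 h1 powR1 => /(_ isT isT isT); rewrite ltNge h.
apply: ge_ereal_sup => _ [rho rI <-]; move: rI; rewrite /= in_itv/= => /andP[r0 r1].
rewrite E// lee_fin.
have := ge0_ler_powR (_ : 0 <= p^-1); rewrite invr_ge0 => /(_ (ltW p0) (ravg (fun t => cmod (f (circle_point rho t)) `^ p)) 1).
by rewrite !nnegrE ler01 m0 powR1 (H rho r0 r1) => /(_ isT isT isT).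
Qed.

Lemma cmod_1B_pole_ge (s rho t : R) : 0 <= s -> 0 <= rho ->
  1 - s * rho <= cmod (1 - s%:C * circle_point rho t).
Proof.
move=> s0 r0; apply: le_trans (ler_cmod_sub _ _).
by rewrite cmod1 cmodM cmod_real cmod_circle_point// !ger0_norm.
Qed.

Lemma circle_pointC (s rho t : R) : s%:C * circle_point rho t = rho%:C * circle_point s t.
Proof. by rewrite !circle_pointE; ring. Qed.

(** The Poisson mean at the point [1] gives [1 / (1 - s)]. As [s] and [rho] play symmetric roles,
    [1 / (1 - rho)] is a bound too, and with [a] the smaller of the two numbers,
    [1 - s rho <= 1 - a^2 <= 2 (1 - a)]. *)
Lemma pole_mean2 (s rho : R) : 0 <= s -> s < 1 -> 0 <= rho -> rho < 1 ->
  ravg (fun t => (cmod (1 - s%:C * circle_point rho t) ^+ 2)^-1) <= 2 / (1 - s * rho).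
Proof.
move=> s0 s1 r0 r1.
have H (a b : R) : 0 <= a -> a < 1 -> 0 <= b -> b < 1 ->
    ravg (fun t => (cmod (1 - a%:C * circle_point b t) ^+ 2)^-1) <= (1 - a)^-1.
  move=> a0 a1 b0 b1.
  have := @poisson_mean_le1 R b a 1 b0 b1 a0 a1; rewrite cmod1 => /(_ (lexx _)).
  have cR : rcont (fun t => (cmod (1 - a%:C * circle_point b t) ^+ 2)^-1).
    apply: rcontV; first move=> t.
      rewrite expf_neq0// gt_eqF//; apply: lt_le_trans (cmod_1B_pole_ge t a0 b0).
      by rewrite subr_gt0; nra.
    by apply/rcontX/rcont_cmod; cont.
  rewrite expr1n mulr1 => h.
  rewrite -[leRHS]mulr1 ler_pdivlMl ?subr_gt0// -ravgZ//.
  have E : (1 : R[i])^* = 1 by exact: (rmorph1 (@Num.conj R[i])).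
  by move: h; rewrite E; under eq_fun do rewrite mulr1.
have [sr|/ltW sr] := leP s rho.
  apply: le_trans (H _ _ s0 s1 r0 r1) _.
  rewrite -[leLHS]mul1r ler_pdivrMr ?subr_gt0// mulrAC ler_pdivlMr; nra.
under eq_fun do rewrite circle_pointC.
apply: le_trans (H _ _ r0 r1 s0 s1) _.
rewrite -[leLHS]mul1r ler_pdivrMr ?subr_gt0// mulrAC ler_pdivlMr; nra.
Qed.

(** Two powers of the denominator are kept for [pole_mean2]; the other [N p - 2], nonnegative in
    number, are bounded by their value at the point nearest to the pole. *)
Lemma pole_mean (s rho c p : R) N : 0 <= s -> s < 1 -> 0 <= rho -> rho < 1 -> 0 <= c ->
  2 <= N%:R * p ->
  ravg (fun t => cmod (c%:C / (1 - s%:C * circle_point rho t) ^+ N) `^ p) <=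
    2 * c `^ p * (1 - s * rho) `^ (1 - N%:R * p).
Proof.
move=> s0 s1 r0 r1 c0 Np2; set q := N%:R * p; pose d := 1 - s * rho.
have d0 : 0 < d by rewrite subr_gt0; nra.
pose X t := cmod (1 - s%:C * circle_point rho t).
have dX t : d <= X t by exact: cmod_1B_pole_ge.
have X0 t : 0 < X t by apply: lt_le_trans (dX t).
have p0 : 0 < p.
  have : 0 < N%:R * p by lra.
  by rewrite pmulr_rgt0// ltr0n lt0n; apply: contraTneq Np2 => ->; rewrite mul0r; lra.
have nz t : (1 - s%:C * circle_point rho t) != 0 by rewrite -cmod_gt0; exact: X0.
have cX : rcont (fun t => (X t ^+ 2)^-1).
  by apply: rcontV; [move=> t; rewrite expf_neq0// gt_eqF|apply/rcontX/rcont_cmod; cont].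
have cF : rcont (fun t => cmod (c%:C / (1 - s%:C * circle_point rho t) ^+ N) `^ p).
  by apply: rcont_powR => //; cont => t; rewrite expf_neq0.
have le1 t : cmod (c%:C / (1 - s%:C * circle_point rho t) ^+ N) `^ p <=
    (c `^ p * d `^ (2 - q)) * (X t ^+ 2)^-1.
  rewrite cmodM cmodV cmodX cmod_real (ger0_norm c0) -/(X t).
  rewrite powRM// ?invr_ge0 ?exprn_ge0 ?(ltW (X0 t))// -mulrA ler_wpM2l ?powR_ge0//.
  rewrite -!powR_mulrn ?(ltW (X0 t))// -!powRN -powRrM mulNr -/q.
  have -> : X t `^ (- q) = X t `^ (2 - q) * X t `^ (- 2).
    by rewrite -powRD ?(gt_eqF (X0 t)) ?implybT//; congr (_ `^ _); ring.
  rewrite ler_wpM2r ?powR_ge0//.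
  have -> : 2 - q = - (q - 2) by ring.
  rewrite (powRN (X t)) (powRN d) lef_pV2 ?posrE ?powR_gt0//.
  by apply: ge0_ler_powR; rewrite ?nnegrE ?(ltW d0) ?(ltW (X0 t)) ?dX// subr_ge0.
apply: le_trans (ler_ravg cF _ le1) _.
  by apply: rcontM; [exact: rcont_cst|exact: cX].
rewrite ravgZ//.
apply: (@le_trans _ _ (c `^ p * d `^ (2 - q) * (2 / d))).
  by rewrite ler_wpM2l ?mulr_ge0 ?powR_ge0//; exact: pole_mean2.
have -> : d `^ (1 - q) = d `^ (2 - q) / d.
  rewrite -(powR_inv1 (ltW d0)) -powRD ?(gt_eqF d0) ?implybT//; congr (_ `^ _); ring.
by rewrite le_eqVlt; apply/orP; left; apply/eqP; ring.
Qed.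

Lemma holomorphic_pole (s c : R) N : 0 <= s -> s < 1 ->
  holomorphic (fun z => c%:C / (1 - s%:C * z) ^+ N).
Proof.
move=> s0 s1; apply/holomorphic_hol_at => z z1.
have n0 : 1 - s%:C * z != 0.
  have sc : cmod (s%:C) < 1 by rewrite cmod_real ger0_norm.
  by have := cmod_1BM_neq0 sc (ltW z1); rewrite conjC_real.
have n1 : (1 - s%:C * z) ^+ N != 0 by rewrite expf_neq0.
by hol.
Qed.

Lemma Hardy_C_nr (p : R) : 1 <= p ->
  exists c1 c2 : R, [/\ 0 < c1, 0 < c2 &
     forall (n : nat) (r : R), (1 <= n)%N -> 0 <= r -> r < 1 ->
       ((c1 * (n%:R / (1 - r)) `^ (1 / p))%:E
          <= C_nr n r (Hardy p) (Hardy_norm p))%E /\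
       (C_nr n r (Hardy p) (Hardy_norm p)
          <= (c2 * (n%:R / (1 - r)) `^ (1 / p))%:E)%E].
Proof.
(* With [N = 2], [lower_test] gives [(c / 4) (A / 32)^2], and [c] carries a factor [1/2]:
   [8 * 32^2 = 8192]. The [132] is that of [hermite_interpolation] at [m = 1]. *)
move=> p1; exists (1 / 8192), 132; split; [lra|lra|] => n r n1 r0 r1.
rewrite [1 / p]div1r; set A := n%:R / (1 - r).
have r10 : 0 < 1 - r by rewrite subr_gt0.
have n1' : 1 <= n%:R :> R by rewrite ler1n.
have A1 : 1 <= A by rewrite /A ler_pdivlMr// mul1r; lra.
have p0 : 0 < p by lra.
have Ai0 : 0 < A^-1 by rewrite invr_gt0; lra.
have Ai1 : A^-1 <= 1 by rewrite invf_le1; lra.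
split.
  (* Makes [2 c^p (1 - s rho)^(1 - 2 p)] at most [1] on every circle, given [1 - s rho >= 1/A] and
     [2^(-p) <= 1/2]; moreover [c A^2] is half of [A^(1/p)]. *)
  pose s := 1 - A^-1; pose c := 2^-1 * A `^ (p^-1 - 2).
  have A0 : 0 < A by lra.
  have c0 : 0 <= c by rewrite mulr_ge0 ?powR_ge0.
  have s0 : 0 <= s by rewrite /s; lra.
  have s1 : s < 1 by rewrite /s; lra.
  have fh := @holomorphic_pole s c 2 s0 s1.
  have fn : (Hardy_norm p (fun z => (c%:C / (1 - s%:C * z) ^+ 2)%R) <= 1)%E.
    apply/(Hardy_norm_le1 p1 fh) => rho rho0 rho1.
    have Np2 : 2 <= 2%:R * p by lra.
    apply: le_trans (pole_mean s0 s1 rho0 rho1 c0 Np2) _.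
    have dA : A^-1 <= 1 - s * rho by rewrite /s; nra.
    have h1 : (1 - s * rho) `^ (1 - 2%:R * p) <= A `^ (2 * p - 1).
      have -> : 1 - 2%:R * p = - (2 * p - 1) by ring.
      rewrite powRN -[leRHS]invrK lef_pV2 ?posrE ?invr_gt0 ?powR_gt0//; last by lra.
      rewrite -powR_inv1 ?powR_ge0// powRAC powR_inv1 ?(ltW A0)//.
      by apply: ge0_ler_powR; rewrite ?nnegrE ?(ltW Ai0)//; lra.
    have cp : c `^ p <= 2^-1 * A `^ (1 - 2 * p).
      rewrite /c powRM ?powR_ge0// -powRrM.
      have -> : (p^-1 - 2) * p = 1 - 2 * p by field; lra.
      rewrite ler_wpM2r ?powR_ge0// -{1}powR_inv1// powRAC powR_inv1 ?powR_ge0//.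
      rewrite lef_pV2 ?posrE ?powR_gt0// -{1}[2]powRr1//.
      by rewrite ler_powR// ler1n.
    apply: (@le_trans _ _ (2 * (2^-1 * A `^ (1 - 2 * p)) * A `^ (2 * p - 1))).
      by apply: ler_pM; rewrite ?mulr_ge0 ?powR_ge0// ler_wpM2l.
    rewrite mulrA divff ?mul1r ?pnatr_eq0// -powRD; last by rewrite (gt_eqF A0) implybT.
    by rewrite subrKA subrr powRr0.
  apply: (le_C_nr (sigma := nseq_tuple n (r%:C)) (f := fun z => c%:C / (1 - s%:C * z) ^+ 2)).
  - move=> a /nseqP[-> _]; rewrite cmod_real ger0_norm//.
  - by split => //; apply: le_lt_trans fn _; exact: ltry.
  - exact: fn.
  move=> g K gh gf gK.
  apply: (le_trans _ (lower_test (isT : (0 < 2)%N) n1 r0 r1 c0 gh gf gK)).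
  rewrite -/A /c.
  have -> : A `^ p^-1 = A `^ (p^-1 - 2) * A ^+ 2.
    rewrite -powR_mulrn ?(ltW A0)// -powRD ?subrK//; last by rewrite (gt_eqF A0) implybT.
  by rewrite le_eqVlt; apply/orP; left; apply/eqP; field.
apply: C_nr_le => sigma f sr [fh _] fn.
(* So that [1 - rho^2 <= 2 (1 - rho) = 1 / (4 A)]. *)
pose rho := 1 - (8 * A)^-1.
have A8 : (8 * A)^-1 = A^-1 / 8 by rewrite invfM mulrC.
have rho0 : 0 < rho by rewrite /rho A8; lra.
have rho1 : rho < 1 by rewrite /rho A8; lra.
have rhoA : 1 - rho ^+ 2 <= (4 * A)^-1.
  have -> : (4 * A)^-1 = A^-1 / 4 by rewrite invfM mulrC.
  by rewrite /rho A8; nra.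
have m1 := (Hardy_norm_le1 p1 fh).1 fn rho (ltW rho0) rho1.
have [g [gh gf gM]] := hermite_interpolation n1 r0 r1 sr fh rho0 rho1 rhoA p1 ltr01 m1.
by exists g; split => // z z1; have := gM z z1; rewrite mulr1.
Qed.

End HardyAssembly.

(** * Polar coordinates *)

Section Polar.
Variable R : realType.
Notation mu := (@lebesgue_measure R).

(** Such a set is the countable union of the rational boxes it contains, and boxes belong to the
    product sigma-algebra. *)
Lemma measurable_box_open (P : set (R * R)) :
  (forall w, P w -> exists2 e : R, 0 < e &
     forall w', `|w'.1 - w.1| < e -> `|w'.2 - w.2| < e -> P w') ->
  measurable P.
Proof.
move=> Po.
pose B (q : (rat * rat) * (rat * rat)) : set (R * R) :=
  `](ratr q.1.1 : R), ratr q.1.2[%classic `*` `](ratr q.2.1 : R), ratr q.2.2[%classic.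
have -> : P = \bigcup_q (if `[< B q `<=` P >] then B q else set0).
  apply/seteqP; split => [w Pw|w [q _]]; last by case: asboolP => // + Bw; apply.
  have [e e0 He] := Po w Pw.
  have rx (x : R) : exists q : rat * rat, [/\ x - e < ratr q.1, ratr q.1 < x, x < ratr q.2 & ratr q.2 < x + e].
    have xe : x - e < x by rewrite ltrBlDr ltrDl.
    have xe' : x < x + e by rewrite ltrDl.
    have [a] := rat_in_itvoo xe; rewrite in_itv/= => /andP[a1 a2].
    have [b] := rat_in_itvoo xe'; rewrite in_itv/= => /andP[b1 b2].
    by exists (a, b).
  have [q1 [a1 a2 a3 a4]] := rx w.1; have [q2 [b1 b2 b3 b4]] := rx w.2.
  have Bw : B (q1, q2) w by split; rewrite /= in_itv/= ?a2 ?a3 ?b2 ?b3.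
  exists (q1, q2) => //; case: asboolP => // -[] w' [/=]; rewrite !in_itv/=.
  by move=> /andP[c1 c2] /andP[d1 d2]; apply: He; rewrite ltr_norml; lra.
apply: countable_bigcupT_measurable; first exact: countableP.
move=> q; case: ifP => // _.
by apply: measurableX; exact: measurable_itv.
Qed.

Lemma measurable_fun_box_continuous (D : set (R * R)) (h : R * R -> R) :
  (forall w, D w -> exists2 e : R, 0 < e &
     forall w', `|w'.1 - w.1| < e -> `|w'.2 - w.2| < e -> D w') ->
  (forall w eps, D w -> 0 < eps -> exists2 e : R, 0 < e &
     forall w', `|w'.1 - w.1| < e -> `|w'.2 - w.2| < e -> `|h w' - h w| < eps) ->
  measurable_fun D h.
Proof.
move=> Do hc.
apply: (measurability _ (RGenOInfty.measurableE R)).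
move=> /= _ [_ [a ->]] <-; apply: measurable_box_open => w [Dw /=].
rewrite in_itv/= andbT => ha.
have [e1 e10 H1] := Do w Dw.
have ha0 : 0 < h w - a by rewrite subr_gt0.
have [e2 e20 H2] := hc w _ Dw ha0.
exists (Num.min e1 e2); first by rewrite lt_min e10.
move=> w'; rewrite !lt_min => /andP[x1 x2] /andP[y1 y2]; split; first exact: H1.
rewrite /= in_itv/= andbT; have := H2 w' x2 y2; rewrite ltr_norml; lra.
Qed.

Lemma ge0_integral_opp (F : R -> \bar R) :
  measurable_fun [set: R] F -> (forall x, 0 <= F x)%E ->
  (\int[mu]_x F x = \int[mu]_x F (- x)%R)%E.
Proof.
move=> mF F0.
pose phi (x : R) : measurableTypeR R := - x.
have mphi : measurable_fun [set: R] phi by exact: oppr_measurable.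
have -> : (\int[mu]_x F (- x)%R = \int[pushforward mu phi]_y F y)%E.
  by rewrite ge0_integral_pushforward.
apply: eq_measure_integral => //= A mA _.
apply: lebesgue_measure_unique => //= _ [[a b]] _ <-.
rewrite /pushforward.
have -> : phi @^-1` `]a, b]%classic = `[- b, - a[%classic.
  apply/seteqP; split => x /=; rewrite !in_itv/= => /andP[x1 x2]; rewrite /phi in x1 x2 *;
    apply/andP; split; lra.
rewrite !lebesgue_measure_itv/= !lte_fin ltrN2 !EFinN oppeK.
by case: ifP => // _; rewrite addeC.
Qed.

(** Substitution on [[-n, n]], then monotone convergence on both sides; the images exhaust the open
    interval, whose endpoints are negligible. *)
Lemma integral_atan (G : R -> R) : continuous G -> (forall t, 0 <= G t) ->
  (\int[mu]_t ((1 + t ^+ 2)^-1 * G (atan t))%:E =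
   \int[mu]_(t in `[(- (pi / 2))%R, (pi / 2)%R]) (G t)%:E)%E.
Proof.
move=> cG G0.
pose I n := `[- n%:R, n%:R]%classic : set R.
pose J n := `[- (@atan R n%:R), atan n%:R]%classic : set R.
have mG : measurable_fun [set: R] (EFin \o G) by apply/measurable_EFinP; exact: continuous_measurable_fun.
have ca : continuous (@atan R) by move=> x; exact: continuous_atan.
have cr : continuous (fun t : R => (1 + t ^+ 2)^-1).
  move=> t; apply: cvgV; first by rewrite gt_eqF// ltr_wpDr ?sqr_ge0.
  by apply: cvgD; [exact: cvg_cst|exact: exprn_continuous].
have ck : continuous (fun t : R => (1 + t ^+ 2)^-1 * G (atan t)).
  by move=> t; apply: cvgM; [exact: cr|apply: continuous_comp; [exact: ca|exact: cG]].
have mk : measurable_fun [set: R] (fun t : R => ((1 + t ^+ 2)^-1 * G (atan t))%:E).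
  by apply/measurable_EFinP; exact: continuous_measurable_fun.
have IJ n : (\int[mu]_(t in I n) ((1 + t ^+ 2)^-1 * G (atan t))%:E =
    \int[mu]_(t in J n) (G t)%:E)%E.
  rewrite /I /J -atanN.
  have n0 : - n%:R <= n%:R :> R by rewrite lerNl (le_trans (y := 0))// oppr_le0.
  have dE : (@atan R)^`()%classic = (fun t => (1 + t ^+ 2)^-1).
    by apply/funext => t; rewrite derive1_atan.
  rewrite (integration_by_substitution_increasing n0).
  - by apply: eq_integral => t _; rewrite /= dE mulrC.
  - by move=> x y _ _; exact: lt_atan.
  - by move=> x _; rewrite dE; exact: cr.
  - by rewrite dE; apply/cvg_ex; exists ((1 + (- n%:R) ^+ 2)^-1); apply: cvg_at_right_filter; exact: cr.
  - by rewrite dE; apply/cvg_ex; exists ((1 + n%:R ^+ 2)^-1); apply: cvg_at_left_filter; exact: cr.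
  - split; first by move=> x _; exact: derivable_atan.
      by apply: cvg_at_right_filter; exact: ca.
    by apply: cvg_at_left_filter; exact: ca.
  - exact: continuous_subspaceT.
have UI : \bigcup_n I n = [set: R].
  apply/seteqP; split => // t _; exists (Num.truncn `|t|).+1 => //.
  by rewrite /I /= in_itv/= -ler_norml ltW// truncnS_gt.
have UJ : \bigcup_n J n = `]- (pi / 2), (pi / 2)[%classic.
  apply/seteqP; split => [t [n _]|t].
    rewrite /J /= !in_itv/= -atanN => /andP[t1 t2].
    by rewrite (lt_le_trans (atan_gtNpi2 _) t1) (le_lt_trans t2 (atan_ltpi2 _)).
  move=> ti; exists (Num.truncn `|tan t|).+1 => //; rewrite /J /= in_itv/= -atanN.
  have h : `|tan t| <= (Num.truncn `|tan t|).+1%:R by rewrite ltW// truncnS_gt.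
  move: h; rewrite ler_norml => /andP[h1 h2].
  by have := le_atan h1; have := le_atan h2; rewrite tanK ?inE// => -> ->.
have ndI : {homo I : n m / (n <= m)%N >-> (n <= m)%O}.
  move=> n m nm; rewrite subsetEset => t; rewrite /I /= !in_itv/= => /andP[t1 t2].
  have : (n%:R : R) <= m%:R by rewrite ler_nat.
  by move=> h; apply/andP; split; lra.
have ndJ : {homo J : n m / (n <= m)%N >-> (n <= m)%O}.
  move=> n m nm; rewrite subsetEset => t; rewrite /J /= !in_itv/= => /andP[t1 t2].
  have : @atan R n%:R <= atan m%:R by rewrite le_atan// ler_nat.
  by move=> h; apply/andP; split; lra.
have lI : (\int[mu]_(x in I i) ((1 + x ^+ 2)^-1 * G (atan x))%:E)%E @[i --> \oo] -->
    (\int[mu]_x ((1 + x ^+ 2)^-1 * G (atan x))%:E)%E.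
  rewrite -UI; apply: ge0_nondecreasing_set_cvg_integral => //.
  - by move=> i; exact: measurable_itv.
  - by move=> i; exact: measurable_funTS.
  by move=> i x _; rewrite lee_fin mulr_ge0// invr_ge0 addr_ge0// sqr_ge0.
have lJ : (\int[mu]_(x in J i) (G x)%:E)%E @[i --> \oo] -->
    (\int[mu]_(x in `](- (pi / 2))%R, (pi / 2)%R[) (G x)%:E)%E.
  rewrite -UJ; apply: ge0_nondecreasing_set_cvg_integral => //.
  - by move=> i; exact: measurable_itv.
  - by move=> i; exact: measurable_funTS.
  - by move=> i x _; rewrite lee_fin.
have E : (fun i => \int[mu]_(x in I i) ((1 + x ^+ 2)^-1 * G (atan x))%:E)%E =
  (fun i => \int[mu]_(x in J i) (G x)%:E)%E by apply/funext => i; exact: IJ.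
rewrite E in lI; rewrite (cvg_unique _ lI lJ)//.
rewrite integral_itv_obnd_cbnd; last exact: measurable_funTS.
by rewrite integral_itv_bndo_bndc//; exact: measurable_funTS.
Qed.

Lemma sin_atan (t : R) : sin (atan t) = cos (atan t) * t.
Proof.
have c0 : cos (@atan R t) != 0.
  rewrite cos_atan invr_eq0 gt_eqF// sqrtr_gt0 ltr_wpDr// ?sqr_ge0//.
by rewrite -{3}[t]atanK /tan mulrCA divff// mulr1.
Qed.

Lemma sqr_cos_atan (t : R) : cos (atan t) ^+ 2 = (1 + t ^+ 2)^-1.
Proof. by rewrite cos_atan exprVn sqr_sqrtr// addr_ge0// sqr_ge0. Qed.

(* Write [y = x t], exchange, write [x = rho cos (atan t)], exchange again. *)
Lemma integral_half_plane (F : R * R -> \bar R) :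
  measurable_fun [set: R * R] F -> (forall w, 0 <= F w)%E ->
  (forall rho, 0 < rho -> exists G : R -> R, [/\ continuous G, (forall t, 0 <= G t) &
     forall t, F (rho * cos t, rho * sin t) = (G t)%:E]) ->
  (\int[mu]_(x in `]0%R, +oo[) \int[mu]_y F (x, y) =
   \int[mu]_(rho in `]0%R, +oo[) (rho%:E *
     \int[mu]_(t in `[(- (pi / 2))%R, (pi / 2)%R]) F (rho * cos t, rho * sin t)%R))%E.
Proof.
move=> mF F0 FG.
(* Extends the Jacobian by [0] to the left half-plane, so that Tonelli applies on the whole
   plane. *)
pose pos (x : R) := Num.max x 0.
have pos0 x : 0 <= pos x by rewrite le_max lexx orbT.
have posE x : 0 < x -> pos x = x by move=> x0; rewrite /pos max_l// ltW.
have posN x : x <= 0 -> pos x = 0 by move=> x0; rewrite /pos max_r.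
have mpos : measurable_fun [set: R] pos by apply: measurable_maxr => //; exact: measurable_id.
pose k (t : R) := cos (atan t).
have k0 t : 0 < k t.
  by rewrite /k cos_atan invr_gt0 sqrtr_gt0 ltr_wpDr// ?sqr_ge0//.
have mk : measurable_fun [set: R] k.
  by apply: continuous_measurable_fun => t; apply: continuous_comp; [exact: continuous_atan|exact: continuous_cos].
have m1 : measurable_fun [set: R * R] (fst : R * R -> R) by exact: measurable_fst.
have m2 : measurable_fun [set: R * R] (snd : R * R -> R) by exact: measurable_snd.
pose K (w : R * R) := ((pos w.1)%:E * F (w.1, (w.1 * w.2)%R))%E.
have mK : measurable_fun [set: R * R] K.
  apply: emeasurable_funM.
    by apply/measurable_EFinP; exact: (measurableT_comp mpos m1).
  apply: (measurableT_comp mF); apply: measurable_fun_pair; first exact: m1.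
  exact: measurable_funM.
have K0 w : (0 <= K w)%E by rewrite mule_ge0// lee_fin.
(* One factor [k] comes from [pos], the other from [dx]; [k^2 = 1 / (1 + t^2)] is the derivative of
   [atan], ready for [integral_atan]. *)
pose K' (w : R * R) := ((pos w.1 * k w.2 ^+ 2)%:E * F ((k w.2 * w.1)%R, (k w.2 * w.1 * w.2)%R))%E.
have mkw : measurable_fun [set: R * R] (fun w : R * R => k w.2 * w.1).
  by apply: measurable_funM => //; exact: (measurableT_comp mk m2).
have mK' : measurable_fun [set: R * R] K'.
  apply: emeasurable_funM.
    apply/measurable_EFinP; apply: measurable_funM; first exact: (measurableT_comp mpos m1).
    by apply: measurable_funX; exact: (measurableT_comp mk m2).
  apply: (measurableT_comp mF); apply: measurable_fun_pair => //.
  exact: measurable_funM.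
have K'0 w : (0 <= K' w)%E by rewrite mule_ge0// lee_fin mulr_ge0// sqr_ge0.
have mF2 (f g : R -> R) : measurable_fun [set: R] f -> measurable_fun [set: R] g ->
    measurable_fun [set: R] (fun x => F (f x, g x)).
  by move=> mf mg; apply: (measurableT_comp mF); exact: measurable_fun_pair.
have mid : measurable_fun [set: R] (id : R -> R) by exact: measurable_id.
have mcst (c : R) : measurable_fun [set: R] (fun _ : R => c) by exact: measurable_cst.
transitivity (\int[mu]_x \int[mu]_t K (x, t))%E.
  rewrite integral_mkcond; apply: eq_integral => x _; rewrite /patch mem_setE /= in_itv/= andbT.
  rewrite /K /=; case: ltP => x0; last first.
    by rewrite posN// integral0_eq// => t _; rewrite mul0e.
  rewrite posE// ge0_integralZl_EFin//; last 2 first.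
  - by apply: mF2 => //; exact: measurable_funM.
  - exact: ltW.
  rewrite (@ge0_integral_affine _ x 0)//; last by apply: mF2.
  by congr (_ * _)%E; apply: eq_integral => t _; rewrite addr0.
transitivity (\int[mu]_t \int[mu]_x K (x, t))%E; first exact: (@fubini_tonelli _ _ _ _ R mu mu K mK K0).
transitivity (\int[mu]_t \int[mu]_x K' (x, t))%E.
  apply: eq_integral => t _.
  have mKt : measurable_fun [set: R] (fun x => K (x, t)).
    apply: emeasurable_funM; first exact/measurable_EFinP.
    by apply: mF2 => //; exact: measurable_funM.
  rewrite (@ge0_integral_affine _ (k t) 0)// -ge0_integralZl_EFin//; last 2 first.
  - apply: (measurableT_comp mKt (_ : measurable_fun _ (fun x : R => k t * x + 0))).
    by apply: measurable_funD => //; exact: measurable_funM.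
  - exact: ltW.
  apply: eq_integral => x _; rewrite /K /K' /= addr0 muleA -EFinM; congr (_%:E * _)%E.
  have -> : pos (k t * x) = k t * pos x by rewrite /pos maxr_pMr ?(ltW (k0 t))// mulr0.
  by rewrite expr2; ring.
transitivity (\int[mu]_x \int[mu]_t K' (x, t))%E; first (apply: esym).
  exact: (@fubini_tonelli _ _ _ _ R mu mu K' mK' K'0).
rewrite [RHS]integral_mkcond; apply: eq_integral => x _; rewrite /patch mem_setE /= in_itv/= andbT.
rewrite /K' /=; case: ltP => x0; last first.
  by rewrite posN// integral0_eq// => t _; rewrite mul0r mul0e.
have [G [cG G0 GE]] := FG x x0.
under [in RHS]eq_integral do rewrite GE.
rewrite -integral_atan// -ge0_integralZl_EFin//; last 3 first.
- by move=> t _; rewrite lee_fin mulr_ge0// invr_ge0 addr_ge0// sqr_ge0.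
- apply/measurable_EFinP; apply: measurable_funM.
    by apply: (eq_measurable_fun (fun t => k t ^+ 2)); [move=> t _; exact: sqr_cos_atan|exact: measurable_funX].
  by apply: continuous_measurable_fun => t; apply: continuous_comp; [exact: continuous_atan|exact: cG].
- exact: ltW.
apply: eq_integral => t _; rewrite posE// EFinM -muleA; congr (_ * _)%E.
rewrite [in RHS]EFinM -GE /k sqr_cos_atan sin_atan; congr (_ * F _)%E; congr (_, _); ring.
Qed.

Lemma cmod_le_normD (x y : R) : cmod (x +i* y) <= `|x| + `|y|.
Proof.
have -> : x +i* y = x%:C + 'i * y%:C.
  by apply/eqP; rewrite eq_complex /=; apply/andP; split; apply/eqP; ring.
by apply: le_trans (ler_cmodD _ _) _; rewrite cmodM cmod_i mul1r !cmod_real.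
Qed.

Lemma cmod_box (w w' : R * R) e : `|w'.1 - w.1| < e / 2 -> `|w'.2 - w.2| < e / 2 ->
  cmod ((w'.1 +i* w'.2) - (w.1 +i* w.2)) < e.
Proof.
move=> h1 h2; have -> : (w'.1 +i* w'.2) - (w.1 +i* w.2) = (w'.1 - w.1) +i* (w'.2 - w.2).
  by apply/eqP; rewrite eq_complex /= !eqxx.
by apply: le_lt_trans (cmod_le_normD _ _) _; lra.
Qed.

Lemma unit_disc_box (w : R * R) : cmod (w.1 +i* w.2) < 1 -> exists2 e : R, 0 < e &
  forall w' : R * R, `|w'.1 - w.1| < e -> `|w'.2 - w.2| < e -> cmod (w'.1 +i* w'.2) < 1.
Proof.
move=> w1; exists ((1 - cmod (w.1 +i* w.2)) / 2) => [|w' h1 h2].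
  by rewrite divr_gt0// subr_gt0.
have := cmod_box h1 h2; have := ler_cmodD ((w'.1 +i* w'.2) - (w.1 +i* w.2)) (w.1 +i* w.2).
by rewrite subrK /=; lra.
Qed.

Lemma measurable_disc (h : R[i] -> R) :
  (forall z, cmod z < 1 -> {for z, continuous (h : R[i]^o -> R)}) ->
  measurable_fun [set w : R * R | unit_disc (w.1 +i* w.2)] (fun w => h (w.1 +i* w.2)).
Proof.
move=> hc; apply: measurable_fun_box_continuous => [w w1|w e w1 e0].
  exact: unit_disc_box.
have := hc _ w1; move=> /cvg_realP/(_ e e0)/nbhs_cmodP[d d0 H].
by exists (d / 2); [rewrite divr_gt0|move=> w' h1 h2; apply: H; exact: cmod_box].
Qed.

Lemma continuous_circle_comp (h : R[i] -> R) rho :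
  (forall z, cmod z < 1 -> {for z, continuous (h : R[i]^o -> R)}) ->
  0 <= rho -> rho < 1 -> continuous (fun t => h (circle_point rho t)).
Proof.
move=> hc r0 r1 t.
have c1 := @continuous_arc R rho t.
by apply: (continuous_comp c1); apply: hc; rewrite cmod_circle_point.
Qed.

Lemma continuous_shift (c : R) (g : R -> R) : continuous g -> continuous (fun t => g (t + c)).
Proof.
move=> cg t; apply: continuous_comp; last exact: cg.
by apply: cvgD; [exact: cvg_id|exact: cvg_cst].
Qed.

(** The half-plane formula sees only half of the angles; the values at [t + pi] supply the opposite
    half-circle. *)
Lemma Rint_half_periods (g : R -> R) : continuous g -> (forall t, g (t + pi *+ 2) = g t) ->
  (\int[mu]_(t in `[- (pi / 2), pi / 2]) (g t + g (t + pi)) =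
   \int[mu]_(t in `[0, pi *+ 2]) g t)%R.
Proof.
move=> cg gP.
have p0 : 0 < (pi : R) by exact: pi_gt0.
have cgp := @continuous_shift pi _ cg.
have co a b (u : R -> R) : continuous u -> cont_on a b u by move=> cu x _; exact: cu.
rewrite RintegralD//; try exact: cont_on_integrable (co _ _ _ _).
rewrite -Rint_shift//.
have -> : - (pi / 2) + pi = pi / 2 :> R by field.
have l1 : - (pi / 2) <= pi / 2 :> R by clear -p0; lra.
have l2 : pi / 2 <= pi / 2 + pi :> R by clear -p0; lra.
rewrite -(Rint_split l1 l2 (co _ _ _ cg)).
have -> : pi / 2 + pi = - (pi / 2) + pi *+ 2 :> R by rewrite mulr2n; field.
by apply: Rint_periodic => //; rewrite mulr2n; lra.
Qed.

(** The integrand is extended by [0] and the plane folded onto its right half by [w -> - w], which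
    on circles is the shift of the angle by [pi]. *)
Lemma integral_disc (h : R[i] -> R) :
  (forall z, cmod z < 1 -> {for z, continuous (h : R[i]^o -> R)}) ->
  (forall z, cmod z < 1 -> 0 <= h z) ->
  (\int[(mu \x mu)%E]_(w in [set w : R * R | unit_disc (w.1 +i* w.2)]) (h (w.1 +i* w.2))%:E =
   \int[mu]_(rho in `]0%R, 1%R[)
     (rho * (pi *+ 2 * ravg (fun t => h (circle_point rho t))))%:E)%E.
Proof.
move=> hc h0; set D := [set w | _].
have DE (w : R * R) : (w \in D) = (cmod (w.1 +i* w.2) < 1) by apply/idP/idP; rewrite inE.
pose F (w : R * R) := ((fun w => (h (w.1 +i* w.2))%:E) \_ D) w.
have mD : measurable D.
  by apply: measurable_box_open => w; exact: unit_disc_box.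
have mF : measurable_fun [set: R * R] F.
  apply/(measurable_restrictT _ mD)/measurable_EFinP; exact: measurable_disc.
have F0 w : (0 <= F w)%E.
  by rewrite /F /patch DE; case: ifP => // w1; rewrite lee_fin h0.
pose Fo (w : R * R) := F (- w.1, - w.2).
have mopp : measurable_fun [set: R] (-%R : R -> R) by exact: oppr_measurable.
have mo1 : measurable_fun [set: R * R] (fun w : R * R => - w.1).
  exact: (measurableT_comp mopp measurable_fst).
have mo2 : measurable_fun [set: R * R] (fun w : R * R => - w.2).
  exact: (measurableT_comp mopp measurable_snd).
have mFo : measurable_fun [set: R * R] Fo.
  by apply: (measurableT_comp mF); exact: measurable_fun_pair.
have Fo0 w : (0 <= Fo w)%E by exact: F0.
pose H x := (\int[mu]_y F (x, y))%E.
have mH : measurable_fun [set: R] H.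
  exact: (@measurable_fun_fubini_tonelli_F _ _ _ _ R mu F mF F0).
have H0 x : (0 <= H x)%E by exact: integral_ge0.
have mHo : measurable_fun [set: R] (fun x => H (- x)).
  exact: (measurableT_comp mH mopp).
have Fx x : measurable_fun [set: R] (fun y => F (x, y)).
  apply: (measurableT_comp mF); apply: measurable_fun_pair; [exact: measurable_cst|exact: measurable_id].
have Fox x : measurable_fun [set: R] (fun y => Fo (x, y)).
  apply: (measurableT_comp mFo); apply: measurable_fun_pair; [exact: measurable_cst|exact: measurable_id].
have HoE x : H (- x) = (\int[mu]_y Fo (x, y))%E.
  by rewrite /H (ge0_integral_opp (Fx _)).
rewrite integral_mkcond -/F.
transitivity (\int[mu]_x H x)%E; first exact: (@fubini_tonelli1 _ _ _ _ R mu mu F mF F0).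
transitivity (\int[mu]_(x in `]0%R, +oo[) (H x + H (- x)%R))%E.
  have -> : [set: R] = `]-oo, 0%R] `|` `]0%R, +oo[.
    apply/seteqP; split => // x _; rewrite /= !in_itv/= andbT; apply/orP.
    by rewrite leNgt orNb.
  rewrite ge0_integral_setU//=; last 2 first.
  - exact: (measurable_funTS mH).
  - rewrite disj_set2E; apply/eqP; rewrite -subset0 => x []/=; rewrite !in_itv/= andbT => x1 x2.
    by move: x1; rewrite leNgt x2.
  have -> : (\int[mu]_(x in `]-oo, 0%R]) H x = \int[mu]_(x in `]0%R, +oo[) H (- x)%R)%E.
    rewrite -(@integral_itv_bndo_bndc R (BInfty _ true) 0 H (measurable_funTS mH)).
    rewrite integral_mkcond [RHS]integral_mkcond ge0_integral_opp; last 2 first.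
    - exact: ((measurable_restrictT H (measurable_itv _)).1 (measurable_funTS mH)).
    - by move=> x; rewrite /patch; case: ifP => // _; exact: H0.
    apply: eq_integral => x _; rewrite /patch !mem_setE /= !in_itv/= andbT.
    by rewrite oppr_lt0.
  rewrite addeC; apply/esym; exact: (ge0_integralD mu (measurable_itv _) (fun x _ => H0 x)
    (measurable_funTS mH) (fun x _ => H0 (- x)) (measurable_funTS mHo)).
pose S w := (F w + Fo w)%E.
transitivity (\int[mu]_(x in `]0%R, +oo[) \int[mu]_y S (x, y))%E.
  by apply: eq_integral => x _; rewrite HoE; apply/esym; exact: (ge0_integralD mu measurableT (fun _ _ => F0 _) (Fx x) (fun _ _ => Fo0 _) (Fox x)).
have Fcirc rho t : 0 <= rho -> F (rho * cos t, rho * sin t) =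
    (if rho < 1 then h (circle_point rho t) else 0)%:E.
  move=> r0; rewrite /F /patch DE /=.
  have -> : (rho * cos t) +i* (rho * sin t) = circle_point rho t by [].
  by rewrite cmod_circle_point//; case: ifP.
have Focirc rho t : 0 <= rho -> Fo (rho * cos t, rho * sin t) =
    (if rho < 1 then h (circle_point rho (t + pi)) else 0)%:E.
  move=> r0; rewrite /Fo /= -!mulrN -Fcirc//; congr (F (_ * _, _ * _)).
    by rewrite cosDpi.
  by rewrite sinDpi.
rewrite integral_half_plane//; last 3 first.
- by apply: emeasurable_funD.
- by move=> w; rewrite adde_ge0.
- move=> rho r0; case: (ltP rho 1) => r1; last first.
    exists (fun=> 0); split => //; first by move=> x; exact: cvg_cst.
    by move=> t; rewrite /S Fcirc ?Focirc ?(ltW r0)// ltNge r1 /= adde0.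
  have cg := continuous_circle_comp hc (ltW r0) r1.
  exists (fun t => h (circle_point rho t) + h (circle_point rho (t + pi))); split.
  + move=> t; apply: cvgD; first exact: cg.
    exact: (@continuous_shift pi _ cg).
  + by move=> t; rewrite addr_ge0// h0// cmod_circle_point// ltW.
  + by move=> t; rewrite /S Fcirc ?Focirc ?(ltW r0)// r1.
rewrite integral_mkcond [RHS]integral_mkcond; apply: eq_integral => rho _.
rewrite /patch !mem_setE /= !in_itv/= andbT; case: ltP => //= r0.
case: (ltP rho 1) => r1; last first.
  rewrite integral0_eq ?mule0// => t _.
  by rewrite /S Fcirc ?Focirc ?(ltW r0)// ltNge r1 /= adde0.
have cg := continuous_circle_comp hc (ltW r0) r1.
have cg' : continuous (fun t => h (circle_point rho t) + h (circle_point rho (t + pi))).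
  move=> t; apply: cvgD; first exact: cg.
  exact: (@continuous_shift pi _ cg).
rewrite EFinM; congr (_ * _)%E.
transitivity (\int[mu]_(t in `[(- (pi / 2))%R, (pi / 2)%R])
    (h (circle_point rho t) + h (circle_point rho (t + pi)))%:E)%E.
  by apply: eq_integral => t _; rewrite /S Fcirc ?Focirc ?(ltW r0)// r1.
rewrite -[LHS]fineK; last first.
  apply: integrable_fin_num => //; apply: cont_on_integrable => t _; exact: cg'.
congr (_%:E); rewrite /ravg mulrA divff ?mul1r ?gt_eqF ?twopi_gt0//.
rewrite -(Rint_half_periods cg)//.
by move=> t; rewrite circle_pointD2pi.
Qed.

Lemma measurable_ravg (h : R[i] -> R) :
  (forall z, cmod z < 1 -> {for z, continuous (h : R[i]^o -> R)}) ->
  (forall z, cmod z < 1 -> 0 <= h z) ->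
  measurable_fun (`]0%R, 1%R[%classic : set R) (fun rho => ravg (fun t => h (circle_point rho t))).
Proof.
move=> hc h0.
pose D : set (R * R) := `]0%R, 1%R[%classic `*` `[0%R, (pi *+ 2)%R]%classic.
have mD : measurable D by apply: measurableX; exact: measurable_itv.
pose D1 : set (R * R) := `]0%R, 1%R[%classic `*` [set: R].
have mc : measurable_fun D1 (fun w : R * R => h (circle_point w.1 w.2)).
  apply: measurable_fun_box_continuous => [w []|w e []]; rewrite /= in_itv/= => /andP[w0 w1] _.
    exists (Num.min w.1 (1 - w.1)); first by rewrite lt_min w0 subr_gt0.
    move=> w' + _; rewrite lt_min !ltr_norml => /andP[h1 h2].
    by split => //; rewrite /= in_itv/=; lra.
  move=> e0.
  have c1 : cmod (circle_point w.1 w.2) < 1 by rewrite cmod_circle_point// ltW.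
  have := hc _ c1; move=> /cvg_realP/(_ e e0)/nbhs_cmodP[d d0 H].
  exists (d / 2); first by rewrite divr_gt0.
  move=> w' h1 h2; apply: H; apply: le_lt_trans (circle_point_lip _ _ _ (ltW w0) (ltW w1)) _.
  by lra.
pose F := (fun w : R * R => (h (circle_point w.1 w.2))%:E) \_ D.
have mF : measurable_fun [set: R * R] F.
  apply/(measurable_restrictT _ mD)/measurable_EFinP; apply: measurable_funS mc.
    by apply: measurableX => //; exact: measurable_itv.
  by move=> w [w1 _]; split.
have F0 w : (0 <= F w)%E.
  rewrite /F /patch; case: ifP => //; rewrite inE => -[/=]; rewrite in_itv/= => /andP[w0 w1] _.
  by rewrite lee_fin h0// cmod_circle_point// ltW.
have mH : measurable_fun [set: R] (fun rho => (\int[mu]_t F (rho, t))%E).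
  exact: (@measurable_fun_fubini_tonelli_F _ _ _ _ R mu F mF F0).
have mf : measurable_fun (`]0%R, 1%R[%classic : set R) (fun rho => fine (\int[mu]_t F (rho, t))%E).
  apply: measurable_funTS; apply: (measurableT_comp _ mH); exact: fine_measurable.
apply: (eq_measurable_fun (fun rho => (pi *+ 2)^-1 * (fine (\int[mu]_t F (rho, t))%E))); last first.
  exact: (measurable_funM (measurable_cst _) mf).
move=> rho; rewrite inE/= => rI; rewrite /ravg /Rintegral; congr (_ * fine _).
rewrite [RHS]integral_mkcond; apply: eq_integral => t _; rewrite /F /patch.
have -> : ((rho, t) \in D) = (t \in `[0%R, (pi *+ 2)%R]%classic) => //.
by apply/idP/idP => [/set_mem[_ tI]|/set_mem tI]; apply/mem_set.
Qed.

End Polar.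

(** * Bergman spaces *)

Section BergmanAssembly.
Variable R : realType.
Implicit Types (z w : R[i]) (f g : R[i] -> R[i]).
Notation mu := (@lebesgue_measure R).

Lemma poweR_le1 (x : \bar R) (q : R) : (0 <= x)%E -> 0 < q -> (x `^ q <= 1)%E -> (x <= 1)%E.
Proof.
case: x => [x| |] // x0 q0; last by rewrite poweRyr ?gt_eqF.
rewrite poweR_EFin !lee_fin => h; rewrite leNgt; apply/negP => x1.
rewrite lee_fin in x0; have := gt0_ltr_powR q0; move=> /(_ 1 x).
by rewrite !nnegrE ler01 x0 x1 powR1 => /(_ isT isT isT); rewrite ltNge h.
Qed.

(* The integrand of the Bergman norm, integrated along the circle of radius [rho], with
   the Jacobian [rho] of polar coordinates. *)
Definition bergman_density (p beta : R) f rho : R :=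
  rho * (pi *+ 2 * ((1 - rho ^+ 2) `^ beta * ravg (fun t => cmod (f (circle_point rho t)) `^ p))).

Lemma bergman_density_ge0 p beta f rho : 0 <= rho -> 0 <= bergman_density p beta f rho.
Proof.
move=> r0; apply: mulr_ge0 => //; apply: mulr_ge0; first exact: (ltW (twopi_gt0 R)).
by apply: mulr_ge0; [exact: powR_ge0|apply: ravg_ge0 => t; exact: powR_ge0].
Qed.

Lemma continuous_cmod_powR f p z : 0 < p -> hol_at f z ->
  {for z, continuous ((fun z => cmod (f z) `^ p) : R[i]^o -> R)}.
Proof.
move=> p0 fz.
have c1 : {for z, continuous ((fun z => cmod (f z)) : R[i]^o -> R)}.
  exact: (@continuous_comp _ _ _ (f : R[i]^o -> R[i]^o) _ z (hol_at_continuous fz) (@continuous_cmod R (f z))).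
have -> : (fun z => cmod (f z) `^ p) = (fun x : R => `|x| `^ p) \o (fun z => cmod (f z)).
  by apply/funext => w /=; rewrite ger0_norm ?cmod_ge0.
by apply: (continuous_comp c1); exact: continuous_powR_norm.
Qed.

Lemma continuous_bergman_integrand f p beta z : 0 < p -> holomorphic f -> cmod z < 1 ->
  {for z, continuous ((fun z => cmod (f z) `^ p * (1 - cmod z ^+ 2) `^ beta) : R[i]^o -> R)}.
Proof.
move=> p0 /holomorphic_hol_at fh z1.
have cf := continuous_cmod_powR p0 (fh z z1).
have c0 := @continuous_cmod R z.
have c1 : {for z, continuous ((fun z => 1 - cmod z ^+ 2) : R[i]^o -> R)}.
  exact: (cvgB (cvg_cst _) (cvgM c0 c0)).
have u0 : 0 < 1 - cmod z ^+ 2 by rewrite subr_gt0 exprn_ilt1 ?cmod_ge0.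
have d2 : derivable (fun y : R => y `^ beta) (1 - cmod z ^+ 2) 1.
  by apply: derivable_powR; rewrite in_itv/= u0.
have c2 : {for (1 - cmod z ^+ 2), continuous (fun y : R => y `^ beta)}.
  by move: d2 => /derivable1_diffP/differentiable_continuous.
have c3 : {for z, continuous ((fun z => (1 - cmod z ^+ 2) `^ beta) : R[i]^o -> R)}.
  exact: (@continuous_comp _ _ _ (fun z : R[i]^o => 1 - cmod z ^+ 2) (fun y : R => y `^ beta) z c1 c2).
exact: (cvgM cf c3).
Qed.

Lemma ravg_bergman f p beta rho : 0 < p -> holomorphic f -> 0 <= rho -> rho < 1 ->
  ravg (fun t => cmod (f (circle_point rho t)) `^ p * (1 - cmod (circle_point rho t) ^+ 2) `^ beta) =
  (1 - rho ^+ 2) `^ beta * ravg (fun t => cmod (f (circle_point rho t)) `^ p).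
Proof.
move=> p0 fh r0 r1; rewrite -ravgZ; last first.
  by apply: rcont_powR => //; exact: ccont_holomorphic.
congr ravg; apply/funext => t; rewrite cmod_circle_point//; exact: mulrC.
Qed.

Lemma Bergman_integral f p beta : 0 < p -> holomorphic f ->
  (\int[(mu \x mu)%E]_(w in [set w : R * R | unit_disc (w.1 +i* w.2)])
      (cmod (f (w.1 +i* w.2)) `^ p * (1 - cmod (w.1 +i* w.2) ^+ 2) `^ beta)%:E =
   \int[mu]_(rho in `]0%R, 1%R[) (bergman_density p beta f rho)%:E)%E.
Proof.
move=> p0 fh; rewrite (integral_disc (h := fun z => cmod (f z) `^ p * (1 - cmod z ^+ 2) `^ beta)).
- apply: eq_integral => rho; rewrite inE/= in_itv/= => /andP[r0 r1].
  by rewrite ravg_bergman// ltW.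
- by move=> z z1; exact: continuous_bergman_integrand.
- by move=> z _; rewrite mulr_ge0// powR_ge0.
Qed.

Lemma measurable_bergman_density f p beta : 0 < p -> holomorphic f ->
  measurable_fun (`]0%R, 1%R[%classic : set R) (bergman_density p beta f).
Proof.
move=> p0 fh.
have H := @measurable_ravg R (fun z => cmod (f z) `^ p * (1 - cmod z ^+ 2) `^ beta).
have {}H := H (fun z => @continuous_bergman_integrand f p beta z p0 fh).
have {}H := H (fun z _ => mulr_ge0 (powR_ge0 _ _) (powR_ge0 _ _)).
apply: measurable_funM; first exact: measurable_id.
apply: measurable_funM; first exact: measurable_cst.
apply: (eq_measurable_fun (fun rho => ravg (fun t => cmod (f (circle_point rho t)) `^ p *
  (1 - cmod (circle_point rho t) ^+ 2) `^ beta))); last exact: H.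
move=> rho; rewrite inE/= in_itv/= => /andP[r0 r1].
by rewrite ravg_bergman// ltW.
Qed.

Lemma Bergman_norm_le1 f p beta : 1 <= p -> holomorphic f ->
  (Bergman_norm p beta f <= 1)%E <->
  (\int[mu]_(rho in `]0%R, 1%R[) (bergman_density p beta f rho)%:E <= pi%:E)%E.
Proof.
move=> p1 fh; have p0 : 0 < p by lra.
have pi0 : 0 < (pi : R) by exact: pi_gt0.
rewrite /Bergman_norm Bergman_integral//.
set I := (\int[mu]_(_ in _) _)%E.
have I0 : (0 <= I)%E.
  apply: integral_ge0 => rho; rewrite /= in_itv/= => /andP[r0 _].
  by rewrite lee_fin bergman_density_ge0// ltW.
have E : ((pi^-1)%:E * I <= 1)%E = (I <= pi%:E)%E.
  by rewrite lee_pdivrMl// mule1.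
split=> [h|h].
  rewrite -E; apply: poweR_le1 h; last by rewrite invr_gt0.
  by rewrite mule_ge0// lee_fin invr_ge0 ltW.
rewrite -E in h; have := gt0_ler_poweR (_ : 0 <= p^-1).
rewrite invr_ge0 => /(_ (ltW p0) _ _ _ _ h).
rewrite (_ : (1 `^ p^-1)%E = 1)%E; last by rewrite poweR_EFin powR1.
by apply; rewrite in_itv/= leey ?andbT// mule_ge0// lee_fin invr_ge0 ltW.
Qed.

(** The bound [a / 2 <= x] serves nonnegative exponents, [x <= 2 * a] negative ones; the absolute
    value puts both into one constant. *)
Lemma ler_powR_scale (x a beta : R) : 0 < a -> a / 2 <= x -> x <= 2 * a ->
  2 `^ (- `|beta|) * a `^ beta <= x `^ beta.
Proof.
move=> a0 ax xa; have x0 : 0 < x by lra.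
case: (leP 0 beta) => b0.
  rewrite ger0_norm// powRN ler_pdivrMl ?powR_gt0// -powRM ?(ltW x0)//.
  by apply: ge0_ler_powR => //; rewrite ?nnegrE ?mulr_ge0 ?(ltW a0) ?(ltW x0)//; lra.
rewrite ltr0_norm// opprK -powRM ?(ltW a0)//.
have -> : beta = - (- beta) by rewrite opprK.
rewrite (powRN x) (powRN (2 * a)) lef_pV2 ?posrE ?powR_gt0 ?mulr_gt0//.
apply: ge0_ler_powR; rewrite ?nnegrE ?mulr_ge0 ?(ltW a0) ?(ltW x0) ?xa//; lra.
Qed.

(** Averaging: if the mean exceeded the bound on the whole window, the integral there would be at
    least [2 pi]. The window stays at distance [d / 2] from [1] so that the weight is comparable to
    [d^beta] on it. *)
Lemma Bergman_good_radius f p beta d : 0 < d -> d <= 8^-1 -> 1 <= p -> holomorphic f ->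
  (\int[mu]_(rho in `]0%R, 1%R[) (bergman_density p beta f rho)%:E <= pi%:E)%E ->
  exists rho, [/\ 1 - d < rho, rho < 1 - d / 2 &
    ravg (fun t => cmod (f (circle_point rho t)) `^ p) <=
      4 * 2 `^ `|beta| * d `^ (- 1 - beta)].
Proof.
move=> d0 d8 p1 fh fI; apply: contrapT => H.
have p0 : 0 < p by lra.
have pi0 : 0 < (pi : R) by exact: pi_gt0.
set m := 4 * _ * _ in H.
have Hm rho : 1 - d < rho -> rho < 1 - d / 2 ->
    m < ravg (fun t => cmod (f (circle_point rho t)) `^ p).
  by move=> h1 h2; rewrite ltNge; apply/negP => h3; apply: H; exists rho.
have m0 : 0 < m by rewrite !mulr_gt0 ?powR_gt0.
pose K := pi * (2 `^ (- `|beta|) * d `^ beta) * m.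
have low rho : rho \in `]1 - d, 1 - d / 2[ -> K <= bergman_density p beta f rho.
  rewrite in_itv/= => /andP[h1 h2].
  have b1 : 2 `^ (- `|beta|) * d `^ beta <= (1 - rho ^+ 2) `^ beta.
    by apply: ler_powR_scale => //; nra.
  rewrite /bergman_density /K.
  have b2 := ltW (Hm rho h1 h2).
  have b0 : 0 <= 2 `^ (- `|beta|) * d `^ beta by rewrite mulr_ge0 ?powR_ge0.
  have b3 := ler_pM b0 (ltW m0) b1 b2.
  have -> : rho * (pi *+ 2 * ((1 - rho ^+ 2) `^ beta * ravg (fun t => cmod (f (circle_point rho t)) `^ p)))
    = (2 * rho * pi) * ((1 - rho ^+ 2) `^ beta * ravg (fun t => cmod (f (circle_point rho t)) `^ p)).
    by rewrite mulr2n; ring.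
  rewrite -mulrA; apply: ler_pM => //; [exact: ltW|by rewrite mulr_ge0// ltW|].
  by rewrite ler_peMl//; lra.
have K0 : 0 <= K by rewrite !mulr_ge0 ?powR_ge0 ?(ltW pi0) ?(ltW m0).
have mI : measurable_fun (`]0%R, 1%R[%classic : set R) (EFin \o bergman_density p beta f).
  by apply/measurable_EFinP; exact: measurable_bergman_density.
have sub : `]1 - d, 1 - d / 2[%classic `<=` (`]0%R, 1%R[%classic : set R).
  by move=> x; rewrite /= !in_itv/= => /andP[x1 x2]; lra.
have h1 : (\int[mu]_(rho in `](1 - d)%R, (1 - d / 2)%R[) K%:E <=
    \int[mu]_(rho in `]0%R, 1%R[) (bergman_density p beta f rho)%:E)%E.
  apply: (@le_trans _ _ (\int[mu]_(rho in `](1 - d)%R, (1 - d / 2)%R[) (bergman_density p beta f rho)%:E)%E).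
    apply: ge0_le_integral => //.
    by apply: measurable_funS mI.
  apply: (ge0_subset_integral mu (measurable_itv _) (measurable_itv _) mI _ sub).
  by move=> x; rewrite /= in_itv/= => /andP[x0 _]; rewrite lee_fin bergman_density_ge0// ltW.
have := le_trans h1 fI; rewrite integral_cst//= lebesgue_measure_itv/= lte_fin.
have -> : 1 - d < 1 - d / 2 by lra.
rewrite -EFinD -EFinM lee_fin.
have -> : K * (1 - d / 2 - (1 - d)) = pi * 2 * ((2 `^ (- `|beta|) * 2 `^ `|beta|) * (d `^ beta * d `^ (- 1 - beta) * d)).
  by rewrite /K /m; field.
rewrite -powRD ?pnatr_eq0 ?implybT// addNr powRr0 mul1r.
rewrite -powRD; last by rewrite (gt_eqF d0) implybT.
rewrite (_ : beta + (- 1 - beta) = -1); last by ring.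
by rewrite powR_inv1 ?(ltW d0)// mulVf ?gt_eqF//; lra.
Qed.

End BergmanAssembly.

(** * A radial integral with an explicit primitive *)

Section BergmanConstants.
Variable R : realType.
Implicit Types (z w : R[i]) (f g : R[i] -> R[i]).
Notation mu := (@lebesgue_measure R).

Definition radial_ratio (d x : R) := (1 - x ^+ 2) / (d + (1 - x ^+ 2)).
(** For [0 <= x < 1] this is [x u^beta / (d + u)^(2 + beta)] with [u = 1 - x^2], a majorant of the
    radial density of the test function, up to constants, when [d = 1/A]. *)
Definition radial_weight (d beta x : R) :=
  x * (radial_ratio d x `^ beta * ((d + (1 - x ^+ 2)) ^+ 2)^-1).

(* In the variable [u = 1 - x^2], the function [(u / (d + u))^(beta + 1)] is, up to the factor
   [(beta + 1) d], a primitive of [(u / (d + u))^beta / (d + u)^2]. *)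
Lemma is_derive_radial_primitive (d beta x : R) : 0 < d -> -1 < beta -> 0 <= x -> x < 1 ->
  is_derive x 1 (fun y => - (2 * (beta + 1) * d)^-1 * radial_ratio d y `^ (beta + 1))
    (radial_weight d beta x).
Proof.
move=> d0 b1 x0 x1.
have x2 : 0 < 1 - x ^+ 2 by rewrite subr_gt0 exprn_ilt1.
have D0 : 0 < d + (1 - x ^+ 2) by lra.
have dE : d + (1 - x ^+ 2) != 0 by rewrite gt_eqF.
have du : is_derive x 1 (fun y : R => d + (1 - y ^+ 2)) (- (2 * x)).
  by apply: is_derive_eq; rewrite /GRing.scale/=; ring.
have dr : is_derive x 1 (radial_ratio d) (- (2 * x * d) / (d + (1 - x ^+ 2)) ^+ 2).
  have dv : is_derive x 1 (fun y => (d + (1 - y ^+ 2))^-1) _ :=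
    @is_deriveV R (fun y => d + (1 - y ^+ 2)) x _ 1 dE du.
  have E : radial_ratio d = (fun y => (1 - y ^+ 2) * (d + (1 - y ^+ 2))^-1) by [].
  rewrite E; apply: is_derive_eq.
  by rewrite /GRing.scale/=; field.
have r0 : 0 < radial_ratio d x by rewrite /radial_ratio divr_gt0.
have dp := is_derive1_comp (is_derive1_powR (beta + 1) r0) dr.
have := is_deriveZ (- (2 * (beta + 1) * d)^-1) dp.
move=> h; apply: (is_derive_eq h).
rewrite /GRing.scale/= /radial_weight (_ : beta + 1 - 1 = beta); last by ring.
have b0 : beta + 1 != 0 by rewrite gt_eqF//; lra.
by field; rewrite dE b0 gt_eqF.
Qed.

Lemma cont_on_radial_weight d beta b : 0 < d -> b < 1 -> cont_on 0 b (radial_weight d beta).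
Proof.
move=> d0 b1 x /andP[x0 xb].
have x1 : x < 1 by lra.
have x2 : 0 < 1 - x ^+ 2 by rewrite subr_gt0 exprn_ilt1.
have dE : d + (1 - x ^+ 2) != 0 by rewrite gt_eqF//; lra.
have c1 : {for x, continuous (fun y : R => 1 - y ^+ 2)}.
  by apply: cvgB; [exact: cvg_cst|exact: exprn_continuous].
have c2 : {for x, continuous (fun y : R => d + (1 - y ^+ 2))} by exact: (cvgD (cvg_cst _) c1).
have c3 : {for x, continuous (radial_ratio d)} by exact: (cvgM c1 (cvgV dE c2)).
have r0 : 0 < radial_ratio d x by rewrite /radial_ratio divr_gt0//; lra.
have c4 : {for radial_ratio d x, continuous (fun y : R => y `^ beta)}.
  have : derivable (fun y : R => y `^ beta) (radial_ratio d x) 1.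
    by apply: derivable_powR; rewrite in_itv/= r0.
  by move=> /derivable1_diffP/differentiable_continuous.
have c5 : {for x, continuous (fun y => radial_ratio d y `^ beta)}.
  exact: (@continuous_comp _ _ _ (radial_ratio d) (fun y : R => y `^ beta) x c3 c4).
have dE2 : (d + (1 - x ^+ 2)) ^+ 2 != 0 by rewrite expf_neq0.
have c6 : {for x, continuous (fun y : R => ((d + (1 - y ^+ 2)) ^+ 2)^-1)}.
  by apply: cvgV => //; exact: (cvgM c2 c2).
exact: (cvgM cvg_id (cvgM c5 c6)).
Qed.

Lemma radial_weight_ge0 d beta x : 0 <= x -> 0 <= radial_weight d beta x.
Proof. by move=> x0; rewrite /radial_weight !mulr_ge0 ?powR_ge0 ?invr_ge0 ?sqr_ge0. Qed.

Lemma bigcup_itv_lt1 : \bigcup_n `[0%R, 1 - n.+1%:R^-1]%classic = (`[0%R, 1%R[%classic : set R).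
Proof.
have n1 n : 0 < n.+1%:R^-1 :> R by rewrite invr_gt0.
apply/seteqP; split => [t [n _]|t]; rewrite /= !in_itv/= => /andP[t0 t1].
  by rewrite t0 (le_lt_trans t1)// ltrBlDr ltrDl n1.
have t10 : 0 < 1 - t by rewrite subr_gt0.
exists (Num.truncn (1 - t)^-1) => //=; rewrite in_itv/= t0 lerBrDr addrC -lerBrDr.
rewrite invf_ple ?posrE//; exact/ltW/truncnS_gt.
Qed.

Lemma measurable_radial_weight d beta : 0 < d ->
  measurable_fun (`[0%R, 1%R[%classic : set R) (fun x => (radial_weight d beta x)%:E).
Proof.
move=> d0; rewrite -bigcup_itv_lt1; apply/measurable_fun_bigcup => n; first exact: measurable_itv.
have l1 : 1 - n.+1%:R^-1 < 1 :> R by rewrite ltrBlDr ltrDl invr_gt0.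
exact: (measurable_int mu (cont_on_integrable (@cont_on_radial_weight _ beta _ d0 l1))).
Qed.

(** For negative [beta] the weight is singular at [1], so the primitive is used on [[0, b]] with
    [b < 1]. The ratio at [0] is at most [1], which bounds the increment uniformly, and monotone
    convergence concludes. *)
Lemma integral_radial_weight d beta : 0 < d -> -1 < beta ->
  (\int[mu]_(x in `]0%R, 1%R[) (radial_weight d beta x)%:E <= ((2 * (beta + 1) * d)^-1)%:E)%E.
Proof.
move=> d0 b1.
have step b : 0 <= b -> b < 1 ->
    (\int[mu]_(x in `[0%R, b]) (radial_weight d beta x)%:E <= ((2 * (beta + 1) * d)^-1)%:E)%E.
  move=> b0 bl1; have cw := @cont_on_radial_weight _ beta _ d0 bl1.
  rewrite -[leLHS]fineK; last by apply: integrable_fin_num => //; exact: cont_on_integrable.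
  have dP x : 0 <= x <= b -> is_derive x 1
      (fun y => - (2 * (beta + 1) * d)^-1 * radial_ratio d y `^ (beta + 1)) (radial_weight d beta x).
    by move=> /andP[x0 xb]; apply: is_derive_radial_primitive => //; exact: le_lt_trans xb bl1.
  have FTC := Rint_FTC b0 cw dP.
  rewrite lee_fin -/(Rintegral _ _ _) FTC.
  rewrite !mulNr opprK addrC.
  have k0 : 0 < (2 * (beta + 1) * d)^-1 by rewrite invr_gt0 !mulr_gt0//; lra.
  have r0 : radial_ratio d 0 `^ (beta + 1) <= 1.
    apply: (@le_trans _ _ (1 `^ (beta + 1))); last by rewrite powR1.
    apply: ge0_ler_powR; rewrite ?nnegrE //; first by lra.
      by rewrite /radial_ratio expr0n/= subr0 divr_ge0//; lra.
    by rewrite /radial_ratio expr0n/= subr0 ler_pdivrMr; lra.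
  have p0 : 0 <= radial_ratio d b `^ (beta + 1) by exact: powR_ge0.
  by nra.
pose I n := `[0%R, 1 - n.+1%:R^-1]%classic : set R.
have n1 n : 0 < n.+1%:R^-1 :> R by rewrite invr_gt0.
have UI : \bigcup_n I n = `[0%R, 1%R[%classic by exact: bigcup_itv_lt1.
have ndI : {homo I : n m / (n <= m)%N >-> (n <= m)%O}.
  move=> n m nm; rewrite subsetEset => t; rewrite /I /= !in_itv/= => /andP[-> t1] /=.
  by rewrite (le_trans t1)// lerB// lef_pV2 ?posrE// ler_nat.
have mU := @measurable_radial_weight d beta d0.
have w0 (x : R) : 0 <= x -> (0 <= (radial_weight d beta x)%:E)%E.
  by move=> x0; rewrite lee_fin radial_weight_ge0.
apply: (@le_trans _ _ (\int[mu]_(x in `[0%R, 1%R[) (radial_weight d beta x)%:E)%E).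
  apply: (ge0_subset_integral mu (measurable_itv _) (measurable_itv _) mU).
    by move=> x; rewrite /= in_itv/= => /andP[x0 _]; exact: w0.
  by move=> x; rewrite /= !in_itv/= => /andP[/ltW -> ->].
have lI : (\int[mu]_(x in I i) (radial_weight d beta x)%:E)%E @[i --> \oo] -->
    (\int[mu]_(x in `[0%R, 1%R[) (radial_weight d beta x)%:E)%E.
  rewrite -UI; apply: ge0_nondecreasing_set_cvg_integral => //.
  - by move=> i; exact: measurable_itv.
  - by move=> i; apply: measurable_funS mU => //; rewrite -UI; exact: bigcup_sup.
  - by move=> i x; rewrite /I /= in_itv/= => /andP[x0 _]; exact: w0.
rewrite -(cvg_lim _ lI)//; apply: lime_le; first by apply/cvg_ex; eexists; exact: lI.
apply: nearW => n; apply: step; last by rewrite ltrBlDr ltrDl n1.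
by rewrite subr_ge0 invf_le1// ler1n.
Qed.

End BergmanConstants.

(** * Norm of the test function and the Bergman constants *)

Section BergmanAsymptotics.
Variable R : realType.
Implicit Types (z w : R[i]) (f g : R[i] -> R[i]).
Notation mu := (@lebesgue_measure R).

Lemma ler_powRN (a b e : R) : 0 < a -> a <= b -> 0 <= e -> b `^ (- e) <= a `^ (- e).
Proof.
move=> a0 ab e0; have b0 : 0 < b by lra.
rewrite !powRN lef_pV2 ?posrE ?powR_gt0//.
by apply: ge0_ler_powR; rewrite ?nnegrE ?(ltW a0) ?(ltW b0).
Qed.

(** The exponent splits as [1 - q = - (q - (3 + beta)) - (2 + beta)]. The first part uses
    [1 - s rho >= 1/A], the second [1 - s rho >= (1/A + 1 - rho^2) / 3], which keeps enough decay
    for a convergent radial integral. *)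
Lemma pole_weight_le (A beta q rho : R) (s := 1 - A^-1) :
  1 <= A -> -1 < beta -> 3 + beta <= q -> 0 < rho -> rho < 1 ->
  (1 - rho ^+ 2) `^ beta * (1 - s * rho) `^ (1 - q) <=
  3 `^ (2 + beta) * A `^ (q - (3 + beta)) *
    (radial_ratio A^-1 rho `^ beta * ((A^-1 + (1 - rho ^+ 2)) ^+ 2)^-1).
Proof.
move=> A1 b1 qb r0 r1.
have A0 : 0 < A by lra.
have Ai0 : 0 < A^-1 by rewrite invr_gt0.
have Ai1 : A^-1 <= 1 by rewrite invf_le1.
set u := 1 - rho ^+ 2; pose D := A^-1 + u; pose X := 1 - s * rho.
have u0 : 0 < u by rewrite /u subr_gt0 exprn_ilt1// ltW.
have D0 : 0 < D by rewrite /D; lra.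
have XA : A^-1 <= X by rewrite /X /s; nra.
have XD : D / 3 <= X by rewrite /X /s /D /u; nra.
have X0 : 0 < X by lra.
have D30 : 0 < D / 3 by lra.
have -> : X `^ (1 - q) = X `^ (- (q - (3 + beta))) * X `^ (- (2 + beta)).
  rewrite -powRD ?(gt_eqF X0) ?implybT//; congr (_ `^ _); ring.
have h1 : X `^ (- (q - (3 + beta))) <= A `^ (q - (3 + beta)).
  apply: le_trans (ler_powRN Ai0 XA _) _; first by rewrite subr_ge0.
  rewrite powRN -powR_inv1 ?powR_ge0// powRAC powR_inv1 ?invr_ge0 ?(ltW A0)//.
  by rewrite invrK.
have h2 : X `^ (- (2 + beta)) <= 3 `^ (2 + beta) * D `^ (- (2 + beta)).
  apply: le_trans (ler_powRN D30 XD _) _; first by lra.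
  rewrite powRM ?(ltW D0)// ?invr_ge0// mulrC ler_wpM2r ?powR_ge0//.
  by rewrite powRN -powR_inv1 ?powR_ge0// powRAC powR_inv1// invrK.
have h3 : radial_ratio A^-1 rho `^ beta * (D ^+ 2)^-1 = u `^ beta * D `^ (- (2 + beta)).
  rewrite /radial_ratio -/u -/D powRM ?(ltW u0) ?invr_ge0 ?(ltW D0)// -mulrA; congr (_ * _).
  rewrite -(powR_inv1 (ltW D0)) -powRrM -powR_mulrn ?(ltW D0)// -powRN.
  rewrite -powRD ?(gt_eqF D0) ?implybT//; congr (_ `^ _); ring.
rewrite -/D h3 -/X.
have -> : 3 `^ (2 + beta) * A `^ (q - (3 + beta)) * (u `^ beta * D `^ (- (2 + beta))) =
  u `^ beta * (A `^ (q - (3 + beta)) * (3 `^ (2 + beta) * D `^ (- (2 + beta)))) by ring.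
by rewrite ler_wpM2l ?powR_ge0// ler_pM ?powR_ge0.
Qed.

(** The radial integral with [d = 1/A] contributes [A / (2 (beta + 1))]; the condition on [c] is
    what cancels all powers of [A] and constants, leaving exactly [pi]. *)
Lemma Bergman_norm_pole (A beta p c : R) N (s := 1 - A^-1) (q := N%:R * p) :
  1 <= A -> -1 < beta -> 1 <= p -> 2 <= q -> 3 + beta <= q -> 0 <= c ->
  c `^ p <= (beta + 1) / (2 * 3 `^ (2 + beta)) * A `^ (2 + beta - q) ->
  (Bergman_norm p beta (fun z => (c%:C / (1 - s%:C * z) ^+ N)%R) <= 1)%E.
Proof.
move=> A1 b1 p1 q2 qb c0 cp.
have A0 : 0 < A by lra.
have Ai0 : 0 < A^-1 by rewrite invr_gt0.
have Ai1 : A^-1 <= 1 by rewrite invf_le1.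
have s0 : 0 <= s by rewrite /s; lra.
have s1 : s < 1 by rewrite /s; lra.
have pi0 : 0 < (pi : R) by exact: pi_gt0.
have p0 : 0 < p by lra.
have fh := @holomorphic_pole R s c N s0 s1.
apply/(Bergman_norm_le1 beta p1 fh).
set f := fun z => _ in fh *.
pose K := pi * 4 * c `^ p * (3 `^ (2 + beta) * A `^ (q - (3 + beta))).
have K0 : 0 <= K by rewrite !mulr_ge0 ?powR_ge0 ?(ltW pi0).
have le1 rho : rho \in `]0, 1[ -> bergman_density p beta f rho <= K * radial_weight A^-1 beta rho.
  rewrite in_itv/= => /andP[r0 r1].
  have h1 := @pole_mean R s rho c p N s0 s1 (ltW r0) r1 c0 q2.
  have h2 := @pole_weight_le A beta q rho A1 b1 qb r0 r1.
  rewrite /bergman_density /radial_weight.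
  have -> : K * (rho * (radial_ratio A^-1 rho `^ beta * ((A^-1 + (1 - rho ^+ 2)) ^+ 2)^-1)) =
    rho * (pi * 4 * c `^ p * (3 `^ (2 + beta) * A `^ (q - (3 + beta)) *
      (radial_ratio A^-1 rho `^ beta * ((A^-1 + (1 - rho ^+ 2)) ^+ 2)^-1))) by rewrite /K; ring.
  rewrite ler_wpM2l ?(ltW r0)//.
  apply: (@le_trans _ _ (pi * 4 * c `^ p * ((1 - rho ^+ 2) `^ beta * (1 - s * rho) `^ (1 - q)))); last first.
    by rewrite ler_wpM2l// !mulr_ge0 ?powR_ge0 ?(ltW pi0).
  have -> : pi * 4 * c `^ p * ((1 - rho ^+ 2) `^ beta * (1 - s * rho) `^ (1 - q)) =
    pi *+ 2 * ((1 - rho ^+ 2) `^ beta * (2 * c `^ p * (1 - s * rho) `^ (1 - q))).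
    by rewrite mulr2n; ring.
  by rewrite ler_wpM2l ?(ltW (twopi_gt0 R))// ler_wpM2l ?powR_ge0.
have mB : measurable_fun (`]0%R, 1%R[%classic : set R) (fun rho => (bergman_density p beta f rho)%:E).
  by apply/measurable_EFinP; exact: measurable_bergman_density.
have mw : measurable_fun (`]0%R, 1%R[%classic : set R) (fun rho => (radial_weight A^-1 beta rho)%:E).
  apply: measurable_funS (measurable_radial_weight beta Ai0); first exact: measurable_itv.
  by move=> x; rewrite /= !in_itv/= => /andP[/ltW -> ->].
have w0 (rho : R) : rho \in `]0, 1[ -> (0 <= (radial_weight A^-1 beta rho)%:E)%E.
  by rewrite in_itv/= => /andP[r0 _]; rewrite lee_fin radial_weight_ge0// ltW.
apply: (@le_trans _ _ (\int[mu]_(rho in `]0%R, 1%R[) (K%:E * (radial_weight A^-1 beta rho)%:E))%E).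
  apply: ge0_le_integral => //.
  - move=> rho; rewrite /= in_itv/= => /andP[r0 _].
    by rewrite lee_fin bergman_density_ge0// ltW.
  - exact: measurable_funeM.
rewrite ge0_integralZl_EFin//.
apply: (@le_trans _ _ (K%:E * ((2 * (beta + 1) * A^-1)^-1)%:E)%E).
  by rewrite lee_wpmul2l// integral_radial_weight.
rewrite -EFinM lee_fin.
have b0 : 0 < beta + 1 by lra.
have T0 : 0 < 3 `^ (2 + beta) :> R by exact: powR_gt0.
have E : K * (2 * (beta + 1) * A^-1)^-1 =
    pi * (c `^ p * (2 * 3 `^ (2 + beta) / (beta + 1) * (A `^ (q - (3 + beta)) * A))).
  by rewrite /K; field; rewrite !gt_eqF.
rewrite E ler_piMr ?(ltW pi0)//.
have -> : A `^ (q - (3 + beta)) * A = A `^ (q - (2 + beta)).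
  rewrite -{2}[A]powRr1 ?(ltW A0)// -powRD ?(gt_eqF A0) ?implybT//; congr (_ `^ _); ring.
have B0 : 0 <= 2 * 3 `^ (2 + beta) / (beta + 1) * A `^ (q - (2 + beta)).
  by rewrite !mulr_ge0 ?powR_ge0 ?invr_ge0 ?(ltW b0).
apply: le_trans (ler_wpM2r B0 cp) _.
have -> : (beta + 1) / (2 * 3 `^ (2 + beta)) * A `^ (2 + beta - q) *
    (2 * 3 `^ (2 + beta) / (beta + 1) * A `^ (q - (2 + beta))) =
    A `^ (2 + beta - q) * A `^ (q - (2 + beta)).
  by field; rewrite !gt_eqF.
by rewrite -powRD ?(gt_eqF A0) ?implybT// addrC subrKA subrr powRr0.
Qed.

Lemma Bergman_C_nr (p beta : R) : 1 <= p -> -1 < beta ->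
  exists c1 c2 : R, [/\ 0 < c1, 0 < c2 &
     forall (n : nat) (r : R), (1 <= n)%N -> 0 <= r -> r < 1 ->
       ((c1 * (n%:R / (1 - r)) `^ ((2 + beta) / p))%:E
          <= C_nr n r (Bergman p beta) (Bergman_norm p beta))%E /\
       (C_nr n r (Bergman p beta) (Bergman_norm p beta)
          <= (c2 * (n%:R / (1 - r)) `^ ((2 + beta) / p))%:E)%E].
Proof.
move=> p1 b1; have p0 : 0 < p by lra.
have b0 : 0 < beta + 1 by lra.
(* Ensures [2 <= N] and [3 + beta <= N], hence the same for [N p] whatever [p >= 1]. *)
pose N := (Num.truncn (3 + beta)).+2.
have N2 : 2 <= N%:R :> R by rewrite ler_nat.
have Nb : 3 + beta <= N%:R.
  by rewrite ltW// (lt_le_trans (truncnS_gt _))// ler_nat.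
pose q := N%:R * p.
have Nq : N%:R <= q by rewrite /q ler_peMr.
pose cc := (beta + 1) / (2 * 3 `^ (2 + beta)).
have cc0 : 0 < cc by rewrite divr_gt0// mulr_gt0// powR_gt0.
(* At [d = 1 / (8 A)] the mean in [Bergman_good_radius] is at most [m0 A^(1 + beta)]; the factor [A]
   of the interpolation bound raises the exponent to [2 + beta]. *)
pose m0 := 4 * 2 `^ `|beta| * 8 `^ (1 + beta).
have m00 : 0 < m0 by rewrite !mulr_gt0 ?powR_gt0.
exists (cc `^ p^-1 / 4 * (16 * N%:R) ^- N), (132 * m0 `^ p^-1); split.
- by rewrite !mulr_gt0 ?powR_gt0 ?invr_gt0 ?exprn_gt0 ?mulr_gt0//; lra.
- by rewrite mulr_gt0 ?powR_gt0.
move=> n r n1 r0 r1; set A := n%:R / (1 - r).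
have r10 : 0 < 1 - r by rewrite subr_gt0.
have n1' : 1 <= n%:R :> R by rewrite ler1n.
have A1 : 1 <= A by rewrite /A ler_pdivlMr// mul1r; lra.
have A0 : 0 < A by lra.
have Ai0 : 0 < A^-1 by rewrite invr_gt0.
have Ai1 : A^-1 <= 1 by rewrite invf_le1.
split.
  pose s := 1 - A^-1.
  have s0 : 0 <= s by rewrite /s; lra.
  have s1 : s < 1 by rewrite /s; lra.
  (* The largest value that [Bergman_norm_pole] allows. Since [q / p = N], [c A^N] equals
     [cc^(1/p) A^((2 + beta)/p)]. *)
  pose c := (cc * A `^ (2 + beta - q)) `^ p^-1.
  have c0 : 0 <= c by exact: powR_ge0.
  have fh := @holomorphic_pole R s c N s0 s1.
  have fn : (Bergman_norm p beta (fun z => (c%:C / (1 - s%:C * z) ^+ N)%R) <= 1)%E.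
    apply: Bergman_norm_pole => //; rewrite -/q; try lra.
    by rewrite /c -powRrM mulVf ?gt_eqF// powRr1// mulr_ge0 ?powR_ge0 ?(ltW cc0).
  apply: (le_C_nr (sigma := nseq_tuple n (r%:C)) (f := fun z => c%:C / (1 - s%:C * z) ^+ N)).
  - by move=> a /nseqP[-> _]; rewrite cmod_real ger0_norm.
  - by split => //; exact: (le_lt_trans fn (ltry 1)).
  - exact: fn.
  move=> g K gh gf gK.
  apply: (le_trans _ (lower_test (isT : (0 < N)%N) n1 r0 r1 c0 gh gf gK)).
  rewrite -/A /c powRM ?powR_ge0 ?(ltW cc0)// -powRrM.
  have -> : (A / (16 * N%:R)) ^+ N = A ^+ N * (16 * N%:R) ^- N by rewrite exprMn exprVn.
  have -> : A `^ ((2 + beta) / p) = A `^ ((2 + beta - q) / p) * A ^+ N.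
    rewrite -powR_mulrn ?(ltW A0)// -powRD ?(gt_eqF A0) ?implybT//; congr (_ `^ _).
    by rewrite /q; field; rewrite gt_eqF.
  by rewrite le_eqVlt; apply/orP; left; apply/eqP; ring.
apply: C_nr_le => sigma f sr [fh _] fn.
(* The radius found satisfies [1 - rho < d], so [1 - rho^2 <= 2 d = 1 / (4 A)]. *)
pose d := (8 * A)^-1.
have dE : d = A^-1 / 8 by rewrite /d invfM mulrC.
have d0 : 0 < d by rewrite dE; lra.
have d8 : d <= 8^-1 by rewrite dE; lra.
have [rho [h1 h2 h3]] := Bergman_good_radius d0 d8 p1 fh ((Bergman_norm_le1 beta p1 fh).1 fn).
have rho0 : 0 < rho by lra.
have rho1 : rho < 1 by lra.
have rhoA : 1 - rho ^+ 2 <= (4 * A)^-1.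
  have -> : (4 * A)^-1 = 2 * d by rewrite /d; field; lra.
  by nra.
have mp : 0 < 4 * 2 `^ `|beta| * d `^ (- 1 - beta) by rewrite !mulr_gt0 ?powR_gt0.
have [g [gh gf gM]] := hermite_interpolation n1 r0 r1 sr fh rho0 rho1 rhoA p1 mp h3.
exists g; split => // z z1; apply: le_trans (gM z z1) _; rewrite -/A.
have -> : A * (4 * 2 `^ `|beta| * d `^ (- 1 - beta)) = m0 * A `^ (2 + beta).
  have -> : d `^ (- 1 - beta) = 8 `^ (1 + beta) * A `^ (1 + beta).
    rewrite -powRM ?(ltW A0)// (_ : - 1 - beta = - (1 + beta)); last by ring.
    have A80 : 0 <= 8 * A by lra.
    by rewrite powRN /d -powR_inv1 ?powR_ge0// powRAC powR_inv1 ?invr_ge0// invrK.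
  have -> : A `^ (2 + beta) = A `^ (1 + beta) * A.
    rewrite -{3}[A]powRr1 ?(ltW A0)// -powRD ?(gt_eqF A0) ?implybT//; congr (_ `^ _); ring.
  by rewrite /m0; ring.
by rewrite powRM ?powR_ge0 ?(ltW m00)// -powRrM mulrA.
Qed.

End BergmanAsymptotics.

Theorem theorem2p1 (R : realType) (p : R) (hp : 1 <= p) :
  (exists c1 c2 : R, [/\ 0 < c1, 0 < c2 &
     forall (n : nat) (r : R), (1 <= n)%N -> 0 <= r -> r < 1 ->
       ((c1 * (n%:R / (1 - r)) `^ (1 / p))%:E
          <= C_nr n r (Hardy p) (Hardy_norm p))%E /\
       (C_nr n r (Hardy p) (Hardy_norm p)
          <= (c2 * (n%:R / (1 - r)) `^ (1 / p))%:E)%E]) /\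
  (forall beta : R, -1 < beta ->
   exists c1 c2 : R, [/\ 0 < c1, 0 < c2 &
     forall (n : nat) (r : R), (1 <= n)%N -> 0 <= r -> r < 1 ->
       ((c1 * (n%:R / (1 - r)) `^ ((2 + beta) / p))%:E
          <= C_nr n r (Bergman p beta) (Bergman_norm p beta))%E /\
       (C_nr n r (Bergman p beta) (Bergman_norm p beta)
          <= (c2 * (n%:R / (1 - r)) `^ ((2 + beta) / p))%:E)%E]).
Proof.
split; first exact: Hardy_C_nr.
by move=> beta hbeta; exact: Bergman_C_nr.
Qed.
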